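(* Let $L\in(0,\infty]$ and let $\|\cdot\|_{X(0,L)}$ be a rearrangement-invariant function norm on $(0,L)$. Let $\nu\colon(0,L)\to(0,L)$ be an increasing bijection; if $L=\infty$, assume that $\nu\in\underline{D}^{\infty}$. Let $u\colon(0,L)\to(0,\infty)$ be nonincreasing. Let $v\colon(0,L)\to(0,\infty)$ be defined by $$\frac1{v(t)}=\int_0^{\nu^{-1}(t)}\xi(s)\,ds\quad\text{for every } t\in(0,L),$$ where $\xi\colon(0,L)\to(0,\infty)$ is a measurable function. If $L<\infty$, assume that $v(L^-)>0$. Assume that $$\Big\|u(t)\chi_{(0,\nu^{-1}(a))}(t)\int_{\nu(t)}^av(s)\,ds\Big\|_{X(0,L)}<\infty,$$ where $a=L$ if $L<\infty$ and $a=1$ if $L=\infty$, and that the operator $T_\varphi$ with $\varphi=\frac u\xi$ is bounded on $X'(0,L)$. Set, for $f\in\mathfrak M^+(0,L)$, $$\varrho(f)=\sup_{h\sim f}\Big\|u(t)\int_{\nu(t)}^L h(s)v(s)\,ds\Big\|_{X(0,L)},$$ where the supremum extends over all $h\in\mathfrak M^+(0,L)$ equimeasurable with $f$, and $$\widetilde\varrho(f)=\sup_{\substack{g\in\mathfrak M^+(0,L)\\ \|g\|_{X'(0,L)}\le1}}\int_0^Lf^*(t)v(t)\int_0^{\nu^{-1}(t)}T_\varphi g(s)u(s)\,ds\,dt.$$ The functionals $\varrho$ and $\widetilde\varrho$ are rearrangement-invariant function norms. Furthermore, $$\|H_{u,v,\nu}(f^* )\|_{X(0,L)}\le\varrho(f)\le\widetilde\varrho(f)\le\|T_\varphi\|_{X'(0,L)}\|H_{u,v,\nu}(f^*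 )\|_{X(0,L)}$$ for every $f\in\mathfrak M^+(0,L)$, where $\|T_\varphi\|_{X'(0,L)}$ stands for the operator norm of $T_\varphi$ on $X'(0,L)$. In particular, the rearrangement-invariant function norms $\varrho$ and $\widetilde\varrho$ are equivalent.
   Context: Conventions: $\frac1\infty=0\cdot\infty=0$, and $\nu^{-1}(L)=L$ when $L<\infty$. $\mathfrak{M}(0,L)$ is the set of (Lebesgue) measurable functions on $(0,L)$ with values in $[-\infty,\infty]$, and $\mathfrak{M}^+(0,L)$ is the subset of those that are nonnegative a.e. For $f\in\mathfrak M(0,L)$, $f^*(t)=\inf\{\lambda\in(0,\infty):|\{s\in(0,L):|f(s)|>\lambda\}|\le t\}$, $t\in(0,\infty)$, is its nonincreasing rearrangement. Functions $f,g$ are equimeasurable, $f\sim g$, if $|\{|f|>\lambda\}|=|\{|g|>\lambda\}|$ for every $\lambda\in(0,\infty)$. A rearrangement-invariant function norm on $(0,L)$ is a functional $\|\cdot\|_{X(0,L)}\colon\mathfrak{M}^+(0,L)\to[0,\infty]$ such that, for all $f,g,f_k\in\mathfrak M^+(0,L)$ and $\lambda\in[0,\infty)$: (P1) $\|f\|=0$ iff $f=0$ a.e., $\|\lambda f\|=\lambda\|f\|$, $\|f+g\|\le\|f\|+\|g\|$; (P2) $f\le g$ a.e. implies $\|f\|\le\|g\|$; (P3) $f_k\nearrow f$ a.e. implies $\|f_k\|\nearrow\|f\|$; (P4) $\|\chi_E\|<\infty$ for every measurable $E$ of finite measure; (P5) for every measurable $E$ of finite measure there is a finite constant $C_E>0$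 with $\int_E f\le C_E\|f\|$ for all $f$; (P6) $\|f\|=\|g\|$ whenever $f\sim g$. It is extended to $\mathfrak M(0,L)$ by $\|f\|=\|\,|f|\,\|$. The associate function norm is $\|f\|_{X'(0,L)}=\sup\{\int_0^Lf(t)g(t)\,dt: g\in\mathfrak M^+(0,L),\|g\|_{X(0,L)}\le1\}$, $f\in\mathfrak M^+(0,L)$; it is again a rearrangement-invariant function norm. $v(L^-)$ is the left limit at $L$. $\nu\in\underline{D}^\infty$ means that there is $\theta>1$ with $\liminf_{t\to\infty}\frac{\nu(\theta t)}{\nu(t)}>1$. $H_{u,v,\nu}g(t)=u(t)\int_{\nu(t)}^L|g(s)|v(s)\,ds$, $t\in(0,L)$. For $\varphi\colon(0,L)\to(0,\infty)$ measurable, $$T_\varphi f(t)=\frac1{\varphi(t)}\operatorname*{ess\,sup}_{s\in[t,L)}\varphi(s)f^*(s),\quad t\in(0,L),\ f\in\mathfrak M(0,L).$$ $T_\varphi$ is bounded on $X'(0,L)$ if $\|T_\varphi f\|_{X'(0,L)}\le C\|f\|_{X'(0,L)}$ for some $C$ and all $f$; the least such $C$ is its operator norm. Two functionals are equivalent if each is bounded by a constant multiple of the other on $\mathfrak M^+(0,L)$. *)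

(* Defs.v *)
From HB Require Import structures.
From mathcomp Require Import all_boot all_order all_algebra.
From mathcomp Require Import all_classical all_reals all_analysis measurable_realfun.

Set Implicit Arguments.
Unset Strict Implicit.
Unset Printing Implicit Defensive.

Import Order.TTheory GRing.Theory Num.Theory.
Import numFieldNormedType.Exports.

Local Open Scope classical_set_scope.
Local Open Scope ring_scope.
Local Open Scope ereal_scope.

(* The carrier R equipped with the sigma-algebra of Lebesgue measurable sets
   (Caratheodory measurable sets of the Lebesgue outer measure), as opposed to
   the Borel sets that R carries canonically; it is convertible to R. *)
Definition lebR (R : realType) :=
  caratheodory_type ((@wlength R idfun)^*%mu).

Definition leb (R : realType) : {measure set (lebR R) -> \bar R} :=
  @completed_lebesgue_measure R.
Arguments leb {R}.

(* Functions on (0, L) are total functions on R of which only the values on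
   (0, L) matter; a function norm is likewise a functional on R -> \bar R that
   is constrained only on functions that are measurable and nonnegative a.e.
   on (0, L). *)
Section RearrangementInvariantNorms.
Context {R : realType}.
Implicit Types (a t : R) (L b : \bar R) (f g : R -> \bar R).

Definition ioo a b : set R := [set x | (a < x)%R /\ x%:E < b].

Definition ico a b : set R := [set x | (a <= x)%R /\ x%:E < b].

Definition ae_on (D : set R) (P : R -> Prop) : Prop :=
  \forall x \ae (@leb R), D x -> P x.

Definition M L f : Prop := measurable_fun (ioo 0 L : set (lebR R)) (f : lebR R -> \bar R).

Definition Mplus L f : Prop := M L f /\ ae_on (ioo 0 L) (fun x => 0 <= f x).

Definition distr L f (lam : R) : \bar R :=
  leb [set x | ioo 0 L x /\ lam%:E < `|f x|].

Definition equimeasurable L f g : Prop :=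
  forall lam : R, (0 < lam)%R -> distr L f lam = distr L g lam.

Definition rearr L f t : \bar R :=
  ereal_inf [set lam%:E | lam in
    [set lam : R | (0 < lam)%R /\ distr L f lam <= t%:E]].

Definition ess_sup_on (D : set R) f : \bar R :=
  ereal_inf [set y | ae_on D (fun x => f x <= y)].

Record ri_norm L (N : (R -> \bar R) -> \bar R) : Prop := {
  ri_ge0 : forall f, Mplus L f -> 0 <= N f ;
  ri_eq0 : forall f, Mplus L f ->
    (N f = 0 <-> ae_on (ioo 0 L) (fun x => f x = 0)) ;
  ri_homogeneous : forall (lam : R) f, (0 <= lam)%R -> Mplus L f ->
    N (fun x => lam%:E * f x) = lam%:E * N f ;
  ri_triangle : forall f g, Mplus L f -> Mplus L g ->
    N (fun x => f x + g x) <= N f + N g ;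
  ri_monotone : forall f g, Mplus L f -> Mplus L g ->
    ae_on (ioo 0 L) (fun x => f x <= g x) -> N f <= N g ;
  ri_fatou : forall (f_ : nat -> R -> \bar R) f,
    (forall k, Mplus L (f_ k)) -> Mplus L f ->
    ae_on (ioo 0 L) (fun x => nondecreasing_seq (fun k => f_ k x) /\
                              f_ k x @[k --> \oo] --> f x) ->
    nondecreasing_seq (fun k => N (f_ k)) /\ N (f_ k) @[k --> \oo] --> N f ;
  ri_indic : forall E : set (lebR R), measurable E -> E `<=` ioo 0 L ->
    leb E < +oo -> N (fun x => (\1_E x)%:E) < +oo ;
  ri_local_integral : forall E : set (lebR R), measurable E ->
    E `<=` ioo 0 L -> leb E < +oo ->
    exists C : R, (0 < C)%R /\
      forall f, Mplus L f -> \int[leb]_(x in E) f x <= C%:E * N f ;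
  ri_rearrangement : forall f g, Mplus L f -> Mplus L g ->
    equimeasurable L f g -> N f = N g
}.

Definition norm_ext (N : (R -> \bar R) -> \bar R) f : \bar R :=
  N (fun x => `|f x|).

Definition associate L (N : (R -> \bar R) -> \bar R) f : \bar R :=
  ereal_sup [set \int[leb]_(x in ioo 0 L) (f x * g x) | g in
    [set g | Mplus L g /\ N g <= 1]].

Definition op_bound L (N : (R -> \bar R) -> \bar R)
    (T : (R -> \bar R) -> R -> \bar R) (C : R) : Prop :=
  (0 <= C)%R /\ forall f, M L f -> norm_ext N (T f) <= C%:E * norm_ext N f.

Definition bounded_op L N T : Prop := exists C : R, op_bound L N T C.

Definition op_norm L N T : \bar R :=
  ereal_inf [set C%:E | C in op_bound L N T].

Definition equivalent_functionals L (N1 N2 : (R -> \bar R) -> \bar R) : Prop :=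
  (exists C : R, forall f, Mplus L f -> N1 f <= C%:E * N2 f) /\
  (exists C : R, forall f, Mplus L f -> N2 f <= C%:E * N1 f).

End RearrangementInvariantNorms.

Section Operators.
Context {R : realType}.
Implicit Types (t : R) (L : \bar R) (u v nu phi xi : R -> R)
  (f g : R -> \bar R).

Definition increasing_bij L nu : Prop :=
  set_bij (ioo 0 L) (ioo 0 L) nu /\
  forall s t, ioo 0 L s -> ioo 0 L t -> (s < t -> nu s < nu t)%R.

(* The inverse of nu : (0, L) -> (0, L), with nu^-1(L) = L when L < +oo. *)
Definition nuinv L nu t : R :=
  if t%:E == L then t else 'pinv_(fun=> 0%R) (ioo 0 L) nu t.

Definition D_inf_lower nu : Prop :=
  exists theta : R, (1 < theta)%R /\
    1 < limf_einf (fun t => (nu (theta * t) / nu t)%:E) (pinfty_nbhs R).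

Definition left_lim v (l : R) : R := lim (v x @[x --> l^'-]).

Definition Hop L u v nu g t : \bar R :=
  (u t)%:E * \int[leb]_(s in ioo (nu t) L) (`|g s| * (v s)%:E).

Definition Top L phi f t : \bar R :=
  ((phi t)^-1)%:E * ess_sup_on (ico t L) (fun s => (phi s)%:E * rearr L f s).

Definition endpoint L : R := if L is r%:E then r else 1%R.

Definition rho L (N : (R -> \bar R) -> \bar R) u v nu f : \bar R :=
  ereal_sup [set N (fun t => (u t)%:E *
                      \int[leb]_(s in ioo (nu t) L) (h s * (v s)%:E)) | h in
    [set h | Mplus L h /\ equimeasurable L h f]].

Definition rho_tilde L (N : (R -> \bar R) -> \bar R) u v nu phi f : \bar R :=
  ereal_sup [set \int[leb]_(t in ioo 0 L)
      (rearr L f t * (v t)%:E *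
       \int[leb]_(s in ioo 0 (nuinv L nu t)%:E) (Top L phi g s * (u s)%:E)) |
    g in [set g | Mplus L g /\ associate L N g <= 1]].

End Operators.

(* Main.v *)
Require Import Defs.
From HB Require Import structures.
From mathcomp Require Import all_boot all_order all_algebra perm.
From mathcomp Require Import all_classical all_reals all_analysis measurable_realfun.
From mathcomp Require Import ring lra.
Import Order.TTheory GRing.Theory Num.Theory.
Import numFieldNormedType.Exports.
Local Open Scope classical_set_scope.
Local Open Scope ring_scope.
Local Open Scope ereal_scope.

Set Implicit Arguments.
Unset Strict Implicit.
Unset Printing Implicit Defensive.

(** Layer cake formulas turn the Hardy-Littlewood inequality and its saturation
    into statements about level sets. Saturation (resonance): moving the points
    of each level set of a simple function [w] to their rank gives, for every
    [f], some [h ~ f] with [\int f^* w^* <= \int h |w|]; hence the pairing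
    [f |-> \int f^* w^*] is subadditive, and a supremum of such pairings over a
    family of weights [w] is a rearrangement-invariant norm as soon as (P4) and
    (P5) hold.

    Both functionals are such suprema. For [rho] the weights are
    [v(t) \int_0^{nu^-1 t} g u] with [g] in the unit ball of [X'], by Fubini and
    the identity [N = N''] on nonincreasing functions; the latter follows from
    finite-dimensional Hahn-Banach for step functions on a grid and (P3). For
    [rho_tilde] the weights have [T g] in place of [g]: by the definition of [v]
    they are the averages over [(0, nu^-1 t)] with respect to [xi] of the
    nonincreasing function [t |-> esssup_(s >= t) phi(s) g^*(s)], so they are
    nonincreasing, and they dominate those of [g] because [g^* <= T g] a.e. This
    gives [rho <= rho_tilde]; the upper bound is Fubini and Hoelder for [X', X]. *)

(** * Lebesgue measure and rearrangements *)

(** Subadditivity of [rho] is the obstacle: a function equimeasurable with f + g need not split into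
    rearrangements of f and of g. In the pairing \int f^* w^* the rearranging can be moved to w,
    where |f + g| <= |f| + |g| holds pointwise; this is why both functionals are rewritten as
    suprema over weights. The identity N = N'' is needed only for u(t) \int_(nu t)^L h v, which is
    nonincreasing because u is and the domain of integration shrinks as t grows. Its rearrangement
    is a limit of step functions on cells of equal length, where permuting coefficients keeps N, so
    the duality becomes one for a symmetric norm on R^n. The weights of g and T g cannot be compared
    through a pointwise bound on g, since g <= g^* fails in general; integrating against the
    nonincreasing u over initial intervals repairs this. For L = oo the finiteness hypothesis speaks
    only of the endpoint 1, and (P4) needs it for every m >= 1 in place of 1. *)

Lemma le_of_eq d (T : porderType d) (x y : T) : x = y -> (x <= y)%O.
Proof. by move=> ->. Qed.

Section Lebesgue.
Context {R : realType}.
Implicit Types (a b t : R) (L : \bar R) (A B D : set (lebR R)).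

Lemma borel_measurable_leb (A : set R) :
  measurable A -> measurable (A : set (lebR R)).
Proof. exact: sub_caratheodory. Qed.

Lemma borel_measurable_fun_leb d (T : measurableType d) (A : set R) (f : R -> T) :
  measurable A -> measurable_fun A f ->
  measurable_fun (A : set (lebR R)) (f : lebR R -> T).
Proof.
by move=> mA mf _ Y mY; apply: borel_measurable_leb; exact: mf.
Qed.

Lemma leb_lebesgue_measure (A : set R) : leb (A : set (lebR R)) = lebesgue_measure A.
Proof. by []. Qed.

Lemma borel_ioo a L : measurable (ioo a L : set R).
Proof.
apply: is_interval_measurable => x y [ax xL] [ay yL] z /andP[xz zy]; split.
  exact: lt_le_trans ax xz.
by apply: le_lt_trans yL; rewrite lee_fin.
Qed.

Lemma measurable_ioo a L : measurable (ioo a L : set (lebR R)).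
Proof. by apply: borel_measurable_leb; exact: borel_ioo. Qed.

Lemma measurable_ico a L : measurable (ico a L : set (lebR R)).
Proof.
apply: borel_measurable_leb.
apply: is_interval_measurable => x y [ax xL] [ay yL] z /andP[xz zy]; split.
  exact: le_trans ax xz.
by apply: le_lt_trans yL; rewrite lee_fin.
Qed.

Lemma leb_itv (i : interval R) :
  leb ([set` i] : set (lebR R)) =
  (if (i.1 : \bar R) < i.2 then (i.2 : \bar R) - i.1 else 0).
Proof. by rewrite leb_lebesgue_measure lebesgue_measure_itv. Qed.

Lemma ioo_itv a b : ioo a b%:E = `]a, b[%classic.
Proof. by apply/seteqP; split=> x; rewrite /ioo/= in_itv/= lte_fin => /andP. Qed.

Lemma ico_itv a b : ico a b%:E = `[a, b[%classic.
Proof. by apply/seteqP; split=> x; rewrite /ico/= in_itv/= lte_fin => /andP. Qed.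

Lemma leb_ioo_fin a b : (a <= b)%R -> leb (ioo a b%:E : set (lebR R)) = (b - a)%:E.
Proof.
move=> ab; rewrite ioo_itv leb_itv/= lte_fin.
by case: ltrP => // ba; rewrite (@le_anti _ _ a b) ?subrr// ab ba.
Qed.

Lemma leb_ico_fin a b : (a <= b)%R -> leb (ico a b%:E : set (lebR R)) = (b - a)%:E.
Proof.
move=> ab; rewrite ico_itv leb_itv/= lte_fin.
by case: ltrP => // ba; rewrite (@le_anti _ _ a b) ?subrr// ab ba.
Qed.

Lemma leb_ioo0 L : 0 <= L -> leb (ioo 0 L : set (lebR R)) = L.
Proof.
case: L => [b||//].
  by rewrite lee_fin => b0; rewrite leb_ioo_fin// subr0.
move=> _; have -> : (ioo 0 +oo = `]0%R, +oo[%classic :> set R).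
  by apply/seteqP; split=> x; rewrite /ioo/= in_itv/= ltry andbT// => -[].
by rewrite leb_itv /= ltry sube0.
Qed.

Lemma leb_set1 t : leb ([set t] : set (lebR R)) = 0.
Proof. by rewrite leb_lebesgue_measure lebesgue_measure_set1. Qed.

Lemma subset_ioo a a' L L' : (a' <= a)%R -> L <= L' -> ioo a L `<=` ioo a' L'.
Proof.
move=> aa LL x [ax xL]; split; first exact: le_lt_trans ax.
exact: lt_le_trans LL.
Qed.

Lemma subset_ico_ioo t L : ioo 0 L t -> ico t L `<=` ioo 0 L.
Proof. by move=> [t0 _] x [tx xL]; split=> //; exact: lt_le_trans tx. Qed.

Lemma emeasurable_fun_gt d (T : measurableType d) (D : set T) (f : T -> \bar R) :
  (forall r : R, measurable (D `&` [set x | r%:E < f x])) -> measurable_fun D f.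
Proof.
move=> mf mD; apply: (measurability _ (ErealGenOInfty.measurableE R)) => //.
move=> _ [_ [r ->] <-]; rewrite (_ : _ `&` _ = D `&` [set x | r%:E < f x])//.
by apply/seteqP; split=> x -[Dx] /=; rewrite in_itv/= andbT.
Qed.

Lemma monotone_emeasurable_borel (D : set R) (f : R -> \bar R) :
  is_interval D ->
  (forall x y, D x -> D y -> (x <= y)%R -> f y <= f x) \/
  (forall x y, D x -> D y -> (x <= y)%R -> f x <= f y) ->
  measurable_fun D f.
Proof.
move=> iD mono; apply: emeasurable_fun_gt => r.
apply: is_interval_measurable => x y [Dx /= fx] [Dy /= fy] z /andP[xz zy].
have Dz : D z by apply: (iD x y) => //; rewrite xz.
split => //=.
by case: mono => m; [apply: lt_le_trans (m _ _ Dz Dy zy)|apply: lt_le_trans (m _ _ Dx Dz xz)].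
Qed.

Lemma monotone_emeasurable (D : set R) (f : R -> \bar R) :
  is_interval D ->
  (forall x y, D x -> D y -> (x <= y)%R -> f y <= f x) \/
  (forall x y, D x -> D y -> (x <= y)%R -> f x <= f y) ->
  measurable_fun (D : set (lebR R)) (f : lebR R -> \bar R).
Proof.
move=> iD mono; apply: borel_measurable_fun_leb.
  exact: is_interval_measurable.
exact: monotone_emeasurable_borel.
Qed.

Lemma ioo_interval a L : is_interval (ioo a L).
Proof.
move=> x y [ax xL] [ay yL] z /andP[xz zy]; split.
  exact: lt_le_trans ax xz.
by apply: le_lt_trans yL; rewrite lee_fin.
Qed.

Lemma monotone_measurable (D : set R) (f : R -> R) :
  is_interval D ->
  (forall x y, D x -> D y -> (x <= y)%R -> (f y <= f x)%R) \/
  (forall x y, D x -> D y -> (x <= y)%R -> (f x <= f y)%R) ->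
  measurable_fun (D : set (lebR R)) (f : lebR R -> R).
Proof.
move=> iD mono; apply/measurable_EFinP.
exact: monotone_emeasurable.
Qed.

Lemma tonelli_leb (f : lebR R * lebR R -> \bar R) :
  measurable_fun setT f -> (forall x, 0 <= f x) ->
  \int[leb]_x \int[leb]_y f (x, y) = \int[leb]_y \int[leb]_x f (x, y).
Proof. exact: fubini_tonelli. Qed.

End Lebesgue.

Section AlmostEverywhere.
Context d (T : measurableType d) {R : realType}.
Variable mu : {measure set T -> \bar R}.

Lemma ae_le_measure (A B : set T) : measurable A -> measurable B ->
  (\forall x \ae mu, A x -> B x) -> mu A <= mu B.
Proof.
move=> mA mB [N [mN N0 AB]].
apply: (@le_trans _ _ (mu (B `|` N))).
  apply: le_measure; rewrite ?inE//; first exact: measurableU.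
  move=> x Ax; have [Nx|Nx] := pselect (N x); first by right.
  left; apply: contrapT => Bx; apply: Nx; apply: AB => /=.
  by move=> /(_ Ax).
by apply: le_trans (measureU2 mu mB mN) _; rewrite [X in _ + X](_ : _ = 0) ?adde0.
Qed.

End AlmostEverywhere.

(** * Distribution functions and nonincreasing rearrangements *)

Section Rearrangement.
Context {R : realType}.
Implicit Types (a b t lam : R) (L : \bar R) (f g : R -> \bar R).

(** Rearrangements are compared through their superlevel sets at nonnegative reals, which is where
    [rearr_gt] applies. *)
Lemma le_ereal_gt (x y : \bar R) : 0 <= y ->
  (forall r : R, (0 <= r)%R -> r%:E < x -> r%:E < y) -> x <= y.
Proof.
move=> y0 xy; rewrite leNgt; apply/negP => yx.
have : y \is a fin_num.
  by rewrite ge0_fin_numE//; apply: lt_le_trans yx _; rewrite leey.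
move=> /fineK yE; have : (fine y)%:E < y.
  by apply: xy; [exact: fine_ge0|rewrite yE].
by rewrite yE ltxx.
Qed.

Lemma eq_ereal_gt (x y : \bar R) : 0 <= x -> 0 <= y ->
  (forall r : R, (0 <= r)%R -> (r%:E < x) = (r%:E < y)) -> x = y.
Proof.
move=> x0 y0 xy; apply/eqP; rewrite eq_le; apply/andP; split.
  by apply: le_ereal_gt => // r r0; rewrite xy.
by apply: le_ereal_gt => // r r0; rewrite xy.
Qed.

Lemma M_abs L f : M L f -> M L (fun x => `|f x|).
Proof. by move=> mf; exact: measurableT_comp. Qed.

Lemma Mplus_abs L f : M L f -> Mplus L (fun x => `|f x|).
Proof. by move=> mf; split; [exact: M_abs|apply: aeW => x]. Qed.

Lemma measurable_level L f lam : M L f ->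
  measurable ([set x | ioo 0 L x /\ lam%:E < `|f x|] : set (lebR R)).
Proof.
move=> mf; have mI := @measurable_ioo R 0 L.
by apply: emeasurable_fun_o_infty; [exact: mI|exact: M_abs].
Qed.

Lemma le_leb (A B : set (lebR R)) :
  measurable A -> measurable B -> A `<=` B -> leb A <= leb B.
Proof. by move=> mA mB AB; apply: le_measure; rewrite ?inE. Qed.

Lemma distr_ge0 L f lam : 0 <= distr L f lam.
Proof. exact: measure_ge0. Qed.

Lemma distr_le_L L f lam : 0 <= L -> M L f -> distr L f lam <= L.
Proof.
move=> L0 mf; rewrite -[leRHS](leb_ioo0 L0).
apply: le_leb; [exact: measurable_level|exact: measurable_ioo|by move=> x []].
Qed.

Lemma distr_noninc L f lam lam' : M L f -> (lam <= lam')%R ->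
  distr L f lam' <= distr L f lam.
Proof.
move=> mf ll; apply: le_leb; [exact: measurable_level|exact: measurable_level|].
by move=> x [Ix fx]; split=> //; apply: le_lt_trans fx; rewrite lee_fin.
Qed.

(** Right continuity of the distribution function: {|f| > lam} is the increasing union of the sets
    {|f| > lam + 1/(n+1)}. *)
Lemma distr_gt L f lam (y : \bar R) : M L f -> y < distr L f lam ->
  exists lam', (lam < lam')%R /\ y < distr L f lam'.
Proof.
move=> mf yf.
pose F (n : nat) : set (lebR R) := [set x | ioo 0 L x /\ (lam + n.+1%:R^-1)%:E < `|f x|].
have FE : \bigcup_n F n = [set x | ioo 0 L x /\ lam%:E < `|f x|].
  apply/seteqP; split=> x.
    move=> [n _ [Ix fx]]; split=> //; apply: lt_trans fx.
    by rewrite lte_fin ltrDl.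
  move=> [Ix fx].
  have [n nE] : exists n : nat, (lam + n.+1%:R^-1)%:E < `|f x|.
    move: fx; case: `|f x| => [r|_|//]; last by exists 0%N; rewrite ltry.
    rewrite lte_fin -subr_gt0 => r0.
    exists (Num.truncn (r - lam)^-1); rewrite lte_fin -ltrBrDl invf_plt ?posrE//.
    by rewrite truncnS_gt.
  by exists n.
have mF n : measurable (F n) by exact: measurable_level.
have : leb (F n) @[n --> \oo] --> leb (\bigcup_n F n).
  apply: nondecreasing_cvg_mu => //; first exact: bigcup_measurable.
  apply/nondecreasing_seqP => n; apply/subsetPset => x [Ix fx]; split=> //.
  apply: le_lt_trans fx; rewrite lee_fin lerD2l lef_pV2 ?posrE//.
  by rewrite ler_nat.
rewrite FE => cF; apply: contrapT => h.
have : leb [set x | ioo 0 L x /\ lam%:E < `|f x|] <= y.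
  rewrite -(cvg_lim _ cF)//; apply: lime_le; first by apply/cvg_ex; eexists; exact: cF.
  apply: nearW => n; rewrite leNgt; apply/negP => yF; apply: h.
  by exists (lam + n.+1%:R^-1)%R; split=> //; rewrite ltrDl.
by rewrite leNgt -/(distr L f lam) yf.
Qed.

(** The Galois connection between f^* and the distribution function, from which most facts about f^*
    are read off. Right continuity makes the inequality for f^* strict; it also covers lam = 0,
    although the infimum in [rearr] runs over positive values only. *)
Lemma rearr_gt L f lam t : M L f -> (0 <= lam)%R ->
  (lam%:E < rearr L f t) = (t%:E < distr L f lam).
Proof.
move=> mf lam0; apply/idP/idP => [|tf]; last first.
  have [lam' [ll tf']] := distr_gt mf tf.
  apply: (@lt_le_trans _ _ lam'%:E); first by rewrite lte_fin.
  apply: le_ereal_inf_tmp => _ [m [m0 mt] <-]; rewrite lee_fin leNgt; apply/negP => ml.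
  by have := lt_le_trans tf' (distr_noninc mf (ltW ml)); rewrite ltNge mt.
apply: contraLR; rewrite -!leNgt => ft; apply/lee_addgt0Pr => e e0.
apply: ge_ereal_inf; exists (lam + e)%:E; last by rewrite EFinD.
exists (lam + e)%R => //; split; first by rewrite ltr_wpDl.
by apply: le_trans ft; apply: distr_noninc => //; rewrite lerDl ltW.
Qed.

Lemma rearr_ge0 L f t : 0 <= rearr L f t.
Proof. by apply: le_ereal_inf_tmp => _ [m [m0 _] <-]; rewrite lee_fin ltW. Qed.

Lemma abs_rearr L f t : `|rearr L f t| = rearr L f t.
Proof. by rewrite gee0_abs// rearr_ge0. Qed.

Lemma rearr_noninc L f t t' : (t <= t')%R -> rearr L f t' <= rearr L f t.
Proof.
move=> tt; apply: ereal_inf_le_tmp => _ [m [m0 mt] <-]; exists m => //; split=> //.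
by apply: le_trans mt _; rewrite lee_fin.
Qed.

Lemma rearr_M L f : M L (rearr L f).
Proof.
apply: monotone_emeasurable; first exact: ioo_interval.
by left => x y _ _; exact: rearr_noninc.
Qed.

Lemma rearr_Mplus L f : Mplus L (rearr L f).
Proof. by split; [exact: rearr_M|apply: aeW => x _; exact: rearr_ge0]. Qed.

Lemma rearr_level L f lam : 0 <= L -> M L f -> (0 <= lam)%R ->
  [set x | ioo 0 L x /\ lam%:E < `|rearr L f x|] = ioo 0 (distr L f lam).
Proof.
move=> L0 mf lam0; apply/seteqP; split=> x /=.
  by move=> [[x0 _]]; rewrite abs_rearr rearr_gt// => xf; split.
move=> [x0 xf]; split; last by rewrite abs_rearr rearr_gt.
by split=> //; apply: lt_le_trans xf _; exact: distr_le_L.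
Qed.

Lemma distr_rearr L f lam : 0 <= L -> M L f -> (0 <= lam)%R ->
  distr L (rearr L f) lam = distr L f lam.
Proof. by move=> *; rewrite /distr rearr_level// leb_ioo0// distr_ge0. Qed.

Lemma equimeasurable_rearr L f : 0 <= L -> M L f -> equimeasurable L (rearr L f) f.
Proof. by move=> L0 mf lam lam0; rewrite distr_rearr// ltW. Qed.

Lemma eq_rearr L f g : equimeasurable L f g -> rearr L f = rearr L g.
Proof.
move=> fg; apply/funext => t; congr ereal_inf; congr image.
by apply/seteqP; split=> lam /= [lam0]; rewrite fg.
Qed.

Lemma ae_leb_imp (P Q : R -> Prop) : (forall x, P x -> Q x) ->
  (\forall x \ae (@leb R), P x) -> \forall x \ae (@leb R), Q x.
Proof. by move=> PQ; apply: (@filterS (lebR R) (almost_everywhere (@leb R))). Qed.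

Lemma ae_leb_imp2 (P Q S : R -> Prop) : (forall x, P x -> Q x -> S x) ->
  (\forall x \ae (@leb R), P x) -> (\forall x \ae (@leb R), Q x) ->
  \forall x \ae (@leb R), S x.
Proof. by move=> PQ; apply: (@filterS2 (lebR R) (almost_everywhere (@leb R))). Qed.

Lemma ae_onS (D : set R) (P Q : R -> Prop) : (forall x, D x -> P x -> Q x) ->
  ae_on D P -> ae_on D Q.
Proof. by move=> PQ; apply: ae_leb_imp => x h Dx; exact/PQ/h. Qed.

Lemma ae_onS2 (D : set R) (P Q S : R -> Prop) :
  (forall x, D x -> P x -> Q x -> S x) ->
  ae_on D P -> ae_on D Q -> ae_on D S.
Proof.
by move=> PQ; apply: ae_leb_imp2 => x h k Dx; apply: PQ => //; [exact: h|exact: k].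
Qed.

Lemma ae_onW (D : set R) (P : R -> Prop) : (forall x, D x -> P x) -> ae_on D P.
Proof. by move=> h; apply: aeW. Qed.

Lemma le_leb_ae (A B : set (lebR R)) : measurable A -> measurable B ->
  (\forall x \ae (@leb R), A x -> B x) -> leb A <= leb B.
Proof. exact: ae_le_measure. Qed.

Lemma le_distr L f g lam : M L f -> M L g ->
  ae_on (ioo 0 L) (fun x => `|f x| <= `|g x|) -> distr L f lam <= distr L g lam.
Proof.
move=> mf mg fg; apply: le_leb_ae; [exact: measurable_level|exact: measurable_level|].
apply: ae_leb_imp fg => x fg [Ix fx]; split=> //.
exact: lt_le_trans (fg Ix).
Qed.

Lemma rearr_le L f g t : M L f -> M L g ->
  ae_on (ioo 0 L) (fun x => `|f x| <= `|g x|) -> rearr L f t <= rearr L g t.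
Proof.
move=> mf mg fg; apply: le_ereal_gt; first exact: rearr_ge0.
move=> r r0; rewrite !rearr_gt// => tf; apply: lt_le_trans tf _.
exact: le_distr.
Qed.

Lemma distr_gt_cvg L (f_ : nat -> R -> \bar R) f lam (y : \bar R) :
  (forall k, M L (f_ k)) -> M L f ->
  ae_on (ioo 0 L) (fun x => nondecreasing_seq (fun k => `|f_ k x|) /\
                            `|f_ k x| @[k --> \oo] --> `|f x|) ->
  y < distr L f lam -> exists k, y < distr L (f_ k) lam.
Proof.
move=> mf_ mf fE yf.
pose F (n : nat) : set (lebR R) := [set x | ioo 0 L x /\ lam%:E < `|f_ n x|].
have mF n : measurable (F n) by exact: measurable_level.
(* The sets [F n] increase only up to null sets; their finite unions increase everywhere and have
   the same measures. *)
pose G (n : nat) : set (lebR R) := \big[setU/set0]_(i < n.+1) F i.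
have mG n : measurable (G n) by apply: bigsetU_measurable => i _.
have cG : leb (G n) @[n --> \oo] --> leb (\bigcup_n G n).
  apply: nondecreasing_cvg_mu => //; first exact: bigcup_measurable.
  apply/nondecreasing_seqP => n; apply/subsetPset.
  by rewrite /G [X in _ `<=` X]big_ord_recr/=; exact: subsetUl.
have fG : distr L f lam <= leb (\bigcup_n G n).
  apply: le_leb_ae; [exact: measurable_level|exact: bigcup_measurable|].
  apply: ae_leb_imp fE => x fE [Ix fx]; have [_ cf] := fE Ix.
  have [n fn] : exists n, lam%:E < `|f_ n x|.
    apply: contrapT => h; have : `|f x| <= lam%:E.
      rewrite -(cvg_lim _ cf)//; apply: lime_le; first by apply/cvg_ex; eexists; exact: cf.
      by apply: nearW => n; rewrite leNgt; apply/negP => ?; apply: h; exists n.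
    by rewrite leNgt fx.
  exists n => //; rewrite /G big_ord_recr/=; right; split => //.
apply: contrapT => h.
have : leb (\bigcup_n G n) <= y.
  rewrite -(cvg_lim _ cG)//; apply: lime_le; first by apply/cvg_ex; eexists; exact: cG.
  apply: nearW => n; apply: (@le_trans _ _ (leb (F n))); last first.
    by rewrite leNgt; apply/negP => yF; apply: h; exists n.
  apply: le_leb_ae => //.
  apply: ae_leb_imp fE => x fE; rewrite /G -bigcup_mkord => -[i /= ilt [Ix fi]].
  split=> //; have [nd _] := fE Ix.
  by apply: lt_le_trans fi (nd _ _ _); rewrite -ltnS.
by rewrite leNgt (lt_le_trans yf fG).
Qed.

Lemma rearr_cvg L (f_ : nat -> R -> \bar R) f t :
  (forall k, M L (f_ k)) -> M L f ->
  ae_on (ioo 0 L) (fun x => nondecreasing_seq (fun k => `|f_ k x|) /\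
                            `|f_ k x| @[k --> \oo] --> `|f x|) ->
  nondecreasing_seq (fun k => rearr L (f_ k) t) /\
  rearr L (f_ k) t @[k --> \oo] --> rearr L f t.
Proof.
move=> mf_ mf fE.
have nd : nondecreasing_seq (fun k => rearr L (f_ k) t).
  move=> m n mn; apply: rearr_le => //.
  by apply: ae_onS fE => x _ [nd _]; exact: nd.
split=> //.
suff -> : rearr L f t = ereal_sup (range (fun k => rearr L (f_ k) t)).
  exact: ereal_nondecreasing_cvgn.
apply/eqP; rewrite eq_le; apply/andP; split.
  apply: le_ereal_gt.
    by apply: le_ereal_sup_tmp; exists (rearr L (f_ 0%N) t); [exists 0%N|exact: rearr_ge0].
  move=> r r0; rewrite rearr_gt// => /(distr_gt_cvg mf_ mf fE) [k tk].
  apply: (@lt_le_trans _ _ (rearr L (f_ k) t)); first by rewrite rearr_gt.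
  by apply: ereal_sup_ubound; exists k.
apply: ge_ereal_sup => _ [k _ <-]; apply: rearr_le => //.
apply: ae_onS fE => x _ [ndx cf].
rewrite -(cvg_lim _ cf)//; apply: (@le_trans _ _ (ereal_sup (range (fun k => `|f_ k x|)))).
  by apply: ereal_sup_ubound; exists k.
by rewrite (cvg_lim _ (ereal_nondecreasing_cvgn ndx)).
Qed.

Lemma M_scale L (c : R) f : M L f -> M L (fun x => c%:E * f x).
Proof. by move=> mf; apply: emeasurable_funM => //; exact: measurable_cst. Qed.

Lemma rearr_scale L (c : R) f t : (0 < c)%R -> M L f ->
  rearr L (fun x => c%:E * f x) t = c%:E * rearr L f t.
Proof.
move=> c0 mf; apply: eq_ereal_gt => [||r r0].
- exact: rearr_ge0.
- by rewrite mule_ge0 ?rearr_ge0// lee_fin ltW.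
rewrite rearr_gt//; last exact: M_scale.
have cE (x : \bar R) : (r%:E < c%:E * x) = ((c^-1 * r)%:E < x).
  by rewrite EFinM lte_pdivrMl.
rewrite cE rearr_gt//; last by rewrite mulr_ge0// invr_ge0 ltW.
congr (_ < leb _); apply/seteqP; split=> x /= [Ix];
  by rewrite abseM /= gtr0_norm// cE.
Qed.

(** If f(t) <= r, monotonicity puts {f > r} inside (0, t). Equality may fail at jumps, since f^* is
    right continuous and f need not be. *)
Lemma rearr_le_noninc L f t : 0 <= L -> M L f -> ioo 0 L t ->
  (forall x, ioo 0 L x -> 0 <= f x) ->
  (forall x y, ioo 0 L x -> ioo 0 L y -> (x <= y)%R -> f y <= f x) ->
  rearr L f t <= f t.
Proof.
move=> L0 mf It f0 fni; apply: le_ereal_gt; first exact: f0.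
move=> r r0; rewrite rearr_gt// => tf; rewrite ltNge; apply/negP => ft.
suff : distr L f r <= t%:E by rewrite leNgt tf.
move: (It) => [t0 tL].
have -> : t%:E = leb (ioo 0 t%:E : set (lebR R)) by rewrite leb_ioo0// lee_fin ltW.
apply: le_leb; [exact: measurable_level|exact: measurable_ioo|].
move=> x [Ix fx]; have [x0 xL] := Ix; split=> //; rewrite lte_fin ltNge; apply/negP => tx.
suff : `|f x| <= r%:E by rewrite leNgt fx.
by rewrite gee0_abs ?f0//; apply: le_trans ft; exact: fni.
Qed.

End Rearrangement.

(** * Layer cake formula and Hardy-Littlewood inequality *)

Section LayerCake.
Context d (T : measurableType d) {R : realType}.
Variable mu : {sigma_finite_measure set T -> \bar R}.
Implicit Types f g : T -> \bar R.

Let GR := measurableTypeR R.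
Let leb1 : {sigma_finite_measure set GR -> \bar R} := @lebesgue_measure R.
Let P : set GR := `]0%R, +oo[%classic.

Let mP : measurable P. Proof. exact: measurable_itv. Qed.

Let lambda_section f x : 0 <= f x ->
  (\int[leb1]_l (\1_(P `&` [set l : GR | (l%:E < f x)%E]) l)%:E) = f x.
Proof.
move=> fx0; have -> : P `&` [set l : GR | l%:E < f x] = ioo 0 (f x).
  by apply/seteqP; split=> l; rewrite /P/= in_itv/= andbT.
rewrite integral_indic//; last exact: borel_ioo.
by rewrite setIT; exact: leb_ioo0.
Qed.

Lemma layer_cake f g : measurable_fun setT f -> measurable_fun setT g ->
  (forall x, 0 <= f x) -> (forall x, 0 <= g x) ->
  \int[mu]_x (f x * g x) =
  \int[leb1]_(l in P) \int[mu]_(x in [set x | l%:E < f x]) g x.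
Proof.
move=> mf mg f0 g0.
(* The region 0 < l < f(x), whose section at x has length f(x). Tonelli is applied to its indicator
   times g(x). *)
pose A : set (T * GR) := (snd @^-1` P) `&` [set z | (z.2)%:E < f z.1].
have mA : measurable A.
  apply: measurableI; first by rewrite -[X in measurable X]setTI; exact: measurable_snd.
  rewrite -[X in measurable X]setTI; apply: measurable_lte => //.
    by apply: measurableT_comp => //; exact: measurable_snd.
  by apply: measurableT_comp => //; exact: measurable_fst.
pose F (z : T * GR) := g z.1 * (\1_A z)%:E.
have mF : measurable_fun setT F.
  apply: emeasurable_funM; last by apply/measurable_EFinP; exact: measurable_indic.
  by apply: measurableT_comp => //; exact: measurable_fst.
have F0 z : 0 <= F z by rewrite mule_ge0// lee_fin.
transitivity (\int[mu]_x \int[leb1]_l F (x, l)).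
  apply: eq_integral => x _; rewrite /F/= ge0_integralZl//; last first.
    apply/measurable_EFinP.
    by apply: (@measurableT_comp _ _ _ _ _ _ (\1_A : T * GR -> R)).
  rewrite [LHS]muleC; congr (_ * _); rewrite -[LHS](lambda_section (f0 x)).
  apply: eq_integral => l _; rewrite !indicE; congr ((nat_of_bool _)%:R%:E).
transitivity (\int[leb1]_l \int[mu]_x F (x, l)).
  exact: (fubini_tonelli F mF F0).
rewrite [RHS]integral_mkcond.
apply: eq_integral => l _; rewrite patchE; case: ifPn => [|lP].
  move=> lP; rewrite [RHS]integral_mkcond; apply: eq_integral => x _.
  rewrite patchE /F/= indicE.
  have -> : ((x, l) \in A) = (x \in [set x | l%:E < f x]).
    apply/idP/idP; rewrite !inE /A/=; first by case.
    by move=> lf; split=> //; rewrite inE in lP.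
  by case: ifP => _; rewrite ?mule1 ?mule0.
rewrite [LHS]integral0_eq// => x _; rewrite /F/= indicE/= memNset ?mule0//.
by move=> [Pl _]; move/negP : lP; apply; rewrite inE.
Qed.

Lemma integral_superlevel (A : set T) g : measurable A ->
  measurable_fun setT g -> (forall x, 0 <= g x) ->
  \int[mu]_(x in A) g x =
  \int[leb1]_(k in P) mu (A `&` [set x | k%:E < g x]).
Proof.
move=> mA mg g0; rewrite integral_mkcond epatch_indic layer_cake//; last 2 first.
- by apply/measurable_EFinP; exact: measurable_indic.
- by move=> x; rewrite lee_fin.
apply: eq_integral => k _; rewrite integral_indic//.
by rewrite -[X in measurable X]setTI; exact: emeasurable_fun_o_infty.
Qed.

(** Two layer cakes turn \int f g into a double integral of the measure of {f > l} meeting {g > k},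
    so a comparison at each pair of positive levels suffices. *)
Lemma le_integral_levels f g f' g' :
  measurable_fun setT f -> measurable_fun setT g ->
  measurable_fun setT f' -> measurable_fun setT g' ->
  (forall x, 0 <= f x) -> (forall x, 0 <= g x) ->
  (forall x, 0 <= f' x) -> (forall x, 0 <= g' x) ->
  (forall l k : R, (0 < l)%R -> (0 < k)%R ->
    mu ([set x | l%:E < f x] `&` [set x | k%:E < g x]) <=
    mu ([set x | l%:E < f' x] `&` [set x | k%:E < g' x])) ->
  \int[mu]_x (f x * g x) <= \int[mu]_x (f' x * g' x).
Proof.
have lev (h : T -> \bar R) (l : R) : measurable_fun setT h ->
    measurable [set x | l%:E < h x].
  by move=> mh; rewrite -[X in measurable X]setTI; exact: emeasurable_fun_o_infty.
have iP : is_interval P by exact: interval_is_interval.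
have mono (A : set T) (h : T -> \bar R) : measurable A -> measurable_fun setT h ->
    measurable_fun P (fun k : R => mu (A `&` [set x | k%:E < h x])).
  move=> mA mh; apply: monotone_emeasurable_borel => //; left => k k' _ _ kk.
  apply: le_measure; rewrite ?inE.
  - by apply: measurableI => //; exact: lev.
  - by apply: measurableI => //; exact: lev.
  - by move=> x [Ax /= hx]; split=> //=; apply: le_lt_trans hx; rewrite lee_fin.
have mono2 (h h' : T -> \bar R) : measurable_fun setT h -> measurable_fun setT h' ->
    (forall x, 0 <= h' x) ->
    measurable_fun P (fun l : R => \int[mu]_(x in [set x | l%:E < h x]) h' x).
  move=> mh mh' h'0; apply: monotone_emeasurable_borel => //; left => k k' _ _ kk.
  apply: ge0_subset_integral => //; [exact: lev|exact: lev| |].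
  - exact: measurable_funTS.
  - by move=> x /=; apply: le_lt_trans; rewrite lee_fin.
move=> mf mg mf' mg' f0 g0 f'0 g'0 fg.
rewrite !layer_cake//; apply: ge0_le_integral => //.
- by move=> l _; apply: integral_ge0 => x _.
- exact: mono2.
- exact: mono2.
move=> l; rewrite /P/= in_itv/= andbT => l0.
rewrite !integral_superlevel//; [|exact: lev|exact: lev].
apply: ge0_le_integral => //.
- by apply: mono => //; exact: lev.
- by apply: mono => //; exact: lev.
by move=> k; rewrite /P/= in_itv/= andbT => k0; exact: fg.
Qed.

End LayerCake.

Section HardyLittlewood.
Context {R : realType}.
Implicit Types (L : \bar R) (f g : R -> \bar R).

(** Reduces to the whole line: extending by zero outside D adds no points to superlevel sets at
    positive levels. *)
Lemma le_integral_leb_levels (D : set R) (f g f' g' : R -> \bar R) :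
  measurable (D : set (lebR R)) ->
  measurable_fun (D : set (lebR R)) (f : lebR R -> \bar R) ->
  measurable_fun (D : set (lebR R)) (g : lebR R -> \bar R) ->
  measurable_fun (D : set (lebR R)) (f' : lebR R -> \bar R) ->
  measurable_fun (D : set (lebR R)) (g' : lebR R -> \bar R) ->
  (forall x, 0 <= f x) -> (forall x, 0 <= g x) ->
  (forall x, 0 <= f' x) -> (forall x, 0 <= g' x) ->
  (forall l k : R, (0 < l)%R -> (0 < k)%R ->
    leb [set x : lebR R | [/\ D x, l%:E < f x & k%:E < g x]] <=
    leb [set x : lebR R | [/\ D x, l%:E < f' x & k%:E < g' x]]) ->
  \int[leb]_(x in D) (f x * g x) <= \int[leb]_(x in D) (f' x * g' x).
Proof.
move=> mD mf mg mf' mg' f0 g0 f'0 g'0 fg.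
have pE (h k : R -> \bar R) : (fun x : lebR R => h x * k x) \_ D =
    (fun x : lebR R => (h \_ D) x * (k \_ D) x).
  by apply/funext => x; rewrite !patchE; case: ifP => // _; rewrite mul0e.
have p0 (h : R -> \bar R) : (forall x, 0 <= h x) -> forall x, 0 <= (h \_ D) x.
  by move=> h0 x; rewrite patchE; case: ifP.
have lE (h k : R -> \bar R) (l m : R) : (0 < l)%R -> (0 < m)%R ->
    [set x : lebR R | l%:E < (h \_ D) x] `&` [set x | m%:E < (k \_ D) x] =
    [set x : lebR R | [/\ D x, l%:E < h x & m%:E < k x]].
  move=> l0 m0; apply/seteqP; split=> x; rewrite /= !patchE; case: ifPn => //.
  - by rewrite inE => Dx [].
  - by rewrite lte_fin ltNge ltW//= => _ [].
  - by move=> _ [].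
  - by move/negP => + [Dx _ _]; rewrite inE.
rewrite [leLHS]integral_mkcond [leRHS]integral_mkcond !pE.
apply: (@le_integral_levels _ (lebR R) R leb); try exact: p0;
  try exact/(measurable_restrictT _ mD).
by move=> l k l0 k0; rewrite !lE//; exact: fg.
Qed.

(** Superlevel sets of f^* and g^* are nested initial intervals, so they meet in the smaller of the
    two measures, the most that two sets of these measures can share. *)
Lemma hardy_littlewood L f g : 0 <= L -> M L f -> M L g ->
  \int[leb]_(x in ioo 0 L) (`|f x| * `|g x|) <=
  \int[leb]_(x in ioo 0 L) (rearr L f x * rearr L g x).
Proof.
move=> L0 mf mg; apply: le_integral_leb_levels.
- exact: measurable_ioo.
- exact: M_abs.
- exact: M_abs.
- exact: rearr_M.
- exact: rearr_M.
- by [].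
- by [].
- by move=> x; exact: rearr_ge0.
- by move=> x; exact: rearr_ge0.
move=> l k l0 k0.
have -> : [set x : lebR R | [/\ ioo 0 L x, l%:E < rearr L f x & k%:E < rearr L g x]] =
    ioo 0 (mine (distr L f l) (distr L g k)).
  apply/seteqP; split=> x /=.
    by move=> [[x0 _]]; rewrite !rearr_gt ?ltW// => xf xg; split=> //; rewrite lt_min xf.
  move=> [x0]; rewrite lt_min => /andP[xf xg]; rewrite !rearr_gt ?ltW//; split=> //.
  by split=> //; apply: lt_le_trans xf _; exact: distr_le_L.
rewrite leb_ioo0 ?le_min ?distr_ge0//.
have mI (h h' : R -> \bar R) (a b : R) : M L h -> M L h' ->
    measurable [set x : lebR R | [/\ ioo 0 L x, a%:E < `|h x| & b%:E < `|h' x|]].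
  move=> mh mh'; rewrite (_ : mkset _ =
    [set x : lebR R | ioo 0 L x /\ a%:E < `|h x|] `&`
    [set x : lebR R | ioo 0 L x /\ b%:E < `|h' x|]).
    by apply: measurableI; exact: measurable_level.
  by apply/seteqP; split=> x /= => [[]|[[] ? ? []]].
apply/andP; split; apply: le_leb.
- exact: mI.
- exact: measurable_level.
- by move=> x [].
- exact: mI.
- exact: measurable_level.
- by move=> x [].
Qed.

End HardyLittlewood.

(** * Resonance *)

Section Cut.
Context {R : realType}.
Implicit Types (B : set R) (c : \bar R).

Lemma le_leb_trunc B (c : \bar R) : measurable (B : set (lebR R)) ->
  (forall x, B x -> (0 < x)%R) ->
  (forall s : R, leb (B `&` ioo 0 s%:E : set (lebR R)) <= c) -> leb (B : set (lebR R)) <= c.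
Proof.
move=> mB B0 Bc.
pose F (n : nat) : set (lebR R) := B `&` ioo 0 (n%:R%:E).
have mF n : measurable (F n) by apply: measurableI => //; exact: measurable_ioo.
have FE : \bigcup_n F n = B.
  apply/seteqP; split=> [x [n _ []]//|x Bx].
  exists (Num.truncn x).+1 => //; split=> //; split; first exact: B0.
  by rewrite lte_fin truncnS_gt.
have : leb (F n) @[n --> \oo] --> leb (\bigcup_n F n).
  apply: nondecreasing_cvg_mu => //; first exact: bigcup_measurable.
  apply/nondecreasing_seqP => n; apply/subsetPset => x [Bx [x0 xn]]; split=> //.
  by split=> //; apply: lt_trans xn _; rewrite lte_fin ltr_nat.
rewrite FE => cF; rewrite -(cvg_lim _ cF)//.
apply: lime_le; first by apply/cvg_ex; eexists; exact: cF.
by apply: nearW => n; exact: Bc.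
Qed.

Lemma le_leb_itv_cover (A C : set R) (a b : R) : measurable (A : set (lebR R)) ->
  measurable (C : set (lebR R)) -> (a <= b)%R ->
  A `<=` C `|` `[a, b]%classic ->
  leb (A : set (lebR R)) <= leb (C : set (lebR R)) + (b - a)%:E.
Proof.
move=> mA mC ab AC.
have mI : measurable (`[a, b]%classic : set (lebR R)).
  by apply: borel_measurable_leb; exact: measurable_itv.
apply: (@le_trans _ _ (leb (C `|` `[a, b]%classic : set (lebR R)))).
  by apply: le_leb => //; exact: measurableU.
apply: le_trans (measureU2 leb mC mI) _; rewrite leeD2l//.
rewrite [leLHS](leb_itv `[a, b]) /= lte_fin; case: ifPn => // _.
by rewrite lee_fin subr_ge0.
Qed.

Definition rank_lt B c : set R := [set t | leb (B `&` ioo 0 t%:E : set (lebR R)) < c].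

Lemma measurable_rank_lt B c : measurable (B : set (lebR R)) ->
  measurable (rank_lt B c : set (lebR R)).
Proof.
move=> mB; apply: borel_measurable_leb; apply: is_interval_measurable => x y /= _ yc z.
move=> /andP[xz zy]; apply: le_lt_trans yc; apply: le_leb.
- by apply: measurableI => //; exact: measurable_ioo.
- by apply: measurableI => //; exact: measurable_ioo.
- by apply: setIS; apply: subset_ioo.
Qed.

Lemma rank_lt_down B c s t : measurable (B : set (lebR R)) ->
  (s <= t)%R -> rank_lt B c t -> rank_lt B c s.
Proof.
move=> mB st; apply: le_lt_trans; apply: le_leb.
- by apply: measurableI => //; exact: measurable_ioo.
- by apply: measurableI => //; exact: measurable_ioo.
- by apply: setIS; apply: subset_ioo.
Qed.

Lemma rank_lt_le0 B c t : 0 < c -> (t <= 0)%R -> rank_lt B c t.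
Proof.
move=> c0 t0; rewrite /rank_lt/= (_ : _ `&` _ = set0) ?measure0//.
apply/seteqP; split=> // x [_ [x0]]; rewrite lte_fin => xt.
by have := lt_trans x0 xt; rewrite ltNge t0.
Qed.

(* The function t |-> |B `&` (0,t)| pushes Lebesgue measure on B forward to
   Lebesgue measure on (0,|B|). *)
Lemma leb_rank_lt B c : measurable (B : set (lebR R)) ->
  (forall x, B x -> (0 < x)%R) -> 0 <= c ->
  leb (B `&` rank_lt B c : set (lebR R)) = mine c (leb (B : set (lebR R))).
Proof.
move=> mB B0; rewrite le_eqVlt => /predU1P[<-|c0].
  rewrite (_ : _ `&` _ = set0).
    by rewrite measure0 min_l//; exact: measure_ge0.
  apply/seteqP; split=> // x [_]; rewrite /rank_lt/= ltNge => /negP; apply.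
  exact: measure_ge0.
have mJ := measurable_rank_lt c mB.
have mS : measurable (B `&` rank_lt B c : set (lebR R)) by exact: measurableI.
have mI (a b : R) : measurable (ioo a b%:E : set (lebR R)) by exact: measurable_ioo.
have mBI (s : R) : measurable (B `&` ioo 0 s%:E : set (lebR R)) by exact: measurableI.
apply/eqP; rewrite eq_le; apply/andP; split.
  rewrite le_min; apply/andP; split; last by apply: le_leb => //; exact: subIsetl.
  apply: le_leb_trunc => // [x []/B0//|s].
  apply/lee_addgt0Pr => e e0.
  (* The rank is nondecreasing, so the points of rank below c form a down-set. Up to a piece of
     length e this set lies below some t in [J], whose own rank is below c. The maximum with 0 keeps
     0 in [J] when s < 0. *)
  pose J := [set t | (0 <= t)%R /\ (t <= Num.max s 0%R)%R /\ rank_lt B c t].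
  have J0 : J 0%R by rewrite /J/= lexx le_max lexx orbT; split=> //; split=> //; exact: rank_lt_le0.
  have supJ : has_sup J.
    by split; [exists 0%R|exists (Num.max s 0%R) => x [_ []]].
  have [t [t0 [ts Jt]] tt] := sup_adherent e0 supJ.
  apply: (@le_trans _ _ (leb (B `&` ioo 0 t%:E : set (lebR R)) + (t + e - t)%:E)).
    apply: le_leb_itv_cover => //; first exact: measurableI.
      by rewrite lerDl ltW.
    move=> x [[Bx Jx] [x0 xs]]; have [xt|tx] := ltP x t; [left|right] => //.
    rewrite /= in_itv/= tx/= ltW// -ltrBlDr; apply: le_lt_trans tt; rewrite lerD2r.
    apply: ub_le_sup; first by exists (Num.max s 0%R) => y [_ []].
    rewrite /J/= (ltW x0); split=> //; split=> //.
    by rewrite le_max ltW.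
  by rewrite [(t + e)%R]addrC addrK leeD2r// ltW.
rewrite ge_min; case: (leP c (leb (B `&` rank_lt B c : set (lebR R)))) => //= Sc.
apply: le_leb => //.
suff allJ t : rank_lt B c t by move=> x Bx; split=> //; exact: allJ.
apply: contrapT => Jt.
(* Just above the supremum of the points of rank below c the rank is at least c, while the part of B
   below that supremum lies in the set to be measured; the gap costs at most e. *)
pose J := [set x | (x <= t)%R /\ rank_lt B c x].
have supJ : has_sup J.
  split; last by exists t => x [].
  exists (Num.min t 0%R); split; first by rewrite ge_min lexx.
  by apply: rank_lt_le0 => //; rewrite ge_min lexx orbT.
move: Sc; rewrite ltNge => /negP; apply; apply/lee_addgt0Pr => e e0.
apply: (@le_trans _ _ (leb (B `&` ioo 0 (sup J + e)%:E : set (lebR R)))).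
  rewrite leNgt; apply/negP => Je.
  have [et|te] := leP (sup J + e)%R t.
    have : (sup J + e <= sup J)%R.
      by apply: ub_le_sup; [exists t => x []|split].
    by rewrite gerDl leNgt e0.
  by apply: Jt; apply: rank_lt_down Je => //; exact: ltW.
rewrite -[e in leRHS](addrK (sup J)) [(e + _)%R]addrC.
apply: le_leb_itv_cover => //; first by rewrite lerDl ltW.
move=> x [Bx [x0 xe]]; have [xJ|Jx] := ltP x (sup J); [left|right].
  split=> //; have xJ0 : (0 < sup J - x)%R by rewrite subr_gt0.
  have [y [_ Jy]] := sup_adherent xJ0 supJ.
  by rewrite subKr => xy; apply: rank_lt_down Jy => //; exact: ltW.
by rewrite /= in_itv/= Jx/= ltW// -lte_fin.
Qed.

End Cut.

Section Resonance.
Context {R : realType}.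
Variables (L : \bar R) (l : R -> nat) (m : nat).
Hypothesis L0 : 0 <= L.

Let E (i : nat) : set R := [set x | ioo 0 L x /\ (i <= l x)%N].

Hypothesis mE : forall i, measurable (E i : set (lebR R)).
Hypothesis E1 : leb (E 1%N : set (lebR R)) < +oo.
Hypothesis lm : forall x, (l x <= m)%N.

Let B (i : nat) : set R := [set x | ioo 0 L x /\ l x = i].

Let BE i : B i = E i `\` E i.+1.
Proof.
apply/seteqP; split=> x /=.
  by move=> [Ix <-]; split=> // -[_]; rewrite ltnn.
move=> [[Ix il] /not_andP [//|/negP]]; rewrite -leqNgt => li; split=> //.
by apply/eqP; rewrite eqn_leq il li.
Qed.

Let mB i : measurable (B i : set (lebR R)).
Proof. by rewrite BE; exact: measurableD. Qed.

Let EB i : E i = E i.+1 `|` B i.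
Proof.
rewrite BE; apply/seteqP; split=> x /=.
  by move=> Ex; have [Ex'|Ex'] := pselect (E i.+1 x); [left|right].
by move=> [[Ix il]|[]//]; split=> //; exact: ltnW.
Qed.

Let a i := leb (E i.+1 : set (lebR R)).

Let a_fin i : a i \is a fin_num.
Proof.
rewrite ge0_fin_numE; last exact: measure_ge0.
apply: le_lt_trans E1; apply: le_leb => //.
by move=> x [Ix il]; split=> //; exact: leq_trans il.
Qed.

Let b x := leb (B (l x) `&` ioo 0 x%:E : set (lebR R)).

Let b_fin x : b x \is a fin_num.
Proof.
have mx : measurable (ioo 0 x%:E : set (lebR R)) by exact: measurable_ioo.
rewrite ge0_fin_numE; last exact: measure_ge0.
apply: (@le_lt_trans _ _ (leb (ioo 0 x%:E : set (lebR R)))).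
  by apply: le_leb; [exact: measurableI|exact: mx|exact: subIsetr].
have [x0|x0] := leP 0%R x; first by rewrite leb_ioo_fin// ltry.
rewrite (_ : ioo 0 x%:E = set0) ?measure0//.
apply/seteqP; split=> // y [y0]; rewrite lte_fin => yx.
by have := lt_trans y0 yx; rewrite ltNge ltW.
Qed.

(* A point of level [i] is sent past all points of higher levels and, inside
   its level set, to its rank; hence sigma is measure preserving and maps each
   superlevel set of [l] onto an initial interval. *)
Let sigma x : R := fine (a (l x) + b x).

Let sigmaE x : (sigma x)%:E = a (l x) + b x.
Proof. by rewrite fineK// fin_numD a_fin b_fin. Qed.

Let S (i : nat) (c : \bar R) : set R := E i `&` [set x | (sigma x)%:E < c].

Let T (i : nat) (c : \bar R) : set R := B i `&` [set x | (sigma x)%:E < c].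

Let TE i c : T i c = B i `&` rank_lt (B i) (c - a i).
Proof.
have sE x : B i x ->
    ((sigma x)%:E < c) = (leb (B i `&` ioo 0 x%:E : set (lebR R)) < c - a i).
  by move=> [_ lx]; rewrite sigmaE /b lx lteBrDl// a_fin.
by apply/seteqP; split=> x [Bx /=]; rewrite /rank_lt/= ?sE// => h; split=> //=; rewrite sE.
Qed.

Let mT i c : measurable (T i c : set (lebR R)).
Proof. by rewrite TE; apply: measurableI => //; exact: measurable_rank_lt. Qed.

Let SE i c : S i c = S i.+1 c `|` T i c.
Proof. by rewrite /S EB setIUl. Qed.

Let E_empty i : (m < i)%N -> E i = set0.
Proof.
move=> mi; apply/seteqP; split=> // x [_ il].
by have := leq_trans il (lm x); rewrite leqNgt mi.
Qed.

Let disjB i c : [disjoint S i.+1 c & T i c].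
Proof.
by apply/disj_setPS => x [[[_ il] _] [[_ li] _]]; move: il; rewrite li ltnn.
Qed.

(** This is what measure preservation of [sigma] on {l >= i} amounts to. Descending induction on the
    level: k bounds the number of levels that remain, and above m all sets are empty. *)
Let leb_S_aux k i c : (m < i + k)%N -> 0 <= c ->
  measurable (S i c : set (lebR R)) /\
  leb (S i c : set (lebR R)) = mine c (leb (E i : set (lebR R))).
Proof.
elim: k i => [|k IH] i mik c0.
  rewrite addn0 in mik.
  have S0 : S i c = set0 by rewrite /S E_empty// set0I.
  by rewrite S0 E_empty// measure0 min_r//; split.
have [mS lS] : measurable (S i.+1 c : set (lebR R)) /\
    leb (S i.+1 c : set (lebR R)) = mine c (a i).
  by apply: IH => //; rewrite addSnnS.
rewrite SE; split; first exact: measurableU.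
have U2 (X Y : set (lebR R)) : measurable X -> measurable Y -> [disjoint X & Y] ->
    leb (X `|` Y) = leb X + leb Y.
  by move=> mX mY dXY; rewrite measureU//; exact/disj_set2P.
have lE : leb (E i : set (lebR R)) = a i + leb (B i : set (lebR R)).
  rewrite {1}(EB i); apply: U2 => //.
  by apply/disj_setPS => x [[_ il] [_ li]]; move: il; rewrite li ltnn.
rewrite U2// lS TE.
have B0 x : B i x -> (0 < x)%R by move=> [[]].
(* If c <= a i, the images of the higher levels already fill (0, c), and level i contributes
   nothing. *)
have [ca|ac] := leP c (a i).
  rewrite min_l; last by rewrite lE; apply: le_trans ca _; rewrite leeDl.
  rewrite (_ : _ `&` _ = set0) ?measure0 ?adde0//.
  apply/seteqP; split=> // x [_]; rewrite /rank_lt/= ltNge => /negP; apply.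
  by apply: (@le_trans _ _ 0); [rewrite leeBlDr// add0e|exact: measure_ge0].
rewrite leb_rank_lt//; last by rewrite sube_ge0 ?ltW// a_fin.
rewrite lE; rewrite -{1}(fineK (a_fin i)) ; move: ac lE; rewrite -(fineK (a_fin i)) => ac lE.
rewrite /mine; case: ifPn => cB.
  rewrite addeC subeK// ifT//.
  by move: cB; rewrite lteBlDl.
by rewrite ifF//; apply/negbTE; move: cB; rewrite -!leNgt leeBrDl.
Qed.

Let leb_S i c : 0 <= c ->
  measurable (S i c : set (lebR R)) /\
  leb (S i c : set (lebR R)) = mine c (leb (E i : set (lebR R))).
Proof. by apply: (@leb_S_aux m.+1); rewrite ltn_addl. Qed.

(** The witness h is f^* composed with [sigma]. Its superlevel sets are {sigma < distr f r}, and
    those of w are sets {l >= i}; by [leb_S] they overlap in the smaller measure, so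
    Hardy-Littlewood is saturated at each pair of levels. *)
Lemma resonance_levels (f w : R -> \bar R) : M L f -> M L w ->
  (forall k : R, (0 < k)%R -> exists i,
     [set x | ioo 0 L x /\ k%:E < `|w x|] = [set x | ioo 0 L x /\ (i <= l x)%N]) ->
  exists h : R -> \bar R, [/\ Mplus L h, (forall x, 0 <= h x), equimeasurable L h f &
    \int[leb]_(x in ioo 0 L) (rearr L f x * rearr L w x) <=
    \int[leb]_(x in ioo 0 L) (h x * `|w x|)].
Proof.
move=> mf mw wE; pose h x := rearr L f (sigma x).
have h0 x : 0 <= h x by exact: rearr_ge0.
have hE (r : R) : (0 <= r)%R ->
    ioo 0 L `&` [set x | r%:E < h x] = S 0%N (distr L f r).
  move=> r0; apply/seteqP; split=> x [Ix] /=; rewrite /h rearr_gt//.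
  by move: Ix => [Ix _].
have mh : M L h.
  apply: emeasurable_fun_gt => r; have [r0|r0] := leP 0%R r.
    by rewrite hE//; have [] := leb_S 0 (distr_ge0 L f r).
  rewrite (_ : _ `&` _ = ioo 0 L); first exact: measurable_ioo.
  apply/seteqP; split=> x; first by case.
  by move=> Ix; split=> //; apply: lt_le_trans (h0 x); rewrite lte_fin.
have E0 : E 0%N = ioo 0 L by apply/seteqP; split=> x; [case|].
exists h; split=> //.
- by split=> //; exact: ae_onW.
- move=> r r0; rewrite {1}/distr.
  rewrite (_ : [set x | _] = S 0%N (distr L f r)).
    have [_ ->] := leb_S 0 (distr_ge0 L f r).
    by rewrite E0 leb_ioo0// min_l//; exact: distr_le_L.
  rewrite -hE ?ltW//; apply/seteqP; split=> x [Ix /= hx]; split=> //.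
    by move: hx; rewrite /= gee0_abs.
  by rewrite gee0_abs.
apply: le_integral_leb_levels.
- exact: measurable_ioo.
- exact: rearr_M.
- exact: rearr_M.
- exact: mh.
- by apply: M_abs.
- by move=> x; exact: rearr_ge0.
- by move=> x; exact: rearr_ge0.
- exact: h0.
- by move=> x; exact: abse_ge0.
move=> r k r0 k0.
have -> : [set x : lebR R | [/\ ioo 0 L x, r%:E < rearr L f x & k%:E < rearr L w x]] =
    ioo 0 (mine (distr L f r) (distr L w k)).
  apply/seteqP; split=> x /=.
    by move=> [[x0 _]]; rewrite !rearr_gt ?ltW// => xf xg; split=> //; rewrite lt_min xf.
  move=> [x0]; rewrite lt_min => /andP[xf xg]; rewrite !rearr_gt ?ltW//; split=> //.
  by split=> //; apply: lt_le_trans xf _; exact: distr_le_L.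
rewrite leb_ioo0 ?le_min ?distr_ge0//.
have [i iE] := wE _ k0.
have -> : [set x : lebR R | [/\ ioo 0 L x, r%:E < h x & k%:E < `|w x| ]] =
    S i (distr L f r).
  apply/seteqP; split=> x /=.
    move=> [Ix hx wx]; split.
      by have : [set x | ioo 0 L x /\ k%:E < `|w x|] x by []; rewrite iE.
    by have : (ioo 0 L `&` [set x | r%:E < h x]) x by []; rewrite hE ?ltW// => -[].
  move=> [Ei fx]; have : [set x | ioo 0 L x /\ k%:E < `|w x|] x by rewrite iE.
  move=> [Ix wx]; split=> //.
  have : S 0%N (distr L f r) x by split=> //; rewrite E0.
  by rewrite -hE ?ltW// => -[].
have [_ ->] := leb_S i (distr_ge0 L f r).
by rewrite {2}/distr iE.
Qed.

End Resonance.

(** * Dyadic approximation from below *)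

Section Staircase.
Context {R : realType}.
Implicit Types (x y : \bar R) (r : R).

(** The numerator of the dyadic approximation. Kept as a natural number, it serves as the level
    function of [resonance_levels]. *)
Definition dyadic_level (j : nat) (y : \bar R) : nat :=
  Num.truncn (2 ^+ j * fine (mine `|y| j%:R%:E)%E)%R.

Definition dyadic_floor (j : nat) (y : \bar R) : \bar R :=
  ((dyadic_level j y)%:R / 2 ^+ j)%R%:E.

Let trunc_fin j y : mine `|y| j%:R%:E \is a fin_num.
Proof.
rewrite ge0_fin_numE; first by rewrite gt_min ltry orbT.
by rewrite le_min abse_ge0 lee_fin ler0n.
Qed.

Lemma dyadic_level_ge i j y :
  (i <= dyadic_level j y)%N = ((i%:R / 2 ^+ j)%R%:E <= mine `|y| j%:R%:E).
Proof.
by rewrite truncn_ge_nat// -{2}(fineK (trunc_fin j y)) lee_fin ler_pdivrMr// mulrC.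
Qed.

Lemma dyadic_level_le j y : (dyadic_level j y <= j * 2 ^ j)%N.
Proof.
rewrite -(ler_nat R) (le_trans (_ : _ <= 2 ^+ j * fine (mine `|y| j%:R%:E)%E)%R)//.
  by rewrite -truncn_ge_nat// .
rewrite natrM natrX mulrC ler_pM2r// -lee_fin fineK// ge_min.
by rewrite lexx orbT.
Qed.

Lemma dyadic_floor_ge0 j y : 0 <= dyadic_floor j y.
Proof. by rewrite lee_fin divr_ge0// ltW. Qed.

Lemma dyadic_floor_le j y : dyadic_floor j y <= `|y|.
Proof.
have := dyadic_level_ge (dyadic_level j y) j y; rewrite leqnn => /esym.
by rewrite le_min => /andP[].
Qed.

Lemma dyadic_floor_nd y : {homo (dyadic_floor ^~ y) : i j / (i <= j)%N >-> i <= j}.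
Proof.
apply/nondecreasing_seqP => j; rewrite /dyadic_floor lee_fin.
rewrite ler_pdivrMr// mulrAC ler_pdivlMr// exprS mulrA ler_pM2r//.
rewrite -natrM ler_nat dyadic_level_ge.
have := dyadic_level_ge (dyadic_level j y) j y; rewrite leqnn => /esym.
rewrite natrM exprS invfM -mulrA [(2 * _)%R]mulrA mulfV ?mul1r ?pnatr_eq0//.
rewrite !le_min => /andP[-> h] /=; apply: le_trans h _.
by rewrite lee_fin ler_nat.
Qed.

Lemma dyadic_floor_gt r y : r%:E < `|y| -> exists n, forall j, (n <= j)%N ->
  r%:E < dyadic_floor j y.
Proof.
move=> ry.
have [s [rs sy]] : exists s : R, (r < s)%R /\ s%:E <= `|y|.
  move: ry; case: `|y| => [s|_|//].
    by rewrite lte_fin => rs; exists s.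
  by exists (r + 1)%R; rewrite ltrDl leey.
have sr0 : (0 < s - r)%R by rewrite subr_gt0.
(* For j above s the truncation at height j keeps s, and for j above 1/(s - r) the rounding error
   2^-j is below s - r. *)
exists (maxn (Num.truncn s).+1 (Num.truncn (s - r)^-1).+1) => j.
rewrite geq_max => /andP[sj ej].
have sj' : (s <= j%:R)%R by apply: ltW; apply: lt_le_trans (truncnS_gt s) _; rewrite ler_nat.
have e2 : ((2 ^+ j)^-1 < s - r :> R)%R.
  rewrite invf_plt ?posrE//; apply: lt_le_trans (truncnS_gt _) _.
  apply: (@le_trans _ _ j%:R); first by rewrite ler_nat.
  by rewrite -natrX ler_nat ltnW// ltn_expl.
rewrite lte_fin; apply: (@lt_trans _ _ (s - (2 ^+ j)^-1)%R); first by rewrite ltrBrDr -ltrBrDl.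
rewrite ltrBlDr -[X in (_ + X)%R]mul1r -mulrDl ltr_pdivlMr// natr1.
apply: le_lt_trans (truncnS_gt _); rewrite mulrC ler_pM2l//.
by rewrite -lee_fin fineK// le_min sy lee_fin.
Qed.

End Staircase.

Lemma cvg_integral_nd d (T : measurableType d) (R : realType)
    (mu : {measure set T -> \bar R}) (D : set T) (u_ : nat -> T -> \bar R)
    (u : T -> \bar R) :
  measurable D -> (forall n, measurable_fun D (u_ n)) ->
  (forall n x, D x -> 0 <= u_ n x) ->
  (forall x, D x -> nondecreasing_seq (u_ ^~ x)) ->
  (forall x, D x -> u_ n x @[n --> \oo] --> u x) ->
  \int[mu]_(x in D) u_ n x @[n --> \oo] --> \int[mu]_(x in D) u x.
Proof.
move=> mD mu_ u0 nd cu.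
suff <- : \int[mu]_(x in D) limn (u_ ^~ x) = \int[mu]_(x in D) u x.
  exact: cvg_monotone_convergence.
by apply: eq_integral => x; rewrite inE => Dx; apply: cvg_lim => //; exact: cu.
Qed.

(** * Resonance for general weights and subadditivity of the pairing *)

Section ResonanceFormula.
Context {R : realType}.
Implicit Types (L : \bar R) (f g w : R -> \bar R).

(** The extended product is discontinuous at 0 times oo. Since the limit bounds the sequence, a zero
    limit makes the sequence vanish; a zero factor a makes the products vanish; in the remaining
    case the product is continuous. *)
Lemma mule_cvg_nd (a : \bar R) (u_ : nat -> \bar R) (u : \bar R) : 0 <= a ->
  (forall n, 0 <= u_ n <= u) -> u_ n @[n --> \oo] --> u ->
  a * u_ n @[n --> \oo] --> a * u.
Proof.
move=> a0 u0 cu; have := u0 0%N => /andP[u00 uu].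
have : 0 <= u by exact: le_trans uu.
rewrite le_eqVlt => /predU1P[u_eq0|u_gt0].
  rewrite -u_eq0 mule0.
  rewrite (_ : (fun n => a * u_ n) = fun=> 0); first exact: cvg_cst.
  apply/funext => n; have /andP[un0 unu] := u0 n.
  by rewrite (_ : u_ n = 0) ?mule0//; apply: le_anti; rewrite un0 u_eq0 unu.
move: a0; rewrite le_eqVlt => /predU1P[<-|a_gt0].
  rewrite mul0e (_ : (fun n => 0 * u_ n) = fun=> 0); first exact: cvg_cst.
  by apply/funext => n; rewrite mul0e.
apply: cvgeM => //; last exact: cvg_cst.
by apply: neq0_mule_def; rewrite gt_eqF// mule_gt0.
Qed.

Lemma mule_nd_le (u_ : nat -> \bar R) (u : \bar R) :
  nondecreasing_seq u_ -> u_ n @[n --> \oo] --> u -> forall n, u_ n <= u.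
Proof.
move=> nd cu n; have cs := ereal_nondecreasing_cvgn nd.
rewrite -(cvg_lim _ cu)// (cvg_lim _ cs)//.
by apply: ereal_sup_ubound; exists n.
Qed.

(** Used with W = f^* to approximate a weight from below, and with W = w^* for (P3). *)
Lemma cvg_rearr_integral L (f_ : nat -> R -> \bar R) f (W : R -> \bar R) :
  (forall k, M L (f_ k)) -> M L f -> M L W -> (forall x, 0 <= W x) ->
  ae_on (ioo 0 L) (fun x => nondecreasing_seq (fun k => `|f_ k x|) /\
                            `|f_ k x| @[k --> \oo] --> `|f x|) ->
  nondecreasing_seq (fun k => \int[leb]_(x in ioo 0 L) (W x * rearr L (f_ k) x)) /\
  \int[leb]_(x in ioo 0 L) (W x * rearr L (f_ k) x) @[k --> \oo] -->
  \int[leb]_(x in ioo 0 L) (W x * rearr L f x).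
Proof.
move=> mf_ mf mW W0 fE.
have mI : measurable (ioo 0 L : set (lebR R)) by exact: measurable_ioo.
have mk k : measurable_fun (ioo 0 L : set (lebR R))
    ((fun x => W x * rearr L (f_ k) x) : lebR R -> \bar R).
  by apply: emeasurable_funM => //; exact: rearr_M.
have nd x : nondecreasing_seq (fun k => W x * rearr L (f_ k) x).
  move=> m n mn; apply: lee_wpmul2l => //.
  by have [nd _] := rearr_cvg x mf_ mf fE; exact: nd.
split.
  move=> m n mn; apply: ge0_le_integral; [exact: mI| |exact: mk|exact: mk|].
  - by move=> x _; rewrite mule_ge0// rearr_ge0.
  - by move=> x _; exact: nd.
apply: cvg_integral_nd => //.
  by move=> n x _; rewrite mule_ge0// rearr_ge0.
move=> x _; have [ndx cx] := rearr_cvg x mf_ mf fE.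
apply: mule_cvg_nd => // n; rewrite rearr_ge0/=.
exact: (mule_nd_le ndx cx).
Qed.

(** Phrased with an upper bound B because each truncation of w yields its own h, and the passage to
    the limit yields no single one. *)
Lemma resonance L f w (B : \bar R) : 0 <= L -> M L f -> M L w ->
  (forall h, Mplus L h -> (forall x, 0 <= h x) -> equimeasurable L h f ->
    \int[leb]_(x in ioo 0 L) (h x * `|w x|) <= B) ->
  \int[leb]_(x in ioo 0 L) (rearr L f x * rearr L w x) <= B.
Proof.
move=> L0 mf mw hB.
have mI : measurable (ioo 0 L : set (lebR R)) by exact: measurable_ioo.
(* The dyadic truncations w_ j of |w| take finitely many values, on sets of
   finite measure, so that resonance_levels applies to them. *)
pose l j x := if (x < j%:R)%R then dyadic_level j (w x) else 0%N.
pose w_ j x : \bar R := ((l j x)%:R / 2 ^+ j)%R%:E.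
have w_E j x : w_ j x = if (x < j%:R)%R then dyadic_floor j (w x) else 0.
  by rewrite /w_ /l; case: ifP => // _; rewrite mul0r.
have w_0 j x : 0 <= w_ j x by rewrite w_E; case: ifP => // _; exact: dyadic_floor_ge0.
have w_def j x : w_ j x = ((l j x)%:R / 2 ^+ j)%R%:E by [].
clearbody w_.
have mE j i : measurable ([set x | ioo 0 L x /\ (i <= l j x)%N] : set (lebR R)).
  have [->|i0] := posnP i.
    by rewrite (_ : mkset _ = ioo 0 L)//; apply/seteqP; split=> x //= [].
  rewrite (_ : mkset _ = ioo 0 L `&` ioo 0 (j%:R%:E) `&`
      (ioo 0 L `&` [set x | (i%:R / 2 ^+ j)%R%:E <= mine `|w x| j%:R%:E])).
    apply: measurableI; first by apply: measurableI => //; exact: measurable_ioo.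
    apply: emeasurable_fun_c_infty; first exact: measurable_ioo.
    by apply: measurable_mine; [exact: M_abs|exact: measurable_cst].
  apply/seteqP; split=> x /=.
    rewrite /l; move=> [[x0 xL]]; case: ifPn => [xj|_]; last by rewrite leqNgt i0.
    by rewrite dyadic_level_ge => h; do !split=> //; rewrite lte_fin.
  move=> [[[x0 xL] [_ xj]] [_ h]]; split=> //.
  by rewrite /l -lte_fin xj dyadic_level_ge.
have E1 j : leb ([set x | ioo 0 L x /\ (1 <= l j x)%N] : set (lebR R)) < +oo.
  apply: (@le_lt_trans _ _ (leb (ioo 0 j%:R%:E : set (lebR R)))).
    apply: le_leb => //; first exact: measurable_ioo.
    move=> x [[x0 xL]]; rewrite /l; case: ifPn => // xj _; split=> //.
  by rewrite leb_ioo_fin// ltry.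
have lm j x : (l j x <= j * 2 ^ j)%N.
  by rewrite /l; case: ifP => // _; exact: dyadic_level_le.
have pow_gt0 j : (0 < 2 ^+ j :> R)%R by rewrite exprn_gt0.
have lev j (k : R) : (0 < k)%R -> exists i,
     [set x | ioo 0 L x /\ k%:E < `|w_ j x|] = [set x | ioo 0 L x /\ (i <= l j x)%N].
  (* [w_ j x > k] means [l j x > k * 2 ^+ j]; for the integer [l j x] this says that it is at least
     the floor of the right side plus one. *)
  move=> k0; exists (Num.truncn (k * 2 ^+ j)).+1.
  apply/seteqP; split=> x [Ix h]; split=> //; move: h.
    rewrite gee0_abs// w_def lte_fin ltr_pdivlMr// => h.
    rewrite truncn_lt_nat//; last by rewrite mulr_ge0 ?ltW.
  rewrite truncn_lt_nat; last by rewrite mulr_ge0 ?ltW.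
  by rewrite gee0_abs// w_def lte_fin ltr_pdivlMr.
have mw_ j : M L (w_ j).
  apply: emeasurable_fun_gt => r; have [r0|r0] := ltP 0%R r.
    have [i iE] := lev j _ r0.
    rewrite (_ : _ `&` _ = [set x | ioo 0 L x /\ (i <= l j x)%N])//.
    by rewrite -iE; apply/seteqP; split=> x [Ix /= h]; split=> //; move: h; rewrite /= gee0_abs.
  rewrite le_eqVlt in r0; case/predU1P: r0 => [->|r0].
    rewrite (_ : _ `&` _ = [set x | ioo 0 L x /\ (1 <= l j x)%N])//.
    have lE x : (0 < w_ j x) = (0 < l j x)%N.
      by rewrite w_def lte_fin pmulr_lgt0 ?invr_gt0// ltr0n.
    by apply/seteqP; split=> x [Ix /= h]; split=> //=; move: h; rewrite lE.
  rewrite (_ : _ `&` _ = ioo 0 L)//; apply/seteqP; split=> x; first by case.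
  by move=> Ix; split=> //; apply: lt_le_trans (w_0 j x); rewrite lte_fin.
have w_le j x : `|w_ j x| <= `|w x|.
  rewrite gee0_abs// w_E; case: ifP => // _; exact: dyadic_floor_le.
have w_nd x : nondecreasing_seq (fun j => `|w_ j x|).
  apply/nondecreasing_seqP => j; rewrite !gee0_abs// !w_E; case: ifPn => [xj|_].
    rewrite ifT; last by apply: lt_trans xj _; rewrite ltr_nat.
    exact: dyadic_floor_nd.
  by case: ifP => // _; exact: dyadic_floor_ge0.
have w_cvg x : `|w_ j x| @[j --> \oo] --> `|w x|.
  suff -> : `|w x| = ereal_sup (range (fun j => `|w_ j x|)).
    exact: ereal_nondecreasing_cvgn.
  apply/eqP; rewrite eq_le; apply/andP; split; last first.
    by apply: ge_ereal_sup => _ [j _ <-].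
  apply: le_ereal_gt.
    by apply: le_ereal_sup_tmp; exists `|w_ 0%N x|; [exists 0%N|].
  move=> r r0 /dyadic_floor_gt[n nE].
  pose j := maxn n (Num.truncn x).+1.
  apply: (@lt_le_trans _ _ `|w_ j x|).
    rewrite gee0_abs// w_E ifT; last first.
      apply: lt_le_trans (truncnS_gt x) _; rewrite ler_nat; exact: leq_maxr.
    by apply: nE; exact: leq_maxl.
  by apply: ereal_sup_ubound; exists j.
have [_ cI] := @cvg_rearr_integral L w_ w (rearr L f) mw_ mw (@rearr_M _ L f)
  (rearr_ge0 L f) (ae_onW (fun x _ => conj (w_nd x) (w_cvg x))).
rewrite -(cvg_lim _ cI)//; apply: lime_le.
  by apply/cvg_ex; eexists; exact: cI.
apply: nearW => j.
have [h [ph h0 hf hw]] := resonance_levels L0 (mE j) (E1 j) (lm j) mf (mw_ j) (lev j).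
apply: le_trans hw _; apply: le_trans (hB h ph h0 hf).
have mh : M L h by case: ph.
apply: ge0_le_integral.
- exact: mI.
- by move=> x _; rewrite mule_ge0.
- by apply: emeasurable_funM; [exact: mh|exact: M_abs].
- by apply: emeasurable_funM; [exact: mh|exact: M_abs].
- by move=> x _; apply: lee_wpmul2l.
Qed.

(** Saturation is applied with the roles exchanged: it rearranges w into some h and leaves f + g
    alone. Then |f + g| <= |f| + |g| holds pointwise under the integral, and Hardy-Littlewood bounds
    each summand. *)
Lemma rearr_integral_triangle L f g w : 0 <= L -> M L f -> M L g -> M L w ->
  \int[leb]_(x in ioo 0 L) (rearr L (fun x => f x + g x) x * rearr L w x) <=
  \int[leb]_(x in ioo 0 L) (rearr L f x * rearr L w x) +
  \int[leb]_(x in ioo 0 L) (rearr L g x * rearr L w x).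
Proof.
move=> L0 mf mg mw.
have mI : measurable (ioo 0 L : set (lebR R)) by exact: measurable_ioo.
have mfg : M L (fun x => f x + g x) by apply: emeasurable_funD.
have mulC : (fun x : lebR R => rearr L (fun x => f x + g x) x * rearr L w x) =
    (fun x => rearr L w x * rearr L (fun x => f x + g x) x).
  by apply/funext => x; rewrite muleC.
rewrite mulC; apply: resonance => // h [mh _] h0 hw.
have HL (k : R -> \bar R) : M L k -> \int[leb]_(x in ioo 0 L) (`|k x| * h x) <=
    \int[leb]_(x in ioo 0 L) (rearr L k x * rearr L w x).
  move=> mk; rewrite -(eq_rearr hw); apply: le_trans (hardy_littlewood L0 mk mh).
  by apply: le_of_eq; apply: eq_integral => x _; rewrite [`|h x|]gee0_abs.
apply: (@le_trans _ _ (\int[leb]_(x in ioo 0 L) (`|f x| * h x) +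
    \int[leb]_(x in ioo 0 L) (`|g x| * h x))); last by apply: leeD; exact: HL.
have mfh (k : R -> \bar R) : M L k -> measurable_fun (ioo 0 L : set (lebR R))
    ((fun x => `|k x| * h x) : lebR R -> \bar R).
  by move=> mk; apply: emeasurable_funM; [exact: M_abs|exact: mh].
have p0 (k : R -> \bar R) (x : lebR R) : ioo 0 L x -> 0 <= `|k x| * h x.
  by move=> _; rewrite mule_ge0.
rewrite -(ge0_integralD (@leb R) mI (p0 f) (mfh f mf) (p0 g) (mfh g mg)).
apply: ge0_le_integral.
- exact: mI.
- by move=> x _; rewrite mule_ge0.
- by apply: emeasurable_funM; [exact: mh|exact: (M_abs mfg)].
- by apply: emeasurable_funD; exact: mfh.
- move=> x _; rewrite -ge0_muleDl// muleC; apply: lee_wpmul2r => //.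
  exact: lee_abs_add.
Qed.

End ResonanceFormula.

(** * Norms generated by weights *)

Section LebesgueIntegral.
Context {R : realType}.
Implicit Types (D : set R) (f g : R -> \bar R) (L : \bar R).

(** Sets and functions stay typed over R while measurability refers to the Lebesgue sigma-algebra of
    [lebR]; the lemmas of this section restate the integration facts in that typing. *)
Definition leb_measurable D : Prop := measurable (D : set (lebR R)).
Definition leb_measurable_fun D f : Prop :=
  measurable_fun (D : set (lebR R)) (f : lebR R -> \bar R).

Lemma leb_measurable_funM D f g : leb_measurable_fun D f -> leb_measurable_fun D g ->
  leb_measurable_fun D (fun x => f x * g x).
Proof. by move=> mf mg; apply: emeasurable_funM; [exact: mf|exact: mg]. Qed.

Lemma leb_measurable_funD D f g : leb_measurable_fun D f -> leb_measurable_fun D g ->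
  leb_measurable_fun D (fun x => f x + g x).
Proof. by move=> mf mg; apply: emeasurable_funD; [exact: mf|exact: mg]. Qed.

Lemma leb_measurable_cst D (c : \bar R) : leb_measurable_fun D (fun=> c).
Proof. exact: measurable_cst. Qed.

Lemma leb_measurable_abs D f : leb_measurable_fun D f ->
  leb_measurable_fun D (fun x => `|f x|).
Proof. by move=> mf; exact: measurableT_comp. Qed.

Lemma leb_measurable_funS D E f : leb_measurable D -> E `<=` D ->
  leb_measurable_fun D f -> leb_measurable_fun E f.
Proof. by move=> mD ED; apply: measurable_funS. Qed.

Lemma leb_integral_ge0 D f : (forall x, D x -> 0 <= f x) -> 0 <= \int[leb]_(x in D) f x.
Proof. by move=> f0; apply: integral_ge0. Qed.

Lemma leb_le_integral D f g : leb_measurable D ->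
  leb_measurable_fun D f -> leb_measurable_fun D g ->
  (forall x, D x -> 0 <= f x) -> (forall x, D x -> f x <= g x) ->
  \int[leb]_(x in D) f x <= \int[leb]_(x in D) g x.
Proof. by move=> mD mf mg f0 fg; apply: ge0_le_integral. Qed.

Lemma leb_ae_eq_integral D f g : leb_measurable D ->
  leb_measurable_fun D f -> leb_measurable_fun D g ->
  ae_on D (fun x => f x = g x) ->
  \int[leb]_(x in D) f x = \int[leb]_(x in D) g x.
Proof. by move=> mD mf mg fg; apply: ae_eq_integral. Qed.

Lemma leb_eq_integral D f g : (forall x, D x -> f x = g x) ->
  \int[leb]_(x in D) f x = \int[leb]_(x in D) g x.
Proof. by move=> fg; apply: eq_integral => x; rewrite inE; exact: fg. Qed.

Lemma leb_integralZl D f (c : \bar R) : leb_measurable D ->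
  leb_measurable_fun D f -> (forall x, D x -> 0 <= f x) -> 0 <= c ->
  \int[leb]_(x in D) (c * f x) = c * \int[leb]_(x in D) f x.
Proof. by move=> mD mf f0 c0; apply: ge0_integralZl. Qed.

Lemma leb_subset_integral D E f : leb_measurable D -> leb_measurable E ->
  leb_measurable_fun E f -> (forall x, E x -> 0 <= f x) -> D `<=` E ->
  \int[leb]_(x in D) f x <= \int[leb]_(x in E) f x.
Proof. by move=> mD mE mf f0 DE; apply: ge0_subset_integral. Qed.

Lemma leb_integral_ioo_split (c a b : R) f : (c < a)%R -> (a <= b)%R ->
  leb_measurable_fun (ioo c b%:E) f -> (forall x, ioo c b%:E x -> 0 <= f x) ->
  \int[leb]_(x in ioo c b%:E) f x =
  \int[leb]_(x in ioo c a%:E) f x + \int[leb]_(x in ico a b%:E) f x.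
Proof.
move=> ca ab mf f0.
have IE : ioo c b%:E = ioo c a%:E `|` ico a b%:E.
  apply/seteqP; split=> x /=.
    by move=> [cx xb]; have [xa|ax] := ltP x a; [left|right].
  move=> [[cx xa]|[ax xb]]; split=> //; last exact: lt_le_trans ax.
  by apply: lt_le_trans xa _; rewrite lee_fin.
rewrite IE; apply: ge0_integral_setU.
- exact: measurable_ioo.
- exact: measurable_ico.
- by rewrite -IE.
- by rewrite -IE.
- apply/disj_setPS => x [[_ xa] [ax _]].
  by move: xa; rewrite lte_fin ltNge ax.
Qed.

Lemma leb_integral_abs_eq0 D f : leb_measurable D -> leb_measurable_fun D f ->
  \int[leb]_(x in D) `|f x| = 0 -> ae_on D (fun x => f x = 0).
Proof. by move=> mD mf /(ae_eq_integral_abs _ mD mf). Qed.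

Lemma leb_cvg_integral_nd D (u_ : nat -> R -> \bar R) (u : R -> \bar R) :
  leb_measurable D -> (forall n, leb_measurable_fun D (u_ n)) ->
  (forall n x, D x -> 0 <= u_ n x) ->
  (forall x, D x -> nondecreasing_seq (u_ ^~ x)) ->
  (forall x, D x -> u_ n x @[n --> \oo] --> u x) ->
  \int[leb]_(x in D) u_ n x @[n --> \oo] --> \int[leb]_(x in D) u x.
Proof. exact: cvg_integral_nd. Qed.

Lemma leb_integral_cst D (c : \bar R) : leb_measurable D ->
  \int[leb]_(x in D) c = c * leb (D : set (lebR R)).
Proof. by move=> mD; rewrite integral_cst. Qed.

Lemma ae_on_bigcup (D_ : nat -> set R) (P : R -> Prop) :
  (forall n, ae_on (D_ n) P) -> ae_on (\bigcup_n D_ n) P.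
Proof.
move=> h; have : \forall x \ae (@leb R), forall n, D_ n x -> P x.
  exact: (@ae_foralln _ (lebR R) R (@leb R)).
by apply: ae_leb_imp => x hx [n _ Dx]; exact: (hx n).
Qed.

Lemma ae_on_and (D : set R) (P Q : R -> Prop) :
  ae_on D P -> ae_on D Q -> ae_on D (fun x => P x /\ Q x).
Proof. exact: ae_onS2. Qed.

End LebesgueIntegral.

Section Weights.
Context {R : realType}.
Variable L : \bar R.
Hypothesis L0 : 0 < L.
Implicit Types (f g w h : R -> \bar R).

Definition rearr_pairing f w : \bar R :=
  \int[leb]_(x in ioo 0 L) (rearr L f x * rearr L w x).

Let mI : leb_measurable (ioo 0 L). Proof. exact: measurable_ioo. Qed.

Lemma Mplus_eq_abs f : Mplus L f -> ae_on (ioo 0 L) (fun x => `|f x| = f x).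
Proof. by move=> [_]; apply: ae_onS => x _ fx; rewrite gee0_abs. Qed.

Lemma Mplus_ge0 f : M L f -> (forall x, ioo 0 L x -> 0 <= f x) -> Mplus L f.
Proof. by move=> mf f0; split=> //; exact: ae_onW. Qed.

Lemma rearr_pairing_ge0 f w : 0 <= rearr_pairing f w.
Proof. by apply: leb_integral_ge0 => x _; rewrite mule_ge0// rearr_ge0. Qed.

Lemma rearr_pairing_measurable f w :
  leb_measurable_fun (ioo 0 L) (fun x => rearr L f x * rearr L w x).
Proof. by apply: leb_measurable_funM; exact: rearr_M. Qed.

Lemma rearr_pairing_le f g w : M L f -> M L g ->
  ae_on (ioo 0 L) (fun x => `|f x| <= `|g x|) ->
  rearr_pairing f w <= rearr_pairing g w.
Proof.
move=> mf mg fg; apply: leb_le_integral => //.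
- exact: rearr_pairing_measurable.
- exact: rearr_pairing_measurable.
- by move=> x _; rewrite mule_ge0// rearr_ge0.
- by move=> x _; apply: lee_wpmul2r; [exact: rearr_ge0|exact: rearr_le].
Qed.

Lemma rearr_pairing_scale (c : R) f w : (0 < c)%R -> M L f ->
  rearr_pairing (fun x => c%:E * f x) w = c%:E * rearr_pairing f w.
Proof.
move=> c0 mf; rewrite -leb_integralZl//.
- by apply: leb_eq_integral => x _; rewrite rearr_scale// muleA.
- exact: rearr_pairing_measurable.
- by move=> x _; rewrite mule_ge0// rearr_ge0.
- by rewrite lee_fin ltW.
Qed.

(** Homogeneity, the triangle inequality, (P2) and (P3) pass from single pairings to their supremum,
    and (P6) holds because f enters only through f^*. Definiteness is drawn from (P5). *)
Lemma ri_norm_of_weights (W : set (R -> \bar R)) (Nf : (R -> \bar R) -> \bar R) :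
  W !=set0 -> (forall w, W w -> M L w) ->
  (forall f, Mplus L f -> Nf f = ereal_sup [set rearr_pairing f w | w in W]) ->
  (forall E : set (lebR R), measurable E -> E `<=` ioo 0 L ->
    leb E < +oo -> Nf (fun x => (\1_E x)%:E) < +oo) ->
  (forall E : set (lebR R), measurable E ->
    E `<=` ioo 0 L -> leb E < +oo ->
    exists C : R, (0 < C)%R /\
      forall f, Mplus L f -> \int[leb]_(x in E) f x <= C%:E * Nf f) ->
  ri_norm L Nf.
Proof.
move=> [w0 Ww0] mW NE N4 N5.
have L0' := ltW L0.
have N0 f : Mplus L f -> 0 <= Nf f.
  move=> pf; rewrite NE//; apply: le_ereal_sup_tmp; exists (rearr_pairing f w0).
    by exists w0.
  exact: rearr_pairing_ge0.
have Nle f g : Mplus L f -> Mplus L g ->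
    ae_on (ioo 0 L) (fun x => f x <= g x) -> Nf f <= Nf g.
  move=> pf pg fg; rewrite (NE _ pf) (NE _ pg); apply: ge_ereal_sup => _ [w Ww <-].
  apply: le_ereal_sup_tmp; exists (rearr_pairing g w); first by exists w.
  case: (pf) (pg) => mf f0 [mg g0]; apply: rearr_pairing_le => //.
  have := ae_on_and f0 g0.
  apply: ae_onS2 fg => x _ fg [fx gx].
  by rewrite !gee0_abs.
have Nzero : Nf (fun=> 0) = 0.
  have p0 : Mplus L (fun=> 0 : \bar R).
    by apply: Mplus_ge0 => //; exact: leb_measurable_cst.
  rewrite NE//; apply/eqP; rewrite eq_le; apply/andP; split; last by rewrite -NE// N0.
  apply: ge_ereal_sup => _ [w Ww <-]; rewrite /rearr_pairing.
  rewrite (_ : \int[_]_(x in _) _ = \int[leb]_(x in ioo 0 L) 0).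
    by rewrite integral0.
  apply: leb_eq_integral => x [x0 _]; rewrite (_ : rearr _ _ _ = 0) ?mul0e//.
  apply/eqP; rewrite eq_le rearr_ge0 andbT leNgt rearr_gt//; last by case: p0.
  rewrite -leNgt /distr (_ : mkset _ = set0) ?measure0 ?lee_fin ?ltW//.
  by apply/seteqP; split=> // y [_]; rewrite abse0 ltxx.
split=> //.
- move=> f pf; split=> [Nf0|f0]; last first.
    rewrite -[RHS]Nzero; apply/eqP; rewrite eq_le; apply/andP; split; apply: Nle => //.
    + by apply: Mplus_ge0 => //; exact: leb_measurable_cst.
    + by apply: ae_onS f0 => x _ ->.
    + by apply: Mplus_ge0 => //; exact: leb_measurable_cst.
    + by apply: ae_onS f0 => x _ ->.
  (* (P5) makes f vanish a.e. on sets of finite measure, hence on each bounded piece of (0, L). *)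
  have IE : ioo 0 L = \bigcup_n (ioo 0 L `&` ioo 0 n%:R%:E).
    apply/seteqP; split=> [x [x0 xL]|x [n _ []]//].
    by exists (Num.truncn x).+1 => //; do !split=> //; rewrite lte_fin truncnS_gt.
  rewrite IE; apply: ae_on_bigcup => n.
  have mn : leb_measurable (ioo 0 L `&` ioo 0 n%:R%:E).
    by apply: measurableI; exact: measurable_ioo.
  have sI : ioo 0 L `&` ioo 0 n%:R%:E `<=` ioo 0 L by move=> x [].
  have [||C [C0 fC]] := N5 _ mn => //.
    apply: (@le_lt_trans _ _ (leb (ioo 0 n%:R%:E : set (lebR R)))).
      by apply: le_leb; [exact: mn|exact: measurable_ioo|exact: subIsetr].
    by rewrite leb_ioo_fin// ltry.
  have [mf _] := pf.
  have mfn := leb_measurable_funS mI sI mf.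
  apply: leb_integral_abs_eq0 => //.
  apply/eqP; rewrite eq_le leb_integral_ge0 ?andbT; last by [].
  rewrite (@leb_ae_eq_integral _ _ _ f)//.
  + by have := fC _ pf; rewrite Nf0 mule0.
  + exact: leb_measurable_abs.
  + by apply: ae_leb_imp (Mplus_eq_abs pf) => x h [Ix _]; exact: h.
- move=> c f; rewrite le_eqVlt => /predU1P[<-|c0] pf.
    rewrite mul0e -[RHS]Nzero; congr Nf; apply/funext => x.
    by rewrite mul0e.
  have [mf f0] := pf.
  have pcf : Mplus L (fun x => c%:E * f x).
    split; first exact: M_scale.
    by apply: ae_onS f0 => x _ fx; rewrite mule_ge0// lee_fin ltW.
  rewrite !NE// -ereal_supZl ?ltW//; last first.
    by apply/set0P; exists (rearr_pairing f w0), w0.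
  congr ereal_sup; apply/seteqP; split.
    move=> y [w Ww <-]; exists (rearr_pairing f w); first by exists w.
    by rewrite rearr_pairing_scale.
  by move=> y [z [w Ww <-] <-]; exists w => //; rewrite rearr_pairing_scale.
- move=> f g pf pg; have [mf f0] := pf; have [mg g0] := pg.
  have pfg : Mplus L (fun x => f x + g x).
    split; first exact: leb_measurable_funD.
    by apply: ae_onS2 f0 g0 => x _ ? ?; exact: adde_ge0.
  rewrite !NE//; apply: ge_ereal_sup => _ [w Ww <-].
  apply: (@le_trans _ _ (rearr_pairing f w + rearr_pairing g w)).
    by apply: rearr_integral_triangle => //; exact: mW.
  by apply: leeD; apply: ereal_sup_ubound; exists w.
- move=> f_ f pf_ pf fE.
  have mf_ k : M L (f_ k) by case: (pf_ k).
  have [mf f0] := pf.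
  have f_0 : ae_on (ioo 0 L) (fun x => forall k, 0 <= f_ k x).
    have : \forall x \ae (@leb R), forall k, ioo 0 L x -> 0 <= f_ k x.
      apply: (@ae_foralln _ (lebR R) R (@leb R)) => k; by case: (pf_ k).
    by apply: ae_leb_imp => x h Ix k; exact: h.
  have fE' : ae_on (ioo 0 L) (fun x => nondecreasing_seq (fun k => `|f_ k x|) /\
                            `|f_ k x| @[k --> \oo] --> `|f x|).
    have := ae_on_and f0 f_0.
    apply: ae_onS2 fE => x _ [nd cf] [fx f_x].
    rewrite (_ : (fun k => `|f_ k x|) = (f_ ^~ x)) ?gee0_abs//.
    by apply/funext => k; rewrite gee0_abs.
  have nd : nondecreasing_seq (fun k => Nf (f_ k)).
    move=> m n mn; apply: Nle => //.
    by apply: ae_onS fE => x _ [nd _]; exact: (nd _ _ mn).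
  split=> //.
  have fle k : ae_on (ioo 0 L) (fun x => f_ k x <= f x).
    by apply: ae_onS fE => x _ [ndx cx]; exact: (mule_nd_le ndx cx).
  suff -> : Nf f = ereal_sup (range (fun k => Nf (f_ k))).
    exact: ereal_nondecreasing_cvgn.
  apply/eqP; rewrite eq_le; apply/andP; split; last first.
    by apply: ge_ereal_sup => _ [k _ <-]; exact: Nle.
  rewrite NE//; apply: ge_ereal_sup => _ [w Ww <-].
  have [_ cw] := cvg_rearr_integral mf_ mf (@rearr_M _ L w)
    (rearr_ge0 L w) fE'.
  have pC k : rearr_pairing k w = \int[leb]_(x in ioo 0 L) (rearr L w x * rearr L k x).
    by apply: leb_eq_integral => x _; rewrite muleC.
  rewrite pC -(cvg_lim _ cw)//; apply: lime_le.
    by apply/cvg_ex; eexists; exact: cw.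
  apply: nearW => k; apply: (@le_trans _ _ (Nf (f_ k))).
    rewrite (NE _ (pf_ k)) -(pC (f_ k)). apply: ereal_sup_ubound; exists w; [exact: Ww|reflexivity].
  by apply: ereal_sup_ubound; exists k.
- move=> f g pf pg fg; rewrite (NE _ pf) (NE _ pg).
  have -> : rearr_pairing f = rearr_pairing g by rewrite /rearr_pairing (eq_rearr fg).
  by [].
Qed.

End Weights.

(** * Duality on nonincreasing functions *)

Section HahnBanach.
Context {R : realType}.
Local Open Scope ring_scope.

Definition sublinear (V : lmodType R) (p : V -> R) : Prop :=
  (forall x y, p (x + y) <= p x + p y) /\
  (forall c x, 0 < c -> p (c *: x) = c * p x).

Lemma sublinear0 (V : lmodType R) (p : V -> R) : sublinear p -> p 0 = 0.
Proof.
move=> [_ pZ]; have := pZ 2 0 (ltr0n R 2); rewrite scaler0.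
by move/eqP; rewrite -subr_eq0 -{1}[p 0]mul1r -mulrBl mulf_eq0 => /orP[|/eqP//]; lra.
Qed.

Lemma sublinear_ge (V : lmodType R) (p : V -> R) x : sublinear p -> - p (- x) <= p x.
Proof.
move=> sp; have [pD _] := sp; have := pD x (- x).
by rewrite subrr (sublinear0 sp) addrC -lerBlDl sub0r.
Qed.

(* q x = inf_(t >= 0) (p (x + t y) - t p y) is linear along y. *)
Lemma sublinear_direction (V : lmodType R) (p : V -> R) (y : V) : sublinear p ->
  exists q, [/\ sublinear q, (forall x, q x <= p x) & q (- y) <= - p y].
Proof.
move=> sp; have [pD pZ] := sp.
pose S x : set R := [set p (x + t *: y) - t * p y | t in [set t | 0 <= t]].
have pZ0 t x : 0 <= t -> p (t *: x) = t * p x.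
  rewrite le_eqVlt => /predU1P[<-|/pZ//].
  by rewrite scale0r mul0r (sublinear0 sp).
have S_lb x : lbound (S x) (- p (- x)).
  move=> _ [t t0 <-]; rewrite lerBrDl -pZ0//.
  have := pD (x + t *: y) (- x); rewrite addrAC subrr add0r => h.
  by rewrite lerBlDr.
have S_inf x : has_inf (S x).
  split; last by exists (- p (- x)); exact: S_lb.
  by exists (p (x + 0 *: y) - 0 * p y), 0 => //=.
pose q x := inf (S x).
have q_le x t : 0 <= t -> q x <= p (x + t *: y) - t * p y.
  by move=> t0; apply: ge_inf; [case: (S_inf x)|exists t].
have q_lb x m : (forall t, 0 <= t -> m <= p (x + t *: y) - t * p y) -> m <= q x.
  move=> h; apply: lb_le_inf; first by case: (S_inf x).
  by move=> _ [t t0 <-]; exact: h.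
have qZle c x : 0 < c -> q (c *: x) <= c * q x.
  move=> c0; rewrite -ler_pdivrMl//; apply: q_lb => t t0.
  rewrite ler_pdivrMl// mulrBr -(pZ c (x + t *: y))// scalerDr scalerA mulrA.
  by apply: q_le; rewrite mulr_ge0// ltW.
exists q; split.
- split=> [x1 x2|c x c0].
    (* Given parameters t and s for the two infima on the right, the parameter t + s is used on the
       left. *)
    rewrite -lerBlDr; apply: (q_lb _ _) => t t0; rewrite lerBlDr -lerBlDl.
    apply: (q_lb _ _) => s s0; rewrite lerBlDl.
    apply: (le_trans (q_le _ (t + s) (addr_ge0 t0 s0))).
    have := pD (x1 + t *: y) (x2 + s *: y); rewrite addrACA -scalerDl mulrDl.
    by move: (p _) (p _) (p _) (p _) => *; lra.
  apply/eqP; rewrite eq_le qZle//=.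
  have := qZle c^-1 (c *: x); rewrite invr_gt0 => /(_ c0).
  by rewrite scalerA mulVf ?gt_eqF// scale1r ler_pdivlMl.
- by move=> x; have := q_le x 0 (lexx _); rewrite scale0r addr0 mul0r subr0.
- have := q_le (- y) 1 ler01.
  by rewrite scale1r addNr mul1r (sublinear0 sp) sub0r.
Qed.

(** Linearity along z, in the form q(-z) <= -q(z), survives any later decrease of the functional:
    r(-z) <= q(-z) <= -q(z) <= -r(z). So the directions can be treated one after another. *)
Lemma sublinear_directions (V : lmodType R) (p : V -> R) (ys : seq V) : sublinear p ->
  exists q, [/\ sublinear q, (forall x, q x <= p x) &
    forall y, y \in ys -> q (- y) <= - q y].
Proof.
move=> sp; elim: ys => [|y ys [q [sq qp qys]]]; first by exists p; split.
have [r [sr rq ry]] := sublinear_direction y sq.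
exists r; split => //; first by move=> x; exact: le_trans (qp x).
move=> z; rewrite inE => /predU1P[->|zys].
  by apply: le_trans ry _; rewrite lerN2.
apply: le_trans (rq _) _; apply: le_trans (qys _ zys) _; rewrite lerN2; exact: rq.
Qed.

(** The direction x0 is treated first: p1(-x0) <= -p(x0) forces every sublinear functional below p1
    to be at least p(x0) at x0. The basis vectors then make the functional linear, with coefficients
    its values on the basis. *)
Lemma hahn_banach_row (n : nat) (p : 'rV[R]_n -> R) (x0 : 'rV[R]_n) : sublinear p ->
  exists a : 'I_n -> R, (forall x : 'rV_n, \sum_i a i * x 0 i <= p x) /\
    p x0 <= \sum_i a i * x0 0 i.
Proof.
move=> sp; have [p1 [sp1 p1p p1x0]] := sublinear_direction x0 sp.
pose e (i : 'I_n) : 'rV[R]_n := delta_mx 0 i.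
have [q [sq qp1 qe]] := sublinear_directions [seq e i | i : 'I_n] sp1.
have [qD qZ] := sq.
have qx0 : p x0 <= q x0.
  apply: le_trans (sublinear_ge x0 sq); rewrite lerNr.
  by apply: le_trans (qp1 _) p1x0.
have qze (c : R) i : q (c *: e i) <= c * q (e i).
  have [c0|c0|->] := ltgtP c 0; last by rewrite scale0r mul0r (sublinear0 sq).
    rewrite -[c *: e i]opprK -scaleNr -scalerN qZ ?oppr_gt0// -[leRHS]mulrNN.
    rewrite ler_pM2l ?oppr_gt0//.
    by apply: qe; exact: map_f (mem_enum _ _).
  by rewrite qZ.
have qsum (x : 'rV[R]_n) : q x <= \sum_i x 0 i * q (e i).
  rewrite {1}[x]row_sum_delta.
  elim/big_rec2: _ => [|i y z _ zy]; first by rewrite (sublinear0 sq).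
  by apply: le_trans (qD _ _) _; apply: lerD.
exists (fun i => q (e i)); split=> [x|].
  apply: le_trans (p1p x); apply: le_trans (qp1 x); apply: le_trans (sublinear_ge x sq).
  rewrite lerNr; apply: le_trans (qsum _) _.
  apply: le_of_eq.
  by rewrite -sumrN; apply: eq_bigr => i _; rewrite mxE mulNr mulrC.
apply: le_trans qx0 _; apply: le_trans (qsum _) _.
by apply: le_of_eq; apply: eq_bigr => i _; rewrite mulrC.
Qed.

End HahnBanach.

Lemma sum_ord_mul (V : nmodType) (n m : nat) (F : nat -> V) :
  (\sum_(k < n * m) F k = \sum_(i < n) \sum_(l < m) F (i * m + l)%N)%R.
Proof.
elim: n => [|n IH]; first by rewrite mul0n !big_ord0.
by rewrite mulSnr big_split_ord/= IH big_ord_recr.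
Qed.

Lemma sum_ord_rot (V : nmodType) (m r : nat) (F : nat -> V) :
  (\sum_(l < m) F ((l + r) %% m)%N = \sum_(l < m) F l)%R.
Proof.
case: m => [|m]; first by rewrite !big_ord0.
rewrite [RHS](reindex_inj (@addIr 'I_m.+1 (inZp r)))/=.
by apply: eq_bigr => l _; rewrite modnDmr.
Qed.

(** * Step functions on uniform grids *)

Section Step.
Context {R : realType}.
Variable L : \bar R.
Implicit Types (d : R) (c : nat -> R) (n : nat).

(** Takes the value [c i] on [i d, (i+1) d). All cells have the same length, so permuting the
    coefficients gives an equimeasurable function. *)
Definition step d c (t : R) : \bar R := (c (Num.truncn (t / d)))%:E.

Let mI : leb_measurable (ioo 0 L). Proof. exact: measurable_ioo. Qed.

Lemma truncn_cell d t i : (0 < d)%R -> (0 <= t)%R ->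
  (Num.truncn (t / d) == i) = (i%:R * d <= t < i.+1%:R * d)%R.
Proof.
move=> d0 t0; rewrite truncn_eq; last by rewrite divr_ge0// ltW.
by rewrite ler_pdivlMr// ltr_pdivrMr.
Qed.

Lemma truncn_lt d t n : (0 < d)%R -> (0 <= t)%R ->
  (Num.truncn (t / d) < n)%N = (t < n%:R * d)%R.
Proof.
move=> d0 t0; rewrite truncn_lt_nat; last by rewrite divr_ge0// ltW.
by rewrite ltr_pdivrMr.
Qed.

Let cell d i : set R := ico (i%:R * d)%R (i.+1%:R * d)%:E.

Lemma step_measurable d c : (0 < d)%R -> leb_measurable_fun (ioo 0 L) (step d c).
Proof.
move=> d0; apply: emeasurable_fun_gt => r.
rewrite (_ : _ `&` _ = ioo 0 L `&` \bigcup_(i in [set i | (r < c i)%R]) cell d i).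
  apply: measurableI; first exact: measurable_ioo.
  by apply: bigcup_measurable => i _; exact: measurable_ico.
apply/seteqP; split=> x [[x0 xL]] /=; rewrite /step lte_fin => h; split=> //.
  exists (Num.truncn (x / d)) => //; rewrite /cell /ico/=.
  have := truncn_cell (Num.truncn (x / d)) d0 (ltW x0); rewrite eqxx => /esym /andP[? ?].
  by rewrite lte_fin.
case: h => i ri [ix xi].
suff /eqP -> : Num.truncn (x / d) == i by [].
by rewrite (truncn_cell _ d0 (ltW x0)) ix -lte_fin.
Qed.

Lemma step_Mplus d c : (0 < d)%R -> (forall i, 0 <= c i)%R -> Mplus L (step d c).
Proof.
move=> d0 c0; split; first exact: step_measurable.
by apply: ae_onW => x _; rewrite lee_fin.
Qed.

Lemma leb_cell d i n : (0 < d)%R -> (n%:R * d)%:E <= L -> (i < n)%N ->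
  leb (cell d i `&` ioo 0 L : set (lebR R)) = d%:E.
Proof.
move=> d0 nL iltn.
have id0 : (0 <= i%:R * d)%R by rewrite mulr_ge0// ltW.
have iid : (i%:R * d <= i.+1%:R * d)%R by rewrite ler_pM2r// ler_nat.
have dE : (i.+1%:R * d - i%:R * d = d)%R by rewrite -mulrBl -natrB// subSnn mul1r.
have mc : leb_measurable (cell d i) by exact: measurable_ico.
have mo : leb_measurable (ioo (i%:R * d)%R (i.+1%:R * d)%:E) by exact: measurable_ioo.
have iL x : (x < i.+1%:R * d)%R -> x%:E < L.
  move=> xi; apply: lt_le_trans nL; rewrite lte_fin; apply: lt_le_trans xi _.
  by rewrite ler_pM2r// ler_nat.
apply/eqP; rewrite eq_le; apply/andP; split.
  rewrite -[in leRHS]dE -leb_ico_fin//; apply: le_leb.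
  - by apply: measurableI; [exact: mc|exact: mI].
  - exact: mc.
  - exact: subIsetl.
(* The lower bound uses the open cell: for i = 0 the left endpoint 0 lies outside (0, L). *)
rewrite -[in leLHS]dE -leb_ioo_fin//; apply: le_leb.
- exact: mo.
- by apply: measurableI; [exact: mc|exact: mI].
move=> x [ix xi]; split; first by split=> //; exact: ltW.
by split; [exact: le_lt_trans ix|apply: iL; rewrite -lte_fin].
Qed.

Lemma step_sum d c n t : (0 < d)%R -> (0 <= t)%R ->
  (forall i, (n <= i)%N -> c i = 0%R) ->
  step d c t = \sum_(i < n) (c i)%:E * (\1_(cell d i) t)%:E.
Proof.
move=> d0 t0 cn; rewrite /step.
have inE' i : (t \in cell d i) = (Num.truncn (t / d) == i).
  rewrite truncn_cell//; apply/idP/idP; rewrite inE /cell /ico/= lte_fin.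
    by move=> [-> ->].
  by move=> /andP[].
have [nt|tn] := leqP n (Num.truncn (t / d)).
  rewrite cn// big1// => i _; rewrite indicE inE' gtn_eqF ?mule0//.
  exact: leq_trans nt.
rewrite (bigD1 (Ordinal tn))//= indicE inE' eqxx mule1 big1 ?adde0// => i ine.
rewrite indicE inE' (_ : _ == _ = false) ?mule0//.
by apply: contraNF ine => /eqP h; apply/eqP/val_inj; rewrite /= h.
Qed.

Lemma step_integral d c n : (0 < d)%R -> (n%:R * d)%:E <= L ->
  (forall i, 0 <= c i)%R -> (forall i, (n <= i)%N -> c i = 0%R) ->
  \int[leb]_(x in ioo 0 L) step d c x = (\sum_(i < n) c i * d)%:E.
Proof.
move=> d0 nL c0 cn.
have mc i : leb_measurable (cell d i) by exact: measurable_ico.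
have mind i : leb_measurable_fun (ioo 0 L) (fun x => (\1_(cell d i) x)%:E).
  by apply/measurable_EFinP; apply: measurable_indic; exact: mc.
transitivity (\int[leb]_(x in ioo 0 L) (\sum_(i < n) (c i)%:E * (\1_(cell d i) x)%:E)).
  by apply: leb_eq_integral => x [x0 _]; apply: step_sum => //; exact: ltW.
rewrite (@ge0_integral_sum _ (lebR R) R (@leb R) (ioo 0 L) mI _
  (fun i : 'I_n => fun x => (c i)%:E * (\1_(cell d i) x)%:E)); last 2 first.
- move=> i; apply: leb_measurable_funM; [exact: leb_measurable_cst|exact: mind].
- by move=> i x _; rewrite mule_ge0// lee_fin.
rewrite -sumEFin; apply: eq_bigr => i _.
have i0 x : ioo 0 L x -> 0 <= (\1_(cell d i) x)%:E :> \bar R by rewrite lee_fin.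
have ci0 : 0 <= (c i)%:E by rewrite lee_fin.
rewrite (leb_integralZl mI (mind i) i0 ci0).
rewrite EFinM; congr (_ * _).
rewrite (@integral_indic _ (lebR R) R leb _ mI _ (mc i)).
exact: (@leb_cell _ _ n).
Qed.

Lemma distr_step d c n (lam : R) : (0 < d)%R -> (n%:R * d)%:E <= L -> (0 < lam)%R ->
  (forall i, (n <= i)%N -> c i = 0%R) ->
  distr L (step d c) lam = (\sum_(i < n) (lam < `|c i|)%R%:R * d)%:E.
Proof.
move=> d0 nL lam0 cn.
pose A : set R := [set x | ioo 0 L x /\ lam%:E < `|step d c x|].
have mlev : leb_measurable A.
  by apply: measurable_level; exact: step_measurable.
rewrite -(@step_integral d (fun i => (lam < `|c i|)%R%:R))//; last first.
  by move=> i /cn ->; rewrite normr0 ltNge ltW.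
transitivity (\int[leb]_(x in ioo 0 L) (\1_A x)%:E).
  rewrite (@integral_indic _ (lebR R) R leb _ mI _ mlev) /distr; congr (leb _).
  by apply/seteqP; split=> x /= => [[]|[]//].
apply: leb_eq_integral => x Ix; rewrite /step indicE; congr ((nat_of_bool _)%:R%:E).
rewrite -lte_fin -abse_EFin; apply/idP/idP; rewrite inE /A.
  by case.
by move=> h; split.
Qed.

(** The hypothesis on F says that the coefficients agree as multisets. In this form permutations and
    block shifts are both handled by reindexing a sum. *)
Lemma equimeasurable_step d c c' n : (0 < d)%R -> (n%:R * d)%:E <= L ->
  (forall i, (n <= i)%N -> c i = 0%R) -> (forall i, (n <= i)%N -> c' i = 0%R) ->
  (forall F : R -> R, \sum_(i < n) F (c i) = \sum_(i < n) F (c' i))%R ->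
  equimeasurable L (step d c) (step d c').
Proof.
move=> d0 nL cn cn' cc' lam lam0; rewrite !(@distr_step _ _ n)//; congr (_%:E).
exact: (cc' (fun z => (lam < `|z|)%R%:R * d)%R).
Qed.

Lemma step_refine d c m t : (0 < d)%R -> (0 < m)%N -> (0 <= t)%R ->
  step d c t = step (d / m%:R) (fun k => c (k %/ m)%N) t.
Proof.
move=> d0 m0 t0; rewrite /step; congr (c _)%:E; apply/eqP.
have m0' : (0 < m%:R :> R)%R by rewrite ltr0n.
rewrite truncn_cell//; set k := Num.truncn _.
have : k == k by []; rewrite {1}/k truncn_cell ?divr_gt0// => /andP[kt tk].
have dE : (d = m%:R * (d / m%:R) :> R)%R by rewrite mulrC divfK ?gt_eqF.
have cE (j : nat) : (j%:R * d = (j * m)%:R * (d / m%:R) :> R)%R.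
  by rewrite natrM -mulrA -dE.
rewrite !cE; apply/andP; split.
  by apply: le_trans kt; rewrite ler_pM2r ?divr_gt0// ler_nat leq_trunc_div.
apply: lt_le_trans tk _; rewrite ler_pM2r ?divr_gt0// ler_nat.
exact: ltn_ceil.
Qed.

End Step.

Lemma exists_sorting_perm (R : realDomainType) (n : nat) (a : 'I_n -> R) :
  exists s : {perm 'I_n}, forall i j : 'I_n, (i <= j)%N -> (a (s j) <= a (s i))%R.
Proof.
pose t := [tuple a i | i < n].
pose ge := fun x y : R => (y <= x)%R.
have ge_total : total ge by move=> x y; exact: le_total.
have ge_trans : transitive ge by move=> y x z xy yz; exact: le_trans yz xy.
have ts : size (sort ge t) == n by rewrite size_sort size_tuple.
have /tuple_permP[s sE] : perm_eq (Tuple ts) t by rewrite perm_sort.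
exists s => i j ij.
have nthE (k : 'I_n) : nth 0%R (sort ge t) k = a (s k).
  have -> : sort ge t = [tuple tnth t (s k) | k < n] by [].
  by rewrite -tnth_nth !tnth_mktuple.
rewrite -!nthE; have := sort_sorted ge_total t.
move=> /(sorted_leq_nth ge_trans (@lexx _ R) 0%R) h.
by apply: (h i j); rewrite ?inE ?size_sort ?size_tuple.
Qed.

(** * Approximation of a nonincreasing function by step functions from below *)

Section LowerStep.
Context {R : realType}.
Variables (k : R -> \bar R) (d : R) (e : nat -> nat).
Hypothesis d0 : (0 < d)%R.
Hypothesis k0 : forall t, 0 <= k t.
Hypothesis k_ni : forall s t, (s <= t)%R -> k t <= k s.
Hypothesis k_rc : forall t (r : R), (0 <= t)%R -> r%:E < k t -> exists s, (t < s)%R /\ r%:E < k s.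
Hypothesis e_nd : {homo e : i j / (i <= j)%N >-> (i <= j)%N}.

(** The value of k at the right end of a cell bounds k from below on that cell. Cutting at height j
    and at [e j * d] keeps the values finite and their number finite; [e] is constant on a bounded
    range and the identity on (0, oo). *)
Definition lower_coef (j i : nat) : R :=
  if (i < e j * 2 ^ j)%N
  then fine (mine (k (i.+1%:R * (d / 2 ^+ j))%R) j%:R%:E) else 0%R.

Definition lower_step (j : nat) : R -> \bar R := step (d / 2 ^+ j) (lower_coef j).

Let dj_gt0 j : (0 < d / 2 ^+ j)%R.
Proof. by rewrite divr_gt0// exprn_gt0. Qed.

Let min_fin (x : \bar R) (j : nat) : 0 <= x -> mine x j%:R%:E \is a fin_num.
Proof.
move=> x0; rewrite ge0_fin_numE; first by rewrite gt_min ltry orbT.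
by rewrite le_min x0 lee_fin ler0n.
Qed.

Lemma lower_coef_ge0 j i : (0 <= lower_coef j i)%R.
Proof.
rewrite /lower_coef; case: ifP => // _; apply: fine_ge0.
by rewrite le_min k0 lee_fin ler0n.
Qed.

Lemma lower_coef_out j i : (e j * 2 ^ j <= i)%N -> lower_coef j i = 0%R.
Proof. by rewrite /lower_coef leqNgt => /negbTE ->. Qed.

Lemma lower_coef_ni j i i' : (i <= i')%N -> (lower_coef j i' <= lower_coef j i)%R.
Proof.
move=> ii; rewrite /lower_coef; case: ifPn => [i'e|_]; last exact: lower_coef_ge0.
rewrite (leq_ltn_trans ii i'e) -lee_fin !fineK ?min_fin//.
rewrite le_min; apply/andP; split; last by rewrite ge_min lexx orbT.
rewrite ge_min; apply/orP; left; apply: k_ni.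
by rewrite ler_pM2r// ler_nat.
Qed.

Lemma lower_stepE j t : (0 <= t)%R -> lower_step j t =
  if (t < (e j)%:R * d)%R
  then mine (k ((Num.truncn (t / (d / 2 ^+ j))).+1%:R * (d / 2 ^+ j))%R) j%:R%:E else 0.
Proof.
move=> t0; rewrite /lower_step /step /lower_coef truncn_lt//.
have -> : ((e j * 2 ^ j)%:R * (d / 2 ^+ j) = (e j)%:R * d)%R.
  by rewrite natrM natrX -mulrA [(2 ^+ j * _)%R]mulrC divfK// expf_neq0.
by case: ifP => // _; rewrite fineK// min_fin.
Qed.

Lemma lower_step_ge0 j t : 0 <= lower_step j t.
Proof. by rewrite lee_fin; exact: lower_coef_ge0. Qed.

Lemma lower_step_le j t : (0 <= t)%R -> lower_step j t <= k t.
Proof.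
move=> t0; rewrite lower_stepE//; case: ifP => // _.
rewrite ge_min; apply/orP; left; apply: k_ni.
by rewrite -ler_pdivrMr// ltW// truncnS_gt.
Qed.

Lemma lower_step_nd t : (0 <= t)%R -> nondecreasing_seq (lower_step ^~ t).
Proof.
move=> t0; apply/nondecreasing_seqP => j; rewrite [leLHS]lower_stepE//.
case: ifPn => [te|_]; last exact: lower_step_ge0.
rewrite lower_stepE// ifT; last first.
  by apply: lt_le_trans te _; rewrite ler_pM2r// ler_nat e_nd.
(* Halving the cells moves the right end of the cell around t to the left or leaves it fixed, so k
   can only grow there. *)
have le_k : k ((Num.truncn (t / (d / 2 ^+ j))).+1%:R * (d / 2 ^+ j))%R <=
    k ((Num.truncn (t / (d / 2 ^+ j.+1))).+1%:R * (d / 2 ^+ j.+1))%R.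
  apply: k_ni.
  have hE : (d / 2 ^+ j = 2 * (d / 2 ^+ j.+1) :> R)%R.
    by rewrite exprS invfM mulrCA !mulrA mulfK.
  set i := Num.truncn (t / (d / 2 ^+ j)).
  rewrite [leRHS](_ : _ = (i.+1 * 2)%:R * (d / 2 ^+ j.+1))%R; last by rewrite hE mulrA -natrM.
  rewrite ler_pM2r// ler_nat muln2 doubleS.
  rewrite ltnS -ltnS truncn_lt//.
  have : (t < i.+1%:R * (d / 2 ^+ j))%R by rewrite -ltr_pdivrMr// truncnS_gt.
  by rewrite hE mulrA -natrM muln2 doubleS.
rewrite le_min; apply/andP; split; first by rewrite ge_min le_k.
by rewrite ge_min; apply/orP; right; rewrite lee_fin ler_nat.
Qed.

Lemma lower_step_cvg t : (0 <= t)%R -> (exists j, t < (e j)%:R * d)%R ->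
  lower_step j t @[j --> \oo] --> k t.
Proof.
move=> t0 [j0 tj0].
suff -> : k t = ereal_sup (range (lower_step ^~ t)).
  by apply: ereal_nondecreasing_cvgn; exact: lower_step_nd.
apply/eqP; rewrite eq_le; apply/andP; split; last first.
  by apply: ge_ereal_sup => _ [j _ <-]; exact: lower_step_le.
apply: le_ereal_gt.
  apply: le_ereal_sup_tmp; exists (lower_step 0%N t); first by exists 0%N.
  exact: lower_step_ge0.
move=> r r0 /(k_rc t0)[s [ts rs]].
have st0 : (0 < s - t)%R by rewrite subr_gt0.
(* Large enough that t lies in the range covered, that the height cut is above r, and that the mesh
   is below s - t, so that the right end of the cell around t does not pass s. *)
pose j := maxn j0 (maxn (Num.truncn r).+1 (Num.truncn (d / (s - t))).+1).
have jj0 : (j0 <= j)%N by rewrite leq_maxl.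
have rj : (r < j%:R)%R.
  apply: lt_le_trans (truncnS_gt r) _.
  by rewrite ler_nat /j leq_max leq_max leqnn orbT.
have dj : (d / 2 ^+ j < s - t)%R.
  rewrite ltr_pdivrMr ?exprn_gt0// mulrC -ltr_pdivrMr//.
  apply: lt_le_trans (truncnS_gt _) _; apply: (@le_trans _ _ j%:R).
    by rewrite ler_nat /j !leq_max leqnn !orbT.
  by rewrite -natrX ler_nat ltnW// ltn_expl.
apply: (@lt_le_trans _ _ (lower_step j t)); last by apply: ereal_sup_ubound; exists j.
rewrite lower_stepE// ifT; last first.
  by apply: lt_le_trans tj0 _; rewrite ler_pM2r// ler_nat e_nd.
rewrite lt_min lte_fin rj andbT; apply: lt_le_trans rs _; apply: k_ni.
rewrite -natr1 mulrDl mul1r; apply: (@le_trans _ _ (t + d / 2 ^+ j)%R).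
  rewrite lerD2r -ler_pdivlMr//.
  by rewrite truncn_le divr_ge0// ltW.
by rewrite -lerBrDl ltW.
Qed.

End LowerStep.

(** By [rearr_gt] the condition f^*(t) > r is t < [distr L f r], which persists slightly to the
    right of t. *)
Lemma rearr_rc (R : realType) (L : \bar R) f t (r : R) : M L f -> (0 <= t)%R ->
  r%:E < rearr L f t -> exists s, (t < s)%R /\ r%:E < rearr L f s.
Proof.
move=> mf t0; have [r0|r0] := leP 0%R r; last first.
  move=> _; exists (t + 1)%R; rewrite ltrDl ltr01; split=> //.
  by apply: lt_le_trans (rearr_ge0 _ _ _); rewrite lte_fin.
rewrite rearr_gt//; have := distr_ge0 L f r; case D : (distr L f r) => [D'||]//.
  move=> _; rewrite lte_fin => tD; exists ((t + D') / 2)%R.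
  by rewrite rearr_gt// D lte_fin midf_lt//; split => //; rewrite midf_lt.
by move=> _ _; exists (t + 1)%R; rewrite ltrDl ltr01 rearr_gt// D ltry.
Qed.

(** * Norms of step functions and block averages *)

Section StepNorm.
Context {R : realType}.
Variables (L : \bar R) (N : (R -> \bar R) -> \bar R).
Hypothesis L0 : 0 < L.
Hypothesis hN : ri_norm L N.
Implicit Types (d : R) (c : nat -> R) (n : nat) (f g : R -> \bar R).

Lemma ri_norm0 : N (fun=> 0) = 0.
Proof.
apply/(ri_eq0 hN); last exact: ae_onW.
by apply: Mplus_ge0 => //; exact: leb_measurable_cst.
Qed.

Lemma ri_norm_sum n (f : nat -> R -> \bar R) : (forall i, Mplus L (f i)) ->
  Mplus L (fun t => \sum_(i < n) f i t) /\
  N (fun t => \sum_(i < n) f i t) <= \sum_(i < n) N (f i).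
Proof.
move=> pf; elim: n => [|n [pS NS]].
  have -> : (fun t => \sum_(i < 0) f i t) = fun=> 0.
    by apply/funext => t; rewrite big_ord0.
  rewrite big_ord0 ri_norm0; split=> //.
  by apply: Mplus_ge0 => //; exact: leb_measurable_cst.
have -> : (fun t => \sum_(i < n.+1) f i t) = (fun t => \sum_(i < n) f i t + f n t).
  by apply/funext => t; rewrite big_ord_recr.
split.
  have [mS S0] := pS; have [mf f0] := pf n.
  split; first exact: leb_measurable_funD.
  by apply: ae_onS2 S0 f0 => x _ ? ?; exact: adde_ge0.
by rewrite big_ord_recr/=; apply: le_trans (ri_triangle hN pS (pf n)) _; rewrite leeD2r.
Qed.

Lemma ri_norm_step_fin d c n : (0 < d)%R -> (n%:R * d)%:E <= L ->
  (forall i, 0 <= c i)%R -> (forall i, (n <= i)%N -> c i = 0%R) ->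
  N (step d c) \is a fin_num.
Proof.
move=> d0 nL c0 cn.
have ps := step_Mplus L d0 c0.
rewrite ge0_fin_numE; last exact: (ri_ge0 hN ps).
have nd0 : (0 <= n%:R * d)%R by rewrite mulr_ge0// ltW.
pose E : set R := ioo 0 (n%:R * d)%R%:E.
have mE : leb_measurable E by exact: measurable_ioo.
have EI : E `<=` ioo 0 L by apply: subset_ioo.
have E_fin : leb (E : set (lebR R)) < +oo.
  by rewrite leb_ioo_fin// ltry.
have NE := ri_indic hN mE EI E_fin.
pose C := (\sum_(i < n) c i)%R.
have C0 : (0 <= C)%R by apply: sumr_ge0.
have pE : Mplus L (fun x => (\1_E x)%:E).
  apply: Mplus_ge0; last by move=> x _; rewrite lee_fin.
  by apply/measurable_EFinP; apply: measurable_indic; exact: mE.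
have pCE : Mplus L (fun x => C%:E * (\1_E x)%:E).
  apply: Mplus_ge0; last by move=> x _; rewrite mule_ge0// lee_fin.
  by apply: leb_measurable_funM; [exact: leb_measurable_cst|case: pE].
apply: le_lt_trans (ri_monotone hN ps pCE _) _; last first.
  rewrite (ri_homogeneous hN C0 pE) lte_mul_pinfty ?lee_fin//.
apply: ae_onW => x [x0 xL]; rewrite /step.
have [nx|xn] := leqP n (Num.truncn (x / d)); first by rewrite cn// mule_ge0// lee_fin.
rewrite indicE mem_set/=; last by split=> //; rewrite lte_fin -truncn_lt// ltW.
rewrite mule1 lee_fin /C (bigD1 (Ordinal xn))//= lerDl; exact: sumr_ge0.
Qed.

(* Cyclic shifts inside blocks of length m give functions equimeasurable with y,
   and the mean of the shifts is the block average of y. *)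
Lemma ri_norm_step_average d n m (y : nat -> R) : (0 < d)%R -> (0 < m)%N ->
  (n%:R * d)%:E <= L ->
  (forall i, 0 <= y i)%R -> (forall i, (n * m <= i)%N -> y i = 0%R) ->
  N (step d (fun i => (\sum_(l < m) y (i * m + l)%N) / m%:R)%R) <=
  N (step (d / m%:R) y).
Proof.
move=> d0 m0 nL y0 yn.
have m0' : (0 < m%:R :> R)%R by rewrite ltr0n.
have dm0 : (0 < d / m%:R)%R by rewrite divr_gt0.
pose z r k := y ((k %/ m) * m + (k %% m + r) %% m)%N.
pose c i := ((\sum_(l < m) y (i * m + l)%N) / m%:R)%R.
have z0 r i : (0 <= z r i)%R by exact: y0.
have pz r : Mplus L (step (d / m%:R) (z r)) by exact: step_Mplus.
have pc : Mplus L (step d c).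
  by apply: step_Mplus => // i; rewrite divr_ge0// ?sumr_ge0// ltW.
have [pS NS] := ri_norm_sum m pz.
have zE r : N (step (d / m%:R) (z r)) = N (step (d / m%:R) y).
  apply: (ri_rearrangement hN (pz r) (step_Mplus L dm0 y0)).
  apply: (@equimeasurable_step _ _ _ _ _ (n * m)%N) => //.
  - by rewrite natrM -mulrA [(m%:R * _)%R]mulrC divfK// gt_eqF.
  - move=> i ni; apply: yn; apply: leq_trans (leq_addr _ _).
    by rewrite leq_pmul2r// leq_divRL.
  - move=> F; rewrite (sum_ord_mul n m (fun k => F (z r k))).
    rewrite (sum_ord_mul n m (fun k => F (y k))); apply: eq_bigr => i _.
    rewrite -(@sum_ord_rot _ m r (fun l => F (y (i * m + l)%N))).
    apply: eq_bigr => l _.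
    by rewrite /z divnMDl// divn_small// addn0 modnMDl (modn_small (ltn_ord l)).
have pmS : Mplus L (fun t => (m%:R^-1)%:E * \sum_(r < m) step (d / m%:R) (z r) t).
  have [mS S0] := pS; split.
    by apply: leb_measurable_funM; [exact: leb_measurable_cst|exact: mS].
  by apply: ae_onS S0 => x _ ?; rewrite mule_ge0// lee_fin invr_ge0 ltW.
apply: (le_trans (ri_monotone hN pc pmS _)).
  apply: ae_onW => t [t0 _]; rewrite (step_refine _ d0 m0 (ltW t0)) /step.
  set k := Num.truncn _; rewrite sumEFin -EFinM lee_fin /c mulrC.
  rewrite ler_pM2l ?invr_gt0//; apply: le_of_eq.
  rewrite -(@sum_ord_rot _ m (k %% m) (fun l => y (k %/ m * m + l)%N)).
  by apply: eq_bigr => l _; rewrite /z [(l + _)%N]addnC.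
rewrite (ri_homogeneous hN _ pS) ?invr_ge0//.
rewrite lee_pdivrMl//; apply: le_trans NS _.
rewrite (eq_bigr (fun=> N (step (d / m%:R) y)))//.
by rewrite big_const_ord iter_addr_0 mule_natl.
Qed.

End StepNorm.

Section Extension.
Context {R : realType} (n : nat).

Definition zero_ext (a : 'I_n -> R) (i : nat) : R := oapp a 0%R (insub i).

Lemma zero_ext_val a (i : 'I_n) : zero_ext a i = a i.
Proof. by rewrite /zero_ext valK. Qed.

Lemma zero_ext_out a i : (n <= i)%N -> zero_ext a i = 0%R.
Proof. by move=> ni; rewrite /zero_ext insubF// ltnNge ni. Qed.

Lemma zero_ext_ge0 a i : (forall j, 0 <= a j)%R -> (0 <= zero_ext a i)%R.
Proof.
move=> a0; have [ni|iltn] := leqP n i; first by rewrite zero_ext_out.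
by have := zero_ext_val a (Ordinal iltn); rewrite /= => ->.
Qed.

Lemma zero_ext_le a b i : (forall j, a j <= b j)%R -> (zero_ext a i <= zero_ext b i)%R.
Proof.
move=> ab; have [ni|iltn] := leqP n i; first by rewrite !zero_ext_out.
have := zero_ext_val a (Ordinal iltn); have := zero_ext_val b (Ordinal iltn).
by rewrite /= => -> ->.
Qed.

End Extension.

(** * Duality for step functions and passage to the limit *)

Section Duality.
Context {R : realType}.
Variables (L : \bar R) (N : (R -> \bar R) -> \bar R).
Hypothesis L0 : 0 < L.
Hypothesis hN : ri_norm L N.
Implicit Types (d : R) (c : nat -> R) (n : nat) (f g : R -> \bar R).

Let mI : leb_measurable (ioo 0 L). Proof. exact: measurable_ioo. Qed.

Lemma step_le d c c' : (forall i, c i <= c' i)%R -> forall t, step d c t <= step d c' t.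
Proof. by move=> cc' t; rewrite lee_fin. Qed.

Lemma stepM d c c' t : step d c t * step d c' t = step d (fun i => c i * c' i)%R t.
Proof. by rewrite /step EFinM. Qed.

Lemma step_noninc d c : (0 < d)%R ->
  (forall i j, (i <= j)%N -> c j <= c i)%R ->
  forall s t, (s <= t)%R -> step d c t <= step d c s.
Proof.
move=> d0 cni s t st; rewrite lee_fin; apply: cni; apply: le_truncn.
by rewrite ler_pM2r// invr_gt0.
Qed.

(* By Hahn-Banach the norm of a step function is attained at a functional of
   coordinates; sorting its coefficients makes it a nonincreasing step
   function, which lies in the unit ball of the associate norm because cell
   averaging contracts N. *)
Section DualStep.
Variables (d : R) (n : nat).
Hypothesis d0 : (0 < d)%R.
Hypothesis nL : (n%:R * d)%:E <= L.

Let nrm (x : 'I_n -> R) : \bar R := N (step d (zero_ext x)).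

Let nrm_M (x : 'I_n -> R) : (forall i, 0 <= x i)%R -> Mplus L (step d (zero_ext x)).
Proof. by move=> x0; apply: step_Mplus => // i; exact: zero_ext_ge0. Qed.

Let nrm_fin (x : 'I_n -> R) : (forall i, 0 <= x i)%R -> nrm x \is a fin_num.
Proof.
move=> x0; rewrite /nrm; apply: (@ri_norm_step_fin _ L N hN d _ n) => // i.
  exact: zero_ext_ge0.
exact: zero_ext_out.
Qed.

Let nrm_le (x y : 'I_n -> R) : (forall i, 0 <= x i)%R -> (forall i, x i <= y i)%R ->
  nrm x <= nrm y.
Proof.
move=> x0 xy; have y0 i : (0 <= y i)%R by exact: le_trans (xy i).
apply: (ri_monotone hN (nrm_M x0) (nrm_M y0)); apply: ae_onW => t _.
by apply: step_le => i; exact: zero_ext_le.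
Qed.

Let nrm_D (x y : 'I_n -> R) : (forall i, 0 <= x i)%R -> (forall i, 0 <= y i)%R ->
  nrm (fun i => x i + y i)%R <= nrm x + nrm y.
Proof.
move=> x0 y0; apply: le_trans (ri_triangle hN (nrm_M x0) (nrm_M y0)).
rewrite /nrm; apply: le_of_eq; congr N.
apply/funext => t; rewrite /step -EFinD; congr EFin.
have [ni|iltn] := leqP n (Num.truncn (t / d)).
  by rewrite !zero_ext_out// addr0.
by have E a := zero_ext_val a (Ordinal iltn); rewrite /= in E; rewrite !E.
Qed.

Let nrm_Z (a : R) (x : 'I_n -> R) : (0 <= a)%R -> (forall i, 0 <= x i)%R ->
  nrm (fun i => a * x i)%R = a%:E * nrm x.
Proof.
move=> a0 x0; rewrite -(ri_homogeneous hN a0 (nrm_M x0)) /nrm; congr N.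
apply/funext => t; rewrite /step -EFinM; congr EFin.
have [ni|iltn] := leqP n (Num.truncn (t / d)).
  by rewrite !zero_ext_out// mulr0.
by have E b := zero_ext_val b (Ordinal iltn); rewrite /= in E; rewrite !E.
Qed.

Let nrm_perm (s : {perm 'I_n}) (x : 'I_n -> R) : (forall i, 0 <= x i)%R ->
  nrm (fun i => x (s i)) = nrm x.
Proof.
move=> x0; apply: (ri_rearrangement hN); [exact: nrm_M|exact: nrm_M|].
apply: (equimeasurable_step d0 nL) => [i|i|F]; try exact: zero_ext_out.
rewrite [RHS](reindex_inj (@perm_inj _ s))/=.
by apply: eq_bigr => i _; rewrite !zero_ext_val.
Qed.

(** N is controlled only on nonnegative functions, so Hahn-Banach is applied to the norm of |y|. The
    coefficients a may then be replaced by |a|: putting the signs of a on a nonnegative test vector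
    y does not increase the norm of its modulus. *)
Let exists_functional (x : 'I_n -> R) : (forall i, 0 <= x i)%R ->
  exists b : 'I_n -> R, [/\ (forall i, 0 <= b i)%R,
    (forall y : 'I_n -> R, (forall i, 0 <= y i)%R -> (\sum_i b i * y i)%:E <= nrm y) &
    nrm x <= (\sum_i b i * x i)%:E].
Proof.
move=> x0.
pose p (y : 'rV[R]_n) : R := fine (nrm (fun i => `|y ord0 i|)%R).
have abs0 (y : 'rV[R]_n) i : (0 <= `|y ord0 i|)%R by [].
have sp : sublinear p.
  split=> [y z|a y a0].
    rewrite /p -fineD ?nrm_fin// fine_le ?nrm_fin//.
      by rewrite fin_numD !nrm_fin.
    apply: le_trans (nrm_D (abs0 y) (abs0 z)); apply: nrm_le => // i.
    by rewrite mxE ler_normD.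
  rewrite /p -[a in RHS]/(fine a%:E) -fineM ?nrm_fin// -nrm_Z ?ltW//.
  by congr (fine (nrm _)); apply/funext => i; rewrite mxE normrM gtr0_norm.
have [a [ap xa]] := hahn_banach_row (\row_i x i) sp.
exists (fun i => `|a i|)%R; split=> //.
- move=> y y0; pose y' := (\row_i (Num.sg (a i) * y i))%R : 'rV[R]_n.
  apply: (@le_trans _ _ (p y')%:E).
    rewrite lee_fin; apply: le_trans (ap y').
    apply: le_of_eq; apply: eq_bigr => i _.
    by rewrite mxE mulrA [(a i * _)%R]mulrC -normrEsg.
  rewrite /p fineK ?nrm_fin//; apply: nrm_le => // i.
  rewrite mxE normrM (ger0_norm (y0 i)) ler_piMl// normr_sg.
  by case: (_ == _).
- rewrite -(fineK (nrm_fin x0)) lee_fin.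
  have -> : fine (nrm x) = p (\row_i x i)%R.
    by rewrite /p; congr (fine (nrm _)); apply/funext => i; rewrite mxE ger0_norm.
  apply: le_trans xa _; apply: ler_sum => i _; rewrite mxE ler_wpM2r//.
  exact: ler_norm.
Qed.

Lemma dual_step c : (forall i, 0 <= c i)%R -> (forall i, (n <= i)%N -> c i = 0%R) ->
  (forall i j, (i <= j)%N -> c j <= c i)%R ->
  exists g, [/\ Mplus L g, (forall t, 0 <= g t), associate L N g <= 1 &
    N (step d c) <= \int[leb]_(t in ioo 0 L) (step d c t * g t)].
Proof.
move=> c0 cn cni.
have L0' := ltW L0.
pose x (i : 'I_n) := c i.
have xE i : zero_ext x i = c i.
  have [ni|iltn] := leqP n i; first by rewrite zero_ext_out// cn.
  by have := zero_ext_val x (Ordinal iltn); rewrite /= => ->.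
have [b [b0 bnrm xb]] := exists_functional (fun i => c0 i : (0 <= x i)%R).
have [s sb] := exists_sorting_perm b.
(* Division by the cell length d turns sums over coefficients into integrals. *)
pose h := zero_ext (fun i => b i / d)%R.
pose g := zero_ext (fun i => b (s i) / d)%R.
have bd0 i : (0 <= b i / d)%R by rewrite divr_ge0// ltW.
have h0 i : (0 <= h i)%R by exact: zero_ext_ge0.
have g0 i : (0 <= g i)%R by apply: zero_ext_ge0 => j.
have gn i : (n <= i)%N -> g i = 0%R by exact: zero_ext_out.
have hn i : (n <= i)%N -> h i = 0%R by exact: zero_ext_out.
have gni i j : (i <= j)%N -> (g j <= g i)%R.
  move=> ij; have [nj|jn] := leqP n j; first by rewrite gn.
  have iltn := leq_ltn_trans ij jn.
  have := zero_ext_val (fun i => b (s i) / d)%R (Ordinal iltn).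
  have := zero_ext_val (fun i => b (s i) / d)%R (Ordinal jn).
  rewrite /g/= => -> ->; rewrite ler_pM2r ?invr_gt0//; exact: sb.
have pg := step_Mplus L d0 g0.
have ph := step_Mplus L d0 h0.
have pc := step_Mplus L d0 c0.
have [mg _] := pg; have [mh _] := ph; have [mc _] := pc.
have gh : equimeasurable L (step d h) (step d g).
  apply: (equimeasurable_step d0 nL) => // F.
  rewrite (reindex_inj (@perm_inj _ s))/=.
  by apply: eq_bigr => i _; rewrite /h /g !zero_ext_val.
have rg t : ioo 0 L t -> rearr L (step d g) t <= step d g t.
  move=> It; apply: rearr_le_noninc => //; first by move=> ? _; rewrite lee_fin.
  by move=> ? ? _ _; exact: step_noninc.
exists (step d g); split=> //.
- by move=> t; rewrite lee_fin.
- apply: ge_ereal_sup => _ [f [pf Nf1] <-].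
  have [mf _] := pf.
  (* A fixed range is enough: [step d g] vanishes beyond n d, so f^* matters only on (0, n d). *)
  pose e := fun _ : nat => n.
  pose low := lower_step (rearr L f) d e.
  have low0 j t : 0 <= low j t by apply: lower_step_ge0 => ?; exact: rearr_ge0.
  have dj0 j : (0 < d / 2 ^+ j)%R by rewrite divr_gt0// exprn_gt0.
  have coef0 j i : (0 <= lower_coef (rearr L f) d e j i)%R.
    by apply: lower_coef_ge0 => ?; exact: rearr_ge0.
  have plow j : Mplus L (low j) by apply: step_Mplus.
  have mrf : leb_measurable_fun (ioo 0 L) (rearr L f) by exact: rearr_M.
  have rni (s' t : R) : (s' <= t)%R -> rearr L f t <= rearr L f s'.
    exact: rearr_noninc.
  have rf0 t : 0 <= rearr L f t by exact: rearr_ge0.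
  have low_le j t : ioo 0 L t -> low j t <= rearr L f t.
    by move=> [t0 _]; apply: lower_step_le => //; exact: ltW.
  have low_nd t : ioo 0 L t -> nondecreasing_seq (low ^~ t).
    by move=> [t0 _]; apply: lower_step_nd => //; exact: ltW.
  have low_cvg t : ioo 0 L t -> (t < n%:R * d)%R -> low j t @[j --> \oo] --> rearr L f t.
    move=> [t0 _] tn; apply: lower_step_cvg => //; [|exact: ltW|by exists 0%N].
    by move=> t' r t'0; exact: rearr_rc.
  have cvgI : \int[leb]_(t in ioo 0 L) (step d g t * low j t) @[j --> \oo] -->
      \int[leb]_(t in ioo 0 L) (step d g t * rearr L f t).
    apply: leb_cvg_integral_nd => //.
    + by move=> j; apply: leb_measurable_funM; [exact: mg|case: (plow j)].
    + by move=> j t _; rewrite mule_ge0// lee_fin.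
    + move=> t It i j ij; apply: lee_wpmul2l; first by rewrite lee_fin.
      exact: (low_nd _ It).
    + move=> t It; have [tn|nt] := ltP t (n%:R * d)%R.
        apply: mule_cvg_nd; [by rewrite lee_fin| |exact: low_cvg].
        by move=> j; rewrite low0/= low_le.
      have g0E : step d g t = 0.
        rewrite /step gn// leqNgt truncn_lt//; last by case: It => /ltW.
        by rewrite -leNgt.
      rewrite g0E mul0e (_ : (fun j => 0 * low j t) = fun=> 0); first exact: cvg_cst.
      by apply/funext => j; rewrite mul0e.
  (* On the grid of mesh d / 2^j the function [step d g] is constant on blocks of m = 2^j cells, so
     the integral sees only the block averages [cy]. The bound on b applies to them after a
     permutation, and averaging does not increase N. *)
  have le1 j : \int[leb]_(t in ioo 0 L) (step d g t * low j t) <= 1.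
    pose m := (2 ^ j)%N; have m0 : (0 < m)%N by rewrite expn_gt0.
    have m0' : (0 < m%:R :> R)%R by rewrite ltr0n.
    have dmE : (d / m%:R = d / 2 ^+ j)%R by rewrite /m natrX.
    have dm0 : (0 < d / m%:R)%R by rewrite divr_gt0.
    pose y := lower_coef (rearr L f) d e j.
    have yn i : (n * m <= i)%N -> y i = 0%R by exact: lower_coef_out.
    have lowE : low j = step (d / m%:R) y by rewrite dmE.
    pose cy (i : nat) := ((\sum_(l < m) y (i * m + l)%N) / m%:R)%R.
    have cy0 i : (0 <= cy i)%R.
      by apply: divr_ge0 => //; apply: sumr_ge0 => l _; exact: coef0.
    have -> : \int[leb]_(t in ioo 0 L) (step d g t * low j t) =
        (\sum_i b i * cy ((s^-1)%g i))%:E.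
      transitivity (\int[leb]_(t in ioo 0 L)
          step (d / m%:R) (fun k => g (k %/ m)%N * y k)%R t).
        apply: leb_eq_integral => t [t0 _].
        by rewrite (step_refine _ d0 m0 (ltW t0)) lowE stepM.
      rewrite (@step_integral _ _ _ _ (n * m)%N)//; last 3 first.
      * by rewrite natrM -mulrA [(m%:R * _)%R]mulrC divfK// gt_eqF.
      * by move=> i; rewrite mulr_ge0// coef0.
      * by move=> i /yn ->; rewrite mulr0.
      congr (_%:E); rewrite (sum_ord_mul n m (fun k => g (k %/ m)%N * y k * (d / m%:R))%R).
      rewrite [RHS](reindex_inj (@perm_inj _ s))/=.
      apply: eq_bigr => i _; rewrite permK /cy mulrA mulr_sumr mulr_suml.
      apply: eq_bigr => l _.
      rewrite divnMDl// divn_small// addn0 /g zero_ext_val.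
      rewrite mulrACA divfK ?gt_eqF// .
      by rewrite -mulrA.
    apply: (le_trans (bnrm (fun i => cy ((s^-1)%g i)) _)) => //.
    rewrite (@nrm_perm (s^-1)%g (fun i => cy i))//.
    apply: (@le_trans _ _ (N (step d cy))).
      apply: (ri_monotone hN); [exact: nrm_M|exact: step_Mplus|].
      apply: ae_onW => t _; apply: step_le => i.
      have [ni|iltn] := leqP n i; first by rewrite zero_ext_out.
      by have := zero_ext_val (fun i : 'I_n => cy i) (Ordinal iltn); rewrite /= => ->.
    apply: (le_trans (ri_norm_step_average hN d0 m0 nL (coef0 j) yn)).
    rewrite -lowE; apply: (@le_trans _ _ (N (rearr L f))).
      apply: (ri_monotone hN) => //; first exact: rearr_Mplus.
      by apply: ae_onW => t It; exact: low_le.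
    rewrite (ri_rearrangement hN (rearr_Mplus L f) pf)//.
    exact: equimeasurable_rearr.
  apply: (@le_trans _ _ (\int[leb]_(t in ioo 0 L) (step d g t * rearr L f t))).
    apply: (@le_trans _ _ (\int[leb]_(t in ioo 0 L) (`|step d g t| * `|f t|))).
      apply: le_of_eq; apply: leb_ae_eq_integral => //.
      + by apply: leb_measurable_funM.
      + by apply: leb_measurable_funM; exact: leb_measurable_abs.
      + apply: ae_onS (Mplus_eq_abs pf) => t _ ->.
        by rewrite gee0_abs// lee_fin.
    apply: (le_trans (hardy_littlewood L0' mg mf)).
    apply: leb_le_integral => //.
    + by apply: leb_measurable_funM; exact: rearr_M.
    + by apply: leb_measurable_funM; [exact: mg|exact: rearr_M].
    + by move=> t _; rewrite mule_ge0// rearr_ge0.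
    + by move=> t It; apply: lee_wpmul2r => //; exact: rg.
  rewrite -(cvg_lim _ cvgI)//; apply: lime_le.
    by apply/cvg_ex; eexists; exact: cvgI.
  exact: nearW.
(* The functional pairs c with the unsorted [h]; Hardy-Littlewood passes from [h] to its sorted form
   [g], since [step d c] and [step d g] are already nonincreasing. *)
- have -> : N (step d c) = nrm x.
    by rewrite /nrm; congr (N (step _ _)); apply/funext => i; rewrite xE.
  apply: (le_trans xb).
  have -> : (\sum_i b i * x i)%:E = \int[leb]_(t in ioo 0 L) (`|step d c t| * `|step d h t|).
    transitivity (\int[leb]_(t in ioo 0 L) step d (fun i => c i * h i)%R t); last first.
      by apply: leb_eq_integral => t _; rewrite -stepM !gee0_abs// lee_fin.
    rewrite (@step_integral _ _ _ _ n)//; last 2 first.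
    + by move=> i; rewrite mulr_ge0.
    + by move=> i /cn ->; rewrite mul0r.
    congr (_%:E); apply: eq_bigr => i _; rewrite /h zero_ext_val.
    by rewrite -mulrA divfK ?gt_eqF// mulrC.
  apply: (le_trans (hardy_littlewood L0' mc mh)); rewrite (eq_rearr gh).
  apply: leb_le_integral => //.
  + by apply: leb_measurable_funM; exact: rearr_M.
  + by apply: leb_measurable_funM.
  + by move=> t _; rewrite mule_ge0// rearr_ge0.
  + move=> t It; apply: lee_pmul; [exact: rearr_ge0|exact: rearr_ge0| |exact: rg].
    apply: rearr_le_noninc => //; first by move=> ? _; rewrite lee_fin.
    by move=> ? ? _ _; exact: step_noninc.
Qed.

End DualStep.

(* The nontrivial half of the Lorentz-Luxemburg identity N = N''. *)
Lemma ri_norm_dual (F : R -> \bar R) (B : \bar R) : M L F ->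
  (forall t, ioo 0 L t -> 0 <= F t) ->
  (forall s t, ioo 0 L s -> ioo 0 L t -> (s <= t)%R -> F t <= F s) ->
  (forall g, Mplus L g -> (forall t, 0 <= g t) -> associate L N g <= 1 ->
    \int[leb]_(t in ioo 0 L) (F t * g t) <= B) ->
  N F <= B.
Proof.
move=> mF F0 Fni FB; have L0' := ltW L0.
have pF : Mplus L F by exact: Mplus_ge0.
rewrite -(ri_rearrangement hN (rearr_Mplus L F) pF (equimeasurable_rearr L0' mF)).
(* For finite L a single cell of length L is subdivided; for L = oo the grid starts from unit cells,
   and stage j covers (0, j). *)
have [d [e [d0 e_nd edL e_cover]]] : exists (d : R) (e : nat -> nat),
    [/\ (0 < d)%R, {homo e : i j / (i <= j)%N >-> (i <= j)%N},
      (forall j, ((e j)%:R * d)%:E <= L) &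
      (forall t, ioo 0 L t -> exists j, (t < (e j)%:R * d)%R)].
  move: (L) L0 => [r||//] L_gt0.
    exists r, (fun=> 1%N); split=> //; first by move=> _; rewrite mul1r.
    by move=> t [_ tr]; exists 0%N; rewrite mul1r -lte_fin.
  exists 1%R, id; split=> //; first by move=> j; rewrite leey.
  by move=> t _; exists (Num.truncn t).+1; rewrite mulr1 truncnS_gt.
pose k := rearr L F; pose low := lower_step k d e.
have k0 t : 0 <= k t by exact: rearr_ge0.
have k_ni (s t : R) : (s <= t)%R -> k t <= k s by exact: rearr_noninc.
have k_rc (t r : R) : (0 <= t)%R -> r%:E < k t -> exists s, (t < s)%R /\ r%:E < k s.
  by move=> t0; exact: rearr_rc.
have dj0 j : (0 < d / 2 ^+ j)%R by rewrite divr_gt0// exprn_gt0.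
have coef0 j i : (0 <= lower_coef k d e j i)%R by exact: lower_coef_ge0.
have plow j : Mplus L (low j) by exact: step_Mplus.
have pk : Mplus L k by exact: rearr_Mplus.
have [nd cN] : nondecreasing_seq (fun j => N (low j)) /\ N (low j) @[j --> \oo] --> N k.
  apply: (ri_fatou hN plow pk); apply: ae_onW => t It.
  have t0 : (0 <= t)%R by case: It => /ltW.
  split; first exact: lower_step_nd.
  by apply: lower_step_cvg => //; exact: e_cover.
rewrite -(cvg_lim _ cN)//; apply: lime_le; first by apply/cvg_ex; eexists; exact: cN.
apply: nearW => j.
have nL : ((e j * 2 ^ j)%:R * (d / 2 ^+ j))%:E <= L.
  by rewrite natrM natrX -mulrA [(2 ^+ j * _)%R]mulrC divfK// expf_neq0.
have [g [pg g0 Ng Nlow]] := dual_step (dj0 j) nL (coef0 j)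
  (fun i => @lower_coef_out _ k d e j i) (fun i i' => @lower_coef_ni _ k d e d0 k0 k_ni j i i').
apply: (le_trans Nlow); apply: le_trans (FB _ pg g0 Ng).
have [mg _] := pg; have [mlow _] := plow j.
apply: leb_le_integral => //.
- by apply: leb_measurable_funM.
- by apply: leb_measurable_funM.
- by move=> t _; rewrite mule_ge0// lee_fin.
- move=> t It; apply: lee_wpmul2r => //; apply: (@le_trans _ _ (k t)).
    by apply: lower_step_le => //; case: It => /ltW.
  exact: rearr_le_noninc.
Qed.

End Duality.

(** * The Hardy operator and the supremum operator *)

Section BijectionFubini.
Context {R : realType}.
Variables (L : \bar R) (nu : R -> R).
Hypothesis hnu : increasing_bij L nu.

Let mI : leb_measurable (ioo 0 L). Proof. exact: measurable_ioo. Qed.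

Lemma nu_ioo t : ioo 0 L t -> ioo 0 L (nu t).
Proof. by case: hnu => -[+ _ _] _ It; apply. Qed.

Lemma nu_lt s t : ioo 0 L s -> ioo 0 L t -> (nu s < nu t)%R = (s < t)%R.
Proof.
case: hnu => _ mono Is It; apply/idP/idP; last exact: mono.
apply: contraLR; rewrite -!leNgt le_eqVlt => /predU1P[->//|ts].
by apply/ltW/mono.
Qed.

Lemma nuinvP t : ioo 0 L t -> ioo 0 L (nuinv L nu t) /\ nu (nuinv L nu t) = t.
Proof.
move=> It; have [_ tL] := It; rewrite /nuinv lt_eqF//.
have [[_ _ surj] _] := hnu.
have tim : (nu @` ioo 0 L) t by exact: surj.
split; last by apply: pinvK; rewrite inE.
have [x Ix <-] := tim.
have inj : {in ioo 0 L &, injective nu} by case: hnu => -[].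
by rewrite pinvKV ?inE.
Qed.

Lemma nuinv_ioo t : ioo 0 L t -> ioo 0 L (nuinv L nu t).
Proof. by move=> /nuinvP[]. Qed.

Lemma nuinvK t : ioo 0 L t -> nu (nuinv L nu t) = t.
Proof. by move=> /nuinvP[]. Qed.

Lemma lt_nuinv s t : ioo 0 L s -> ioo 0 L t -> (s < nuinv L nu t)%R = (nu s < t)%R.
Proof. by move=> Is It; rewrite -[in RHS](nuinvK It) nu_lt//; exact: nuinv_ioo. Qed.

Lemma le_nuinv s t : ioo 0 L s -> ioo 0 L t -> (s <= t)%R ->
  (nuinv L nu s <= nuinv L nu t)%R.
Proof.
move=> Is It st; rewrite leNgt lt_nuinv//; last exact: nuinv_ioo.
by rewrite nuinvK// -leNgt.
Qed.

Lemma le_nu s t : ioo 0 L s -> ioo 0 L t -> (s <= t)%R -> (nu s <= nu t)%R.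
Proof. by move=> Is It st; rewrite leNgt nu_lt// -leNgt. Qed.

Lemma sub_ioo_nu t : ioo 0 L t -> ioo (nu t) L `<=` ioo 0 L.
Proof. by move=> /nu_ioo[nt0 _]; apply: subset_ioo => //; exact: ltW. Qed.

Lemma sub_ioo_nuinv t : ioo 0 L t -> ioo 0 (nuinv L nu t)%:E `<=` ioo 0 L.
Proof. by move=> /nuinv_ioo[_ tL]; apply: subset_ioo => //; exact: ltW. Qed.

(** Both sides integrate a(t) b(s) over the region nu(t) < s, which is also t < nu^-1(s). *)
Lemma fubini_nu (a b : R -> \bar R) :
  leb_measurable_fun (ioo 0 L) a -> leb_measurable_fun (ioo 0 L) b ->
  (forall x, ioo 0 L x -> 0 <= a x) -> (forall x, ioo 0 L x -> 0 <= b x) ->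
  \int[leb]_(t in ioo 0 L) (a t * \int[leb]_(s in ioo (nu t) L) b s) =
  \int[leb]_(s in ioo 0 L) (b s * \int[leb]_(t in ioo 0 (nuinv L nu s)%:E) a t).
Proof.
move=> ma mb a0 b0.
pose I : set (lebR R) := ioo 0 L.
pose a' : lebR R -> \bar R := a \_ I; pose b' : lebR R -> \bar R := b \_ I.
pose nu' : lebR R -> \bar R := (EFin \o nu) \_ I.
have ma' : measurable_fun setT a' by exact/(measurable_restrictT _ mI).
have mb' : measurable_fun setT b' by exact/(measurable_restrictT _ mI).
have mnu' : measurable_fun setT nu'.
  apply/(measurable_restrictT _ mI); apply: monotone_emeasurable.
    exact: ioo_interval.
  by right => x y Ix Iy xy; rewrite lee_fin; exact: le_nu.
have a'0 x : 0 <= a' x by rewrite /a' patchE; case: ifPn => //; rewrite inE; exact: a0.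
have b'0 x : 0 <= b' x by rewrite /b' patchE; case: ifPn => //; rewrite inE; exact: b0.
pose A : set (lebR R * lebR R) := [set z | I z.1 /\ nu' z.1 < (z.2)%:E].
have mid : measurable_fun [set: lebR R] (fun s : lebR R => (s : R)%:E).
  apply: monotone_emeasurable; last by right => x y _ _ xy; rewrite lee_fin.
  by [].
have mA : measurable A.
  rewrite (_ : A = (fst @^-1` I) `&` ([set: lebR R * lebR R] `&`
      [set z : lebR R * lebR R | nu' z.1 < (z.2 : R)%:E])).
    apply: measurableI.
      by rewrite -[X in measurable X]setTI; exact: measurable_fst.
    apply: measurable_lte => //.
      by apply: (@measurableT_comp _ _ _ _ _ _ nu' _ fst).
    by apply: (@measurableT_comp _ _ _ _ _ _ (fun s : lebR R => (s : R)%:E) _ snd).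
  by apply/seteqP; split=> z /=; [case|move=> [? []]].
pose f (z : lebR R * lebR R) : \bar R := a' z.1 * (b' z.2 * (\1_A z)%:E).
have mf : measurable_fun setT f.
  apply: emeasurable_funM.
    by apply: (@measurableT_comp _ _ _ _ _ _ a' _ fst).
  apply: emeasurable_funM.
    by apply: (@measurableT_comp _ _ _ _ _ _ b' _ snd).
  by apply/measurable_EFinP; exact: measurable_indic.
have f0 z : 0 <= f z by rewrite !mule_ge0// lee_fin.
have mind1 t : measurable_fun [set: lebR R] (fun s => (\1_A (t, s))%:E : \bar R).
  apply/measurable_EFinP.
  by apply: (@measurableT_comp _ _ _ _ _ _ (\1_A : lebR R * lebR R -> R) _ (pair t)).
have mind2 s : measurable_fun [set: lebR R] (fun t => (\1_A (t, s))%:E : \bar R).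
  apply/measurable_EFinP.
  by apply: (@measurableT_comp _ _ _ _ _ _ (\1_A : lebR R * lebR R -> R) _ (pair^~ s)).
have mbi t : measurable_fun [set: lebR R] (fun s => b' s * (\1_A (t, s))%:E : \bar R).
  by apply: emeasurable_funM; [exact: mb'|exact: mind1].
have mai s : measurable_fun [set: lebR R] (fun t => a' t * (\1_A (t, s))%:E : \bar R).
  by apply: emeasurable_funM; [exact: ma'|exact: mind2].
rewrite [LHS]integral_mkcond [RHS]integral_mkcond.
transitivity (\int[leb]_t \int[leb]_s f (t, s)).
  apply: eq_integral => t _; rewrite patchE; case: ifPn => [|tI]; last first.
    by rewrite integral0_eq// => s _; rewrite /f/= /a' patchE (negbTE tI) mul0e.
  rewrite inE => It.
  transitivity (a' t * \int[leb]_s (b' s * (\1_A (t, s))%:E)); last first.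
    have h0 (s : lebR R) : [set: lebR R] s -> 0 <= b' s * (\1_A (t, s))%:E.
      by move=> _; rewrite mule_ge0// lee_fin.
    by rewrite -(leb_integralZl (D := setT) measurableT (mbi t) h0 (a'0 t)).
  rewrite {1}/a' patchE mem_set//; congr (_ * _).
  rewrite integral_mkcond; apply: eq_integral => s _; rewrite patchE indicE.
  have -> : ((t, s) \in A) = (nu t < s)%R.
    apply/idP/idP; rewrite inE /A/= /nu' patchE mem_set//=.
    by case.
  rewrite /b' patchE.
  have [It' _] := nu_ioo It.
  case: ifPn => [|sI].
    rewrite inE => -[ns sL].
    by rewrite ns mule1 mem_set//; split=> //; exact: lt_trans ns.
  case: ifPn => [|_]; last by rewrite mul0e.
  rewrite inE => -[s0 sL].
  rewrite (_ : (nu t < s)%R = false) ?mule0//; apply/negbTE; apply: contra sI => ns.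
  by rewrite inE; split.
rewrite (tonelli_leb mf f0).
apply: eq_integral => s _; rewrite patchE; case: ifPn => [|sI]; last first.
  by rewrite integral0_eq// => t _; rewrite /f/= /b' patchE (negbTE sI) mul0e mule0.
rewrite inE => Is.
transitivity (b' s * \int[leb]_t (a' t * (\1_A (t, s))%:E)).
  have h0 (t : lebR R) : [set: lebR R] t -> 0 <= a' t * (\1_A (t, s))%:E.
    by move=> _; rewrite mule_ge0// lee_fin.
  rewrite -(leb_integralZl (D := setT) measurableT (mai s) h0 (b'0 s)).
  by apply: eq_integral => t _; rewrite /f/= muleCA.
rewrite {1}/b' patchE mem_set//; congr (_ * _).
rewrite [RHS]integral_mkcond; apply: eq_integral => t _; rewrite patchE indicE /a' patchE.
have [tI|tI] := boolP (t \in I); last first.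
  rewrite mul0e ifF//; apply/negbTE; apply: contra tI; rewrite !inE.
  exact: sub_ioo_nuinv.
have It : ioo 0 L t by move: tI; rewrite inE.
have -> : ((t, s) \in A) = (t < nuinv L nu s)%R.
  rewrite lt_nuinv//; apply/idP/idP; rewrite inE /A/= /nu' patchE mem_set//=.
  by case.
have -> : (t \in ioo 0 (nuinv L nu s)%:E) = (t < nuinv L nu s)%R.
  apply/idP/idP; rewrite inE; first by case.
  by case: It => t0 _ h; split.
by case: ifP; rewrite ?mule1 ?mule0.
Qed.

End BijectionFubini.

(** * Essential suprema over tails *)

Section EssSup.
Context {R : realType}.
Variable L : \bar R.
Implicit Types (F : R -> \bar R) (D : set R) (t : R).

Lemma ae_on_absurd D : leb_measurable D -> ae_on D (fun=> False) ->
  leb (D : set (lebR R)) = 0.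
Proof.
move=> mD D0; apply/eqP; rewrite eq_le measure_ge0 andbT.
have := @le_leb_ae R D set0 mD measurable0 D0.
by rewrite measure0.
Qed.

Lemma ae_on_subset D E (P : R -> Prop) : D `<=` E -> ae_on E P -> ae_on D P.
Proof. by move=> DE; apply: ae_leb_imp => x Px Dx; apply: Px; exact: DE. Qed.

Lemma leb_ico_gt0 t : ioo 0 L t -> 0 < leb (ico t L : set (lebR R)).
Proof.
move=> [t0 tL].
have [s [ts sL]] : exists s : R, (t < s)%R /\ s%:E <= L.
  move: tL; case: L => [r||//]; first by rewrite lte_fin => tr; exists r.
  by move=> _; exists (t + 1)%R; rewrite ltrDl leey.
apply: (@lt_le_trans _ _ (leb (ico t s%:E : set (lebR R)))).
  by rewrite leb_ico_fin ?ltW// lte_fin subr_gt0.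
apply: le_leb; [exact: measurable_ico|exact: measurable_ico|].
by move=> x [tx xs]; split=> //; exact: lt_le_trans sL.
Qed.

Lemma ess_sup_on_lt D F (y : \bar R) : ess_sup_on D F < y -> ae_on D (fun x => F x <= y).
Proof.
move=> /ereal_inf_lt[z Fz zy]; apply: ae_onS Fz => x _ Fx.
by apply: le_trans Fx _; exact: ltW.
Qed.

Lemma ess_sup_on_subset D E F : D `<=` E -> ess_sup_on D F <= ess_sup_on E F.
Proof. by move=> DE; apply: ereal_inf_le_tmp => y; exact: ae_on_subset. Qed.

(** On a null set the essential supremum is -oo, hence the assumption of positive measure. *)
Lemma ess_sup_on_ge (x : \bar R) D F : leb_measurable D ->
  0 < leb (D : set (lebR R)) -> (forall s, D s -> x <= F s) -> x <= ess_sup_on D F.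
Proof.
move=> mD D0 Fx; apply: le_ereal_inf_tmp => y Fy; rewrite leNgt; apply/negP => yx.
have : ae_on D (fun=> False).
  apply: ae_onS Fy => s Ds Fsy.
  by have := le_trans (Fx _ Ds) Fsy; rewrite leNgt yx.
by move/(ae_on_absurd mD) => DE; move: D0; rewrite DE ltxx.
Qed.

Lemma ess_sup_tail_ni F s t : (s <= t)%R ->
  ess_sup_on (ico t L) F <= ess_sup_on (ico s L) F.
Proof.
by move=> st; apply: ess_sup_on_subset => x [tx xL]; split=> //; exact: le_trans tx.
Qed.

Lemma ae_neq (c : R) : \forall x \ae (@leb R), x <> c.
Proof.
exists [set c]; split.
- by apply: borel_measurable_leb; exact: measurable_set1.
- exact: leb_set1.
- by move=> x /= /contrapT.
Qed.

(* Apart from the null sets where F exceeds its essential supremum on a tail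
   with rational endpoint, exceptional points can only be thresholds at which
   the tail supremum drops below a rational, and these are countably many. *)
Lemma ae_le_ess_sup_tail F : (forall t, ioo 0 L t -> 0 <= F t) ->
  ae_on (ioo 0 L) (fun t => F t <= ess_sup_on (ico t L) F).
Proof.
move=> F0; pose S t := ess_sup_on (ico t L) F.
pose c (q : rat) : R := inf [set t | ioo 0 L t /\ S t < (ratr q)%:E].
have Sni s t : (s <= t)%R -> S t <= S s by exact: ess_sup_tail_ni.
have ae_c : \forall x \ae (@leb R), forall n q, unpickle n = Some q -> x <> c q.
  apply: (@ae_foralln _ (lebR R) R (@leb R)) => n.
  case E : (unpickle n) => [q|]; last by apply: aeW.
  by apply: ae_leb_imp (ae_neq (c q)) => x xc _ [<-].
have ae_r : \forall x \ae (@leb R), forall n (z : rat * rat), unpickle n = Some z ->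
    ioo 0 L (ratr z.2) -> S (ratr z.2) < (ratr z.1)%:E ->
    ico (ratr z.2) L x -> F x <= (ratr z.1)%:E.
  apply: (@ae_foralln _ (lebR R) R (@leb R)) => n.
  case E : (unpickle n) => [z|]; last by apply: aeW.
  have [h|h] := pselect (ioo 0 L (ratr z.2 : R) /\ S (ratr z.2) < (ratr z.1)%:E).
    apply: ae_leb_imp (ess_sup_on_lt h.2) => x hx _ [<-] _ _; exact: hx.
  by apply: aeW => x _ [<-] ? ?; exfalso; apply: h.
apply: ae_leb_imp2 ae_c ae_r => x xc xr Ix.
rewrite leNgt; apply/negP => SF.
have [q [Sq qF]] : exists q : rat, S x < (ratr q)%:E /\ (ratr q)%:E < F x.
  have S0 : 0 <= S x.
    apply: ess_sup_on_ge; [exact: measurable_ico|exact: leb_ico_gt0|].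
    by move=> s sI; apply: F0; exact: (subset_ico_ioo Ix sI).
  move: SF S0; rewrite -/(S x); case: (S x) => [a||//]; last by rewrite ltNge leey.
  move=> aF _.
  have [b [ab bF]] : exists b : R, (a < b)%R /\ b%:E <= F x.
    move: aF; case: (F x) => [b||//]; first by rewrite lte_fin => ab; exists b.
    by move=> _; exists (a + 1)%R; rewrite ltrDl leey.
  have [q] := rat_in_itvoo ab; rewrite in_itv/= => /andP[aq qb].
  by exists q; rewrite lte_fin aq; split=> //; apply: lt_le_trans bF; rewrite lte_fin.
have xcq : x <> c q by apply: (xc (pickle q)); exact: pickleK.
pose J := [set t | ioo 0 L t /\ S t < (ratr q)%:E].
have Jx : J x by [].
have J_inf : has_inf J.
  by split; [exists x|exists 0%R => t [[/ltW]]].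
(* Since x is not the threshold [c q], it lies strictly above it, and some rational r below x still
   has [S r < q]. As x is not exceptional for the tail from r, this gives F(x) <= q, a
   contradiction. *)
have cx : (c q < x)%R.
  rewrite lt_neqAle; apply/andP; split; first by apply/eqP => /esym.
  by apply: ge_inf => //; case: J_inf.
have xc0 : (0 < x - c q)%R by rewrite subr_gt0.
have [t [It St] tx] := inf_adherent xc0 J_inf.
rewrite -/(c q) addrC subrK in tx.
have [r] := rat_in_itvoo tx; rewrite in_itv/= => /andP[tr rx].
have [t0 _] := It; have [_ xL] := Ix.
have := xr (pickle (q, r)) (q, r) (pickleK _).
rewrite leNgt /= => h; have /negP : ~~ ((ratr q)%:E < F x); last by apply.
apply: h.
- by split; [exact: lt_trans tr|apply: lt_trans xL; rewrite lte_fin].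
- by apply: le_lt_trans St; apply: Sni; exact: ltW.
- by split=> //; exact: ltW.
Qed.

End EssSup.

(** * The associate norm and the Hoelder inequality *)

Section NormFacts.
Context {R : realType}.
Variables (L : \bar R) (N : (R -> \bar R) -> \bar R).
Hypothesis L0 : 0 < L.
Hypothesis hN : ri_norm L N.
Implicit Types (f g : R -> \bar R).

Let mI : leb_measurable (ioo 0 L). Proof. exact: measurable_ioo. Qed.

Lemma ri_norm_ae f g : Mplus L f -> Mplus L g ->
  ae_on (ioo 0 L) (fun x => f x = g x) -> N f = N g.
Proof.
move=> pf pg fg; apply/eqP; rewrite eq_le; apply/andP; split.
  by apply: (ri_monotone hN pf pg); apply: ae_onS fg => x _ ->.
by apply: (ri_monotone hN pg pf); apply: ae_onS fg => x _ ->.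
Qed.

Lemma eq_M f g : (forall x, ioo 0 L x -> f x = g x) -> M L f -> M L g.
Proof. by move=> fg; apply: eq_measurable_fun => x; rewrite inE => Ix; exact: fg. Qed.

Lemma le_associate f g : Mplus L f -> Mplus L g ->
  ae_on (ioo 0 L) (fun x => f x <= g x) -> associate L N f <= associate L N g.
Proof.
move=> [mf f0] [mg g0] fg; apply: ge_ereal_sup => _ [h [ph Nh] <-].
have [mh h0] := ph.
apply: le_ereal_sup_tmp.
exists (\int[leb]_(x in ioo 0 L) (g x * h x)); first by exists h.
rewrite (@leb_ae_eq_integral _ _ _ (fun x => `|f x| * `|h x|))//; last 3 first.
- exact: leb_measurable_funM.
- by apply: leb_measurable_funM; exact: leb_measurable_abs.
- by apply: ae_onS2 f0 h0 => x _ ? ?; rewrite !gee0_abs.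
(* f <= g holds only a.e.; the maximum of |f| and |g| agrees with g a.e. and dominates |f|
   everywhere. *)
rewrite [leRHS](@leb_ae_eq_integral _ _ _ (fun x => maxe `|f x| `|g x| * `|h x|))//; last 3 first.
- exact: leb_measurable_funM.
- apply: leb_measurable_funM; last exact: leb_measurable_abs.
  by apply: measurable_maxe; exact: leb_measurable_abs.
- apply: ae_onS2 (ae_on_and f0 g0) (ae_on_and h0 fg) => x _ [fx gx] [hx fgx].
  by rewrite !gee0_abs// max_r.
apply: leb_le_integral => //.
- by apply: leb_measurable_funM; exact: leb_measurable_abs.
- apply: leb_measurable_funM; last exact: leb_measurable_abs.
  by apply: measurable_maxe; exact: leb_measurable_abs.
- by move=> x _; apply: lee_wpmul2r => //; rewrite le_max lexx.
Qed.

Lemma associate_ae f g : Mplus L f -> Mplus L g ->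
  ae_on (ioo 0 L) (fun x => f x = g x) -> associate L N f = associate L N g.
Proof.
move=> pf pg fg; apply/eqP; rewrite eq_le; apply/andP; split.
  by apply: le_associate => //; apply: ae_onS fg => x _ ->.
by apply: le_associate => //; apply: ae_onS fg => x _ ->.
Qed.

(** With C > 0 the right side is infinite when [N f] is. If [N f] is 0, definiteness makes f vanish
    a.e.; otherwise f is normalized and tested in the supremum defining the associate norm. *)
Lemma associate_holder f g (C : R) : Mplus L f -> Mplus L g -> (0 < C)%R ->
  associate L N g <= C%:E -> \int[leb]_(x in ioo 0 L) (f x * g x) <= C%:E * N f.
Proof.
move=> pf pg C0 gC; have [mf f0] := pf; have [mg g0] := pg.
have Nf0 := ri_ge0 hN pf.
have [Nfoo|Nf_fin] := eqVneq (N f) +oo.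
  by rewrite Nfoo gt0_muley ?lte_fin// leey.
have {}Nf_fin : N f \is a fin_num by rewrite ge0_fin_numE// lt_neqAle Nf_fin leey.
have [Nf_eq0|Nf_neq0] := eqVneq (N f) 0.
  have fz := (ri_eq0 hN pf).1 Nf_eq0.
  rewrite (@leb_ae_eq_integral _ _ _ (fun=> 0))//; last 3 first.
  - exact: leb_measurable_funM.
  - exact: leb_measurable_cst.
  - by apply: ae_onS fz => x _ ->; rewrite mul0e.
  by rewrite integral0 Nf_eq0 mule0.
pose a := fine (N f).
have a0 : (0 < a)%R by rewrite fine_gt0// lt_neqAle eq_sym Nf_neq0 Nf0 -ge0_fin_numE.
have aE : N f = a%:E by rewrite fineK.
have pf' : Mplus L (fun x => (a^-1)%:E * f x).
  split; first exact: M_scale.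
  by apply: ae_onS f0 => x _ ?; rewrite mule_ge0// lee_fin invr_ge0 ltW.
have Nf' : N (fun x => (a^-1)%:E * f x) <= 1.
  rewrite (ri_homogeneous hN _ pf) ?invr_ge0 ?(ltW a0)//.
  by rewrite aE -EFinM mulVf// gt_eqF.
have le1 : \int[leb]_(x in ioo 0 L) (g x * ((a^-1)%:E * f x)) <= C%:E.
  by apply: le_trans gC; apply: ereal_sup_ubound; exists (fun x => (a^-1)%:E * f x).
have intE : \int[leb]_(x in ioo 0 L) (g x * ((a^-1)%:E * f x)) =
    (a^-1)%:E * \int[leb]_(x in ioo 0 L) (`|f x| * `|g x|).
  rewrite -leb_integralZl//.
  - apply: leb_ae_eq_integral => //.
    + by apply: leb_measurable_funM => //; case: pf'.
    + apply: leb_measurable_funM; first exact: leb_measurable_cst.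
      by apply: leb_measurable_funM; exact: leb_measurable_abs.
    + by apply: ae_onS2 f0 g0 => x _ ? ?; rewrite !gee0_abs// muleCA [g x * _]muleC.
  - by apply: leb_measurable_funM; exact: leb_measurable_abs.
  - by rewrite lee_fin invr_ge0 ltW.
rewrite intE lee_pdivrMl// in le1.
rewrite aE muleC; apply: le_trans le1.
apply: le_of_eq; apply: leb_ae_eq_integral => //.
- exact: leb_measurable_funM.
- by apply: leb_measurable_funM; exact: leb_measurable_abs.
- by apply: ae_onS2 f0 g0 => x _ ? ?; rewrite !gee0_abs.
Qed.

(* (P5) of N says that small multiples of indicators lie in the unit ball of
   the associate norm. *)
Lemma associate_indic_le1 (E : set R) : leb_measurable E -> E `<=` ioo 0 L ->
  leb (E : set (lebR R)) < +oo ->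
  exists c : R, (0 < c)%R /\ associate L N (fun x => (c * \1_E x)%:E) <= 1.
Proof.
move=> mE EI Efin; have [C [C0 hC]] := ri_local_integral hN mE EI Efin.
exists C^-1%R; split; first by rewrite invr_gt0.
apply: ge_ereal_sup => _ [h [ph Nh] <-]; have [mh h0] := ph.
have mEh : leb_measurable_fun E h by exact: (leb_measurable_funS mI EI).
have -> : \int[leb]_(x in ioo 0 L) ((C^-1 * \1_E x)%:E * h x) =
    \int[leb]_(x in ioo 0 L) ((C^-1)%:E * (`|h x| * (\1_E x)%:E)).
  have mind : leb_measurable_fun (ioo 0 L) (fun x => (\1_E x)%:E).
    by apply/measurable_EFinP; apply: measurable_indic; exact: mE.
  apply: leb_ae_eq_integral => //.
  - apply: leb_measurable_funM => //; apply/measurable_EFinP.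
    by apply: measurable_funM; [exact: measurable_cst|exact: measurable_indic].
  - apply: leb_measurable_funM; first exact: leb_measurable_cst.
    by apply: leb_measurable_funM => //; exact: leb_measurable_abs.
  - by apply: ae_onS h0 => x _ ?; rewrite gee0_abs// EFinM [h x * _]muleC muleA.
have mh1 : leb_measurable_fun (ioo 0 L) (fun x => `|h x| * (\1_E x)%:E).
  apply: leb_measurable_funM; first exact: leb_measurable_abs.
  by apply/measurable_EFinP; apply: measurable_indic; exact: mE.
have h10 x : ioo 0 L x -> 0 <= `|h x| * (\1_E x)%:E.
  by move=> _; rewrite mule_ge0// lee_fin.
have Cinv0 : 0 <= (C^-1)%:E by rewrite lee_fin invr_ge0 ltW.
rewrite (leb_integralZl mI mh1 h10 Cinv0).
rewrite lee_pdivrMl// mule1.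
have -> : \int[leb]_(x in ioo 0 L) (`|h x| * (\1_E x)%:E) = \int[leb]_(x in E) h x.
  transitivity (\int[leb]_(x in E) `|h x|).
    rewrite [RHS]integral_mkcond [LHS]integral_mkcond; apply: eq_integral => x _.
    rewrite !patchE indicE; case: ifPn => [|xI]; first by case: ifP; rewrite ?mule1 ?mule0.
    by rewrite ifF//; apply/negbTE; apply: contra xI; rewrite !inE; exact: EI.
  apply: leb_ae_eq_integral => //; first exact: leb_measurable_abs.
  by apply: ae_on_subset EI _; exact: Mplus_eq_abs.
apply: le_trans (hC _ ph) _.
by rewrite -[leRHS]mule1 lee_pmul2l// lte_fin.
Qed.

End NormFacts.

(** * Indicators and integrals of rearrangements *)

Section Indicator.
Context {R : realType}.
Variable L : \bar R.
Hypothesis hL : 0 < L.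

Let mI : leb_measurable (ioo 0 L). Proof. exact: measurable_ioo. Qed.

Lemma indic_M (E : set R) (c : R) : leb_measurable E -> M L (fun x => (c * \1_E x)%:E).
Proof.
move=> mE; apply/measurable_EFinP.
by apply: measurable_funM; [exact: measurable_cst|exact: measurable_indic].
Qed.

Lemma indic_Mplus (E : set R) (c : R) : leb_measurable E -> (0 <= c)%R ->
  Mplus L (fun x => (c * \1_E x)%:E).
Proof.
move=> mE c0; apply: Mplus_ge0; first exact: indic_M.
by move=> x _; rewrite lee_fin mulr_ge0.
Qed.

Lemma indic1_Mplus (E : set R) : leb_measurable E -> Mplus L (fun x => (\1_E x)%:E).
Proof.
move=> mE; have := indic_Mplus mE ler01; congr Mplus; apply/funext => x.
by rewrite mul1r.
Qed.

Lemma rearr_indic_ge (c b t : R) : (0 < c)%R -> b%:E <= L -> (0 <= t)%R -> (t < b)%R ->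
  c%:E <= rearr L (fun x => (c * \1_(ioo 0 b%:E) x)%:E) t.
Proof.
move=> c0 bL t0 tb; apply: le_ereal_gt; first exact: rearr_ge0.
move=> r r0; rewrite lte_fin => rc.
have mb : leb_measurable (ioo 0 b%:E) by exact: measurable_ioo.
rewrite rearr_gt//; last exact: indic_M.
apply: (@lt_le_trans _ _ b%:E); first by rewrite lte_fin.
have b0 : 0 <= b%:E by rewrite lee_fin ltW// (le_lt_trans t0 tb).
rewrite -[leLHS](leb_ioo0 b0); apply: le_leb; first exact: mb.
  by apply: measurable_level; exact: indic_M.
move=> x xb; split; first by case: xb => x0 xb; split=> //; exact: lt_le_trans bL.
by rewrite indicE mem_set// mulr1 abse_EFin lte_fin gtr0_norm.
Qed.

Lemma rearr_indic_le (E : set R) t : leb_measurable E -> (0 <= t)%R ->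
  rearr L (fun x => (\1_E x)%:E) t <=
  if t%:E < leb (E : set (lebR R)) then 1 else 0.
Proof.
move=> mE t0.
have mi : M L (fun x => (\1_E x)%:E).
  by apply/measurable_EFinP; apply: measurable_indic.
apply: le_ereal_gt; first by case: ifP.
move=> r r0; rewrite rearr_gt// => tr.
have dE : distr L (fun x => (\1_E x)%:E) r <= leb (E : set (lebR R)).
  apply: le_leb => //; first exact: measurable_level.
  move=> x [Ix]; rewrite abse_EFin lte_fin indicE; case: (boolP (x \in E)).
    by rewrite inE.
  by rewrite normr0 ltNge r0.
rewrite ifT; last exact: lt_le_trans dE.
rewrite lte_fin ltNge; apply/negP => r1.
move: tr; rewrite /distr (_ : mkset _ = set0).
  by rewrite measure0 lte_fin ltNge t0.
apply/seteqP; split=> // x [_]; rewrite abse_EFin lte_fin indicE.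
by case: (_ \in _); rewrite ?normr1 ?normr0 ltNge ?r1 ?r0.
Qed.

Lemma integral_ioo_trunc (b : R) (k : R -> \bar R) (a : R) (B : \bar R) : b%:E <= B ->
  \int[leb]_(x in ioo a b%:E) k x =
  \int[leb]_(x in ioo a B) ((if (x < b)%R then 1 else 0) * k x).
Proof.
move=> bB; rewrite [LHS]integral_mkcond [RHS]integral_mkcond.
apply: eq_integral => x _; rewrite !patchE.
case: ifPn => [|xb].
  rewrite inE => -[ax xb]; rewrite mem_set; last by split=> //; exact: lt_le_trans bB.
  by rewrite -lte_fin xb mul1e.
case: ifPn => //; rewrite inE => -[ax xB].
rewrite ifF ?mul0e//; apply/negbTE; apply: contra xb => xb.
by rewrite inE; split=> //; rewrite lte_fin.
Qed.

(** Hardy-Littlewood against the indicator of E, whose rearrangement is at most the indicator of (0,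
    |E|). *)
Lemma integral_le_rearr (E : set R) f : leb_measurable E -> E `<=` ioo 0 L ->
  leb (E : set (lebR R)) < +oo -> Mplus L f ->
  \int[leb]_(x in E) f x <=
  \int[leb]_(x in ioo 0 (fine (leb (E : set (lebR R))))%:E) rearr L f x.
Proof.
move=> mE EI Efin pf; have [mf f0] := pf; have L0 := ltW hL.
set m := leb (E : set (lebR R)).
have m_fin : m \is a fin_num by rewrite ge0_fin_numE// measure_ge0.
have mL : (fine m)%:E <= L.
  rewrite fineK// -(leb_ioo0 L0); apply: le_leb => //; exact: mI.
have mi : M L (fun x => (\1_E x)%:E).
  by apply/measurable_EFinP; apply: measurable_indic.
rewrite (integral_ioo_trunc _ _ mL).
apply: (@le_trans _ _ (\int[leb]_(x in ioo 0 L) (`|f x| * `|(\1_E x)%:E|))).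
  apply: le_of_eq.
  transitivity (\int[leb]_(x in E) `|f x|).
    apply: leb_ae_eq_integral => //.
    - exact: (leb_measurable_funS mI EI mf).
    - by apply: leb_measurable_abs; exact: (leb_measurable_funS mI EI mf).
    - by apply: (ae_on_subset EI); apply: ae_onS (Mplus_eq_abs pf) => x _ ->.
  rewrite [LHS]integral_mkcond [RHS]integral_mkcond; apply: eq_integral => x _.
  rewrite !patchE indicE abse_EFin; case: ifPn => [xE|xE].
    by rewrite mem_set ?normr1 ?mule1//; move: xE; rewrite inE; exact: EI.
  by case: ifP => // _; rewrite normr0 mule0.
apply: (le_trans (hardy_littlewood L0 mf mi)).
have mtr : leb_measurable_fun (ioo 0 L) (fun x => if (x < fine m)%R then 1 else 0 : \bar R).
  apply: monotone_emeasurable; first exact: ioo_interval.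
  left => x y _ _ xy; case: ifPn => // yx; last by case: ifP.
  by rewrite (le_lt_trans xy yx).
rewrite /=; apply: leb_le_integral.
- exact: mI.
- by apply: leb_measurable_funM; exact: rearr_M.
- by apply: leb_measurable_funM; [exact: mtr|exact: rearr_M].
- by move=> x _; rewrite mule_ge0 ?rearr_ge0.
- move=> x [x0 xL]; rewrite muleC; apply: lee_wpmul2r; first exact: rearr_ge0.
  have := rearr_indic_le mE (ltW x0); rewrite -/m -{1}(fineK m_fin) lte_fin.
  by [].
Qed.

(** As f^* is nonincreasing, the second half of the interval carries at most as much as the first.
    In the proof of (P5) the measure m may equal L, whereas m/2 is interior to (0, L), where a
    weight can be evaluated. *)
Lemma integral_rearr_double f (m : R) : M L f -> (0 < m)%R -> m%:E <= L ->
  \int[leb]_(x in ioo 0 m%:E) rearr L f x <=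
  2%:E * \int[leb]_(x in ioo 0 (m / 2)%:E) rearr L f x.
Proof.
move=> mf m0 mL.
have m20 : (0 < m / 2)%R by rewrite divr_gt0.
have m2m : (m / 2 < m)%R by rewrite ltr_pdivrMr// ltr_pMr// ltr1n.
have mr (a : R) B : leb_measurable_fun (ioo a B) (rearr L f).
  by apply: monotone_emeasurable; [exact: ioo_interval|left => x y _ _; exact: rearr_noninc].
have mrc (a : R) B : leb_measurable_fun (ico a B) (rearr L f).
  apply: monotone_emeasurable; last by left => x y _ _; exact: rearr_noninc.
  move=> x y [ax xB] [ay yB] z /andP[xz zy]; split; first exact: le_trans xz.
  by apply: le_lt_trans yB; rewrite lee_fin.
pose J : set R := ico (m / 2)%R m%:E.
have mJ : leb_measurable J by exact: measurable_ico.
have mI2 : leb_measurable (ioo 0 (m / 2)%:E) by exact: measurable_ioo.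
rewrite (leb_integral_ioo_split m20 (ltW m2m)); last 2 first.
- exact: mr.
- by move=> x _; exact: rearr_ge0.
have -> : 2%:E = 1 + 1 :> \bar R by [].
rewrite ge0_muleDl// mul1e leeD2l//.
pose k := rearr L f (m / 2)%R.
have lJ : leb (J : set (lebR R)) = (m / 2)%:E.
  by rewrite leb_ico_fin ?ltW//; congr (_%:E); field.
apply: (@le_trans _ _ (k * (m / 2)%:E)).
  rewrite -lJ -(leb_integral_cst k mJ); apply: leb_le_integral.
  - exact: mJ.
  - exact: mrc.
  - exact: leb_measurable_cst.
  - by move=> x _; exact: rearr_ge0.
  - by move=> x [xx _]; exact: rearr_noninc.
have lI : leb (ioo 0 (m / 2)%:E : set (lebR R)) = (m / 2)%:E by rewrite leb_ioo_fin ?subr0 ?ltW.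
rewrite -[in leLHS]lI -(leb_integral_cst k mI2); apply: leb_le_integral.
- exact: mI2.
- exact: leb_measurable_cst.
- exact: mr.
- by move=> x _; exact: rearr_ge0.
- by move=> x [_ xx]; apply: rearr_noninc; rewrite ltW// -lte_fin.
Qed.

End Indicator.

(** * The Hardy operator, its adjoint and the operator T *)

Section Hardy.
Context {R : realType}.
Variables (L : \bar R) (nu u xi v : R -> R).
Hypothesis hnu : increasing_bij L nu.
Hypothesis u_gt0 : forall t, ioo 0 L t -> (0 < u t)%R.
Hypothesis u_noninc : {in ioo 0 L &, nonincreasing_fun u}.
Hypothesis xi_gt0 : forall t, ioo 0 L t -> (0 < xi t)%R.
Hypothesis xi_meas : measurable_fun (ioo 0 L : set (lebR R)) xi.
Hypothesis v_gt0 : forall t, ioo 0 L t -> (0 < v t)%R.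
Hypothesis v_def : forall t, ioo 0 L t ->
     ((v t)^-1)%:E = \int[leb]_(s in ioo 0 (nuinv L nu t)%:E) (xi s)%:E.
Implicit Types (f g h : R -> \bar R).

Let mI : leb_measurable (ioo 0 L). Proof. exact: measurable_ioo. Qed.

Definition hardy h t : \bar R :=
  (u t)%:E * \int[leb]_(s in ioo (nu t) L) (h s * (v s)%:E).

Definition hardy_dual g s : \bar R :=
  (v s)%:E * \int[leb]_(t in ioo 0 (nuinv L nu s)%:E) (g t * (u t)%:E).

Lemma u_ni s t : ioo 0 L s -> ioo 0 L t -> (s <= t)%R -> (u t <= u s)%R.
Proof. by move=> Is It; apply: u_noninc; rewrite inE. Qed.

Lemma u_measurable : leb_measurable_fun (ioo 0 L) (EFin \o u).
Proof.
apply: monotone_emeasurable; first exact: ioo_interval.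
by left => x y Ix Iy xy; rewrite lee_fin; exact: u_ni.
Qed.

Lemma xi_measurable : leb_measurable_fun (ioo 0 L) (EFin \o xi).
Proof. exact/measurable_EFinP. Qed.

Lemma v_ni s t : ioo 0 L s -> ioo 0 L t -> (s <= t)%R -> (v t <= v s)%R.
Proof.
move=> Is It st; rewrite -lef_pV2 ?posrE ?v_gt0// -lee_fin !v_def//.
have sI := sub_ioo_nuinv hnu It.
apply: leb_subset_integral; try exact: measurable_ioo.
- exact: (leb_measurable_funS mI sI xi_measurable).
- by move=> x /sI Ix; rewrite lee_fin ltW// xi_gt0.
- by apply: subset_ioo => //; rewrite lee_fin; exact: le_nuinv.
Qed.

Lemma v_measurable : leb_measurable_fun (ioo 0 L) (EFin \o v).
Proof.
apply: monotone_emeasurable; first exact: ioo_interval.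
by left => x y Ix Iy xy; rewrite lee_fin; exact: v_ni.
Qed.

Section HardyOperator.
Variable h : R -> \bar R.
Hypothesis mh : M L h.
Hypothesis h0 : forall x, ioo 0 L x -> 0 <= h x.

Lemma hv_measurable : leb_measurable_fun (ioo 0 L) (fun s => h s * (v s)%:E).
Proof. by apply: leb_measurable_funM; [exact: mh|exact: v_measurable]. Qed.

Lemma hv_ge0 x : ioo 0 L x -> 0 <= h x * (v x)%:E.
Proof. by move=> Ix; rewrite mule_ge0 ?h0// lee_fin ltW// v_gt0. Qed.

Lemma tail_ge0 t : ioo 0 L t -> 0 <= \int[leb]_(s in ioo (nu t) L) (h s * (v s)%:E).
Proof. by move=> It; apply: leb_integral_ge0 => x /(sub_ioo_nu hnu It); exact: hv_ge0. Qed.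

Lemma hardy_ge0 t : ioo 0 L t -> 0 <= hardy h t.
Proof. by move=> It; rewrite mule_ge0 ?tail_ge0// lee_fin ltW// u_gt0. Qed.

Lemma tail_ni s t : ioo 0 L s -> ioo 0 L t -> (s <= t)%R ->
  \int[leb]_(x in ioo (nu t) L) (h x * (v x)%:E) <=
  \int[leb]_(x in ioo (nu s) L) (h x * (v x)%:E).
Proof.
move=> Is It st; apply: leb_subset_integral; try exact: measurable_ioo.
- exact: (leb_measurable_funS mI (sub_ioo_nu hnu Is) hv_measurable).
- by move=> x /(sub_ioo_nu hnu Is); exact: hv_ge0.
- by apply: subset_ioo => //; exact: (le_nu hnu).
Qed.

Lemma hardy_ni s t : ioo 0 L s -> ioo 0 L t -> (s <= t)%R -> hardy h t <= hardy h s.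
Proof.
move=> Is It st; apply: lee_pmul; [|exact: tail_ge0| |exact: tail_ni].
  by rewrite lee_fin ltW// u_gt0.
by rewrite lee_fin; exact: u_ni.
Qed.

Lemma hardy_M : M L (hardy h).
Proof.
apply: monotone_emeasurable; first exact: ioo_interval.
by left; exact: hardy_ni.
Qed.

Lemma hardy_Mplus : Mplus L (hardy h).
Proof. by apply: Mplus_ge0; [exact: hardy_M|exact: hardy_ge0]. Qed.

End HardyOperator.

Section HardyDual.
Variable g : R -> \bar R.
Hypothesis mg : M L g.
Hypothesis g0 : forall x, ioo 0 L x -> 0 <= g x.

Lemma gu_measurable : leb_measurable_fun (ioo 0 L) (fun s => g s * (u s)%:E).
Proof. by apply: leb_measurable_funM; [exact: mg|exact: u_measurable]. Qed.

Lemma gu_ge0 x : ioo 0 L x -> 0 <= g x * (u x)%:E.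
Proof. by move=> Ix; rewrite mule_ge0 ?g0// lee_fin ltW// u_gt0. Qed.

Lemma hardy_dual_ge0 s : ioo 0 L s -> 0 <= hardy_dual g s.
Proof.
move=> Is; rewrite mule_ge0//; first by rewrite lee_fin ltW// v_gt0.
by apply: leb_integral_ge0 => x /(sub_ioo_nuinv hnu Is); exact: gu_ge0.
Qed.

Lemma hardy_dual_M : M L (hardy_dual g).
Proof.
apply: leb_measurable_funM; first exact: v_measurable.
apply: monotone_emeasurable; first exact: ioo_interval.
right => s t Is It st; apply: leb_subset_integral; try exact: measurable_ioo.
- exact: (leb_measurable_funS mI (sub_ioo_nuinv hnu It) gu_measurable).
- by move=> x /(sub_ioo_nuinv hnu It); exact: gu_ge0.
- by apply: subset_ioo => //; rewrite lee_fin; exact: (le_nuinv hnu).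
Qed.

End HardyDual.

Lemma hardy_duality h g : M L h -> (forall x, ioo 0 L x -> 0 <= h x) ->
  M L g -> (forall x, ioo 0 L x -> 0 <= g x) ->
  \int[leb]_(t in ioo 0 L) (hardy h t * g t) =
  \int[leb]_(s in ioo 0 L) (h s * hardy_dual g s).
Proof.
move=> mh h0 mg g0.
have := fubini_nu hnu (gu_measurable mg) (hv_measurable mh) (gu_ge0 g0) (hv_ge0 h0).
move=> fub; rewrite (_ : \int[leb]_(t in ioo 0 L) (hardy h t * g t) =
  \int[leb]_(t in ioo 0 L) (g t * (u t)%:E *
     \int[leb]_(s in ioo (nu t) L) (h s * (v s)%:E))).
  by rewrite fub; apply: leb_eq_integral => s _; rewrite muleA.
by apply: leb_eq_integral => t _; rewrite /hardy [LHS]muleC muleA.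
Qed.

Notation phi := (fun t => (u t / xi t)%R).
Notation T := (Top L phi).

Let phi_gt0 t : ioo 0 L t -> (0 < phi t)%R.
Proof. by move=> It; rewrite divr_gt0 ?u_gt0 ?xi_gt0. Qed.

Section TOperator.
Variable g : R -> \bar R.
Hypothesis mg : M L g.

Definition tail_sup t : \bar R :=
  ess_sup_on (ico t L) (fun s => (u s / xi s)%:E * rearr L g s).

Let phi_rearr_ge0 t : ioo 0 L t -> 0 <= (phi t)%:E * rearr L g t.
Proof. by move=> It; rewrite mule_ge0 ?rearr_ge0// lee_fin ltW// phi_gt0. Qed.

Lemma tail_sup_ge0 t : ioo 0 L t -> 0 <= tail_sup t.
Proof.
move=> It; apply: ess_sup_on_ge; [exact: measurable_ico|exact: leb_ico_gt0|].
by move=> s /(subset_ico_ioo It); exact: phi_rearr_ge0.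
Qed.

Lemma tail_sup_measurable : leb_measurable_fun (ioo 0 L) tail_sup.
Proof.
apply: monotone_emeasurable; first exact: ioo_interval.
by left => x y _ _; exact: ess_sup_tail_ni.
Qed.

Lemma TopE t : T g t = ((phi t)^-1)%:E * tail_sup t.
Proof. by []. Qed.

Lemma Top_ge0 t : ioo 0 L t -> 0 <= T g t.
Proof.
move=> It; rewrite TopE mule_ge0 ?tail_sup_ge0// lee_fin invr_ge0 ltW//.
exact: phi_gt0.
Qed.

(** The factor u cancels against 1/phi = xi/u. What remains is the density xi, whose integral over
    (0, nu^-1 t) is 1/v(t). *)
Lemma Top_mul_u t : ioo 0 L t -> T g t * (u t)%:E = (xi t)%:E * tail_sup t.
Proof.
move=> It; rewrite TopE muleAC -EFinM invf_div.
by rewrite divfK// gt_eqF// u_gt0.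
Qed.

Lemma Top_M : M L (T g).
Proof.
apply: leb_measurable_funM; last exact: tail_sup_measurable.
have mr : measurable_fun (ioo 0 L : set (lebR R)) (fun t : lebR R => (xi t * (u t)^-1)%R).
  apply: measurable_funM; first exact: xi_meas.
  apply: monotone_measurable; first exact: ioo_interval.
  right => x y Ix Iy xy; rewrite lef_pV2 ?posrE ?u_gt0//; exact: u_ni.
apply: (@eq_measurable_fun _ _ _ _ (ioo 0 L : set (lebR R))
  (fun t : lebR R => (xi t * (u t)^-1)%:E)) => [t _|].
  by rewrite invf_div.
exact/measurable_EFinP.
Qed.

Lemma Top_Mplus : Mplus L (T g).
Proof. by apply: Mplus_ge0; [exact: Top_M|exact: Top_ge0]. Qed.

Lemma rearr_le_Top : ae_on (ioo 0 L) (fun t => rearr L g t <= T g t).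
Proof.
apply: ae_onS (ae_le_ess_sup_tail phi_rearr_ge0) => t It h.
by rewrite TopE lee_pdivlMl// phi_gt0.
Qed.

Lemma hardy_dual_TopE t : ioo 0 L t -> hardy_dual (T g) t =
  (v t)%:E * \int[leb]_(s in ioo 0 (nuinv L nu t)%:E) ((xi s)%:E * tail_sup s).
Proof.
move=> It; congr (_ * _); apply: leb_eq_integral => s sI; apply: Top_mul_u.
exact: (sub_ioo_nuinv hnu It).
Qed.

(* By the definition of v this is the average of the nonincreasing function
   tail_sup over (0, nu^-1 t) with respect to xi. *)
Lemma hardy_dual_Top_ni s t : ioo 0 L s -> ioo 0 L t -> (s <= t)%R ->
  hardy_dual (T g) t <= hardy_dual (T g) s.
Proof.
move=> Is It st; rewrite !hardy_dual_TopE//.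
set x1 := nuinv L nu s; set x2 := nuinv L nu t.
have x12 : (x1 <= x2)%R by exact: le_nuinv.
have I1 : ioo 0 L x1 by exact: nuinv_ioo.
have I2 : ioo 0 L x2 by exact: nuinv_ioo.
have [x10 x1L] := I1; have [x20 x2L] := I2.
pose J : set R := ico x1 x2%:E.
have mJ : leb_measurable J by exact: measurable_ico.
have m1 : leb_measurable (ioo 0 x1%:E) by exact: measurable_ioo.
have s1 : ioo 0 x1%:E `<=` ioo 0 L by apply: subset_ioo => //; exact: ltW.
have sJ : J `<=` ioo 0 L.
  by move=> x [xx xx2]; split; [exact: lt_le_trans xx|exact: lt_trans x2L].
have split_ (k : R -> \bar R) : leb_measurable_fun (ioo 0 L) k ->
    (forall x, ioo 0 L x -> 0 <= k x) ->
    \int[leb]_(x in ioo 0 x2%:E) k x =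
    \int[leb]_(x in ioo 0 x1%:E) k x + \int[leb]_(x in J) k x.
  move=> mk k0; have s2 : ioo 0 x2%:E `<=` ioo 0 L by apply: subset_ioo => //; exact: ltW.
  apply: leb_integral_ioo_split => //; first exact: (leb_measurable_funS mI s2 mk).
  by move=> x /s2; exact: k0.
have xi0 x : ioo 0 L x -> 0 <= (xi x)%:E by move=> Ix; rewrite lee_fin ltW// xi_gt0.
have mxi := xi_measurable.
have mxiS : leb_measurable_fun (ioo 0 L) (fun x => (xi x)%:E * tail_sup x).
  by apply: leb_measurable_funM => //; exact: tail_sup_measurable.
have xiS0 x : ioo 0 L x -> 0 <= (xi x)%:E * tail_sup x.
  by move=> Ix; rewrite mule_ge0 ?xi0 ?tail_sup_ge0.
have vs := v_def Is; have vt := v_def It.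
rewrite -/x1 in vs; rewrite -/x2 split_// -vs in vt.
have vs0 := v_gt0 Is; have vt0 := v_gt0 It.
have JE : \int[leb]_(x in J) (xi x)%:E = ((v t)^-1 - (v s)^-1)%:E.
  by rewrite EFinB vt [X in X - _]addeC addeK.
set A := \int[leb]_(x in ioo 0 x1%:E) ((xi x)%:E * tail_sup x).
(* [tail_sup] is at least [tail_sup x1] on (0, x1) and at most that on [J]; the masses of xi on
   these sets are 1/v(s) and 1/v(t) - 1/v(s). *)
have A_ge : (v s)^-1%:E * tail_sup x1 <= A.
  rewrite vs muleC -leb_integralZl//.
  - apply: leb_le_integral => //.
    + apply: leb_measurable_funM; first exact: leb_measurable_cst.
      exact: (leb_measurable_funS mI s1 mxi).
    + exact: (leb_measurable_funS mI s1 mxiS).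
    + by move=> x /s1 Ix; rewrite mule_ge0 ?xi0 ?tail_sup_ge0.
    + move=> x x1x; rewrite muleC; apply: lee_wpmul2l; first exact/xi0/s1.
      by apply: ess_sup_tail_ni; case: x1x => _; rewrite lte_fin => /ltW.
  - exact: (leb_measurable_funS mI s1 mxi).
  - by move=> x /s1; exact: xi0.
  - exact: tail_sup_ge0.
have B_le : \int[leb]_(x in J) ((xi x)%:E * tail_sup x) <=
    tail_sup x1 * ((v t)^-1 - (v s)^-1)%:E.
  rewrite -JE -leb_integralZl//.
  - apply: leb_le_integral => //.
    + exact: (leb_measurable_funS mI sJ mxiS).
    + apply: leb_measurable_funM; first exact: leb_measurable_cst.
      exact: (leb_measurable_funS mI sJ mxi).
    + by move=> x /sJ; exact: xiS0.
    + move=> x Jx; rewrite muleC; apply: lee_wpmul2r; first exact/xi0/sJ.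
      by apply: ess_sup_tail_ni; case: Jx.
  - exact: (leb_measurable_funS mI sJ mxi).
  - by move=> x /sJ; exact: xi0.
  - exact: tail_sup_ge0.
rewrite split_// -/A.
have S0 : 0 <= tail_sup x1 by exact: tail_sup_ge0.
have A0 : 0 <= A by apply: leb_integral_ge0 => x /s1; exact: xiS0.
have d0 : (0 <= (v t)^-1 - (v s)^-1)%R by rewrite subr_ge0 lef_pV2// v_ni.
(* If [A] is infinite, so is the right side of the claim. Otherwise [A_ge] makes [tail_sup x1]
   finite, and real arithmetic remains. *)
have [Aoo|Afin] := eqVneq A +oo.
  by rewrite [in leRHS]Aoo gt0_muley ?lte_fin// leey.
have A_fin : A \is a fin_num by rewrite ge0_fin_numE// lt_neqAle Afin leey.
have Sfin : tail_sup x1 \is a fin_num.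
  rewrite ge0_fin_numE// ltey; apply: contra_neq Afin => Soo.
  apply/eqP; rewrite eq_le leey/=; apply: le_trans A_ge.
  by rewrite Soo gt0_muley// lte_fin invr_gt0.
apply: (@le_trans _ _ ((v t)%:E * (A + tail_sup x1 * ((v t)^-1 - (v s)^-1)%:E))).
  by apply: lee_wpmul2l; [rewrite lee_fin ltW|rewrite leeD2l].
move: A_ge; rewrite -(fineK A_fin) -(fineK Sfin) -!EFinM !lee_fin.
move: (fine A) (fine (tail_sup x1)) => a c ca.
have vv : (0 <= v s - v t)%R by rewrite subr_ge0 v_ni.
have -> : (v t * (a + c * ((v t)^-1 - (v s)^-1)) =
    v t * a + ((v s)^-1 * c) * (v s - v t))%R.
  by field; rewrite !gt_eqF.
have -> : (v s * a = v t * a + a * (v s - v t))%R by ring.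
by rewrite lerD2l ler_wpM2r.
Qed.

End TOperator.

Variable N : (R -> \bar R) -> \bar R.
Hypothesis hL : 0 < L.
Hypothesis hN : ri_norm L N.

Let L0 : 0 <= L. Proof. exact: ltW. Qed.

Lemma hardy_ae h h' : M L h -> M L h' -> ae_on (ioo 0 L) (fun x => h x = h' x) ->
  forall t, ioo 0 L t -> hardy h t = hardy h' t.
Proof.
move=> mh mh' hh t It; congr (_ * _).
have sI := sub_ioo_nu hnu It.
have mv := v_measurable.
apply: leb_ae_eq_integral; first exact: measurable_ioo.
- by apply: (leb_measurable_funS mI sI); exact: leb_measurable_funM.
- by apply: (leb_measurable_funS mI sI); exact: leb_measurable_funM.
- by apply: (ae_on_subset sI); apply: ae_onS hh => x _ ->.
Qed.

(** Members of [Mplus] are nonnegative only a.e.; passing to |h| changes no integral and allows the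
    use of the lemmas on everywhere nonnegative functions. *)
Lemma hardy_norm_abs h : Mplus L h -> Mplus L (hardy h) /\
  N (hardy h) = N (hardy (fun x => `|h x|)).
Proof.
move=> ph; have [mh _] := ph.
have pa : Mplus L (hardy (fun x => `|h x|)).
  by apply: hardy_Mplus; [exact: M_abs|].
have hE t : ioo 0 L t -> hardy (fun x => `|h x|) t = hardy h t.
  by apply: hardy_ae => //; [exact: M_abs|exact: Mplus_eq_abs].
have phh : Mplus L (hardy h).
  case: pa => ma a0; split; first exact: (eq_M hE ma).
  by apply: ae_onS a0 => t It; rewrite hE.
by split=> //; apply: (ri_norm_ae hN) => //; apply: ae_onW => t It; rewrite hE.
Qed.

(** * The two functionals as suprema over weights *)

Definition dual_ball : set (R -> \bar R) :=
  [set g | [/\ Mplus L g, (forall x, 0 <= g x) & associate L N g <= 1]].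

(** For <=, duality for the nonincreasing function [hardy h] moves the operator onto g, and
    Hardy-Littlewood replaces h by f^*. For >=, [resonance] reduces the pairing to functions h
    equimeasurable with f, and Hoelder bounds each of these. *)
Lemma rhoE f : Mplus L f -> rho L N u v nu f =
  ereal_sup [set rearr_pairing L f w | w in [set hardy_dual g | g in dual_ball]].
Proof.
move=> [mf _]; apply/eqP; rewrite eq_le; apply/andP; split.
- apply: ge_ereal_sup => _ [h [ph hf] <-].
  have [mh _] := ph.
  rewrite -/(hardy h) (hardy_norm_abs ph).2.
  apply: (ri_norm_dual hL hN).
  + by apply: hardy_M => //; exact: M_abs.
  + by move=> t; apply: hardy_ge0.
  + by move=> s t; apply: hardy_ni => //; exact: M_abs.
  move=> g pg g0 Ng; have [mg _] := pg.
  rewrite hardy_duality//; try exact: M_abs.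
  + apply: (@le_trans _ _ (rearr_pairing L f (hardy_dual g))); last first.
      apply: ereal_sup_ubound; exists (hardy_dual g) => //; exists g => //.
    have mw : M L (hardy_dual g) by exact: hardy_dual_M.
    rewrite /rearr_pairing -(eq_rearr hf).
    apply: le_trans (hardy_littlewood L0 mh mw).
    apply: le_of_eq; apply: leb_eq_integral => x Ix.
    by rewrite [`|hardy_dual g x|]gee0_abs//; exact: hardy_dual_ge0.
- apply: ge_ereal_sup => _ [_ [g [pg g0 Ng] <-] <-]; have [mg _] := pg.
  have mw : M L (hardy_dual g) by exact: hardy_dual_M.
  apply: resonance => // h ph h0 hf; have [mh _] := ph.
  apply: (@le_trans _ _ (N (hardy h))); last first.
    by apply: ereal_sup_ubound; exists h.
  have pH : Mplus L (hardy h) by exact: (hardy_norm_abs ph).1.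
  rewrite -[leRHS]mul1e.
  apply: le_trans (associate_holder hN pH pg ltr01 Ng).
  rewrite hardy_duality//.
  apply: le_of_eq; apply: leb_eq_integral => x Ix.
  by rewrite gee0_abs//; exact: hardy_dual_ge0.
Qed.

Lemma rearr_rearr f : M L f -> rearr L (rearr L f) = rearr L f.
Proof. by move=> mf; apply: eq_rearr; exact: equimeasurable_rearr. Qed.

(** A nonincreasing w may differ from w^* at jumps, so the equality is assembled from
    Hardy-Littlewood in one direction and w^* <= w in the other. *)
Lemma integral_rearr_noninc f w : M L f -> M L w -> (forall t, ioo 0 L t -> 0 <= w t) ->
  (forall s t, ioo 0 L s -> ioo 0 L t -> (s <= t)%R -> w t <= w s) ->
  \int[leb]_(t in ioo 0 L) (rearr L f t * w t) = rearr_pairing L f w.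
Proof.
move=> mf mw w0 wni; apply/eqP; rewrite eq_le; apply/andP; split.
  rewrite /rearr_pairing -{2}(rearr_rearr mf).
  apply: le_trans (hardy_littlewood L0 (@rearr_M _ L f) mw).
  apply: le_of_eq; apply: leb_eq_integral => t It.
  by rewrite abs_rearr gee0_abs// w0.
apply: leb_le_integral => //.
- by apply: leb_measurable_funM; exact: rearr_M.
- by apply: leb_measurable_funM; [exact: rearr_M|exact: mw].
- by move=> t _; rewrite mule_ge0 ?rearr_ge0.
- by move=> t It; apply: lee_wpmul2l; [exact: rearr_ge0|exact: rearr_le_noninc].
Qed.

Lemma dual_Top_M g : M L g -> M L (hardy_dual (T g)).
Proof.
move=> mg; apply: hardy_dual_M.
  exact: Top_M.
exact: Top_ge0.
Qed.

Lemma dual_Top_ge0 g t : ioo 0 L t -> 0 <= hardy_dual (T g) t.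
Proof.
apply: hardy_dual_ge0.
exact: Top_ge0.
Qed.

Lemma dual_Top_ni g s t : ioo 0 L s -> ioo 0 L t -> (s <= t)%R ->
  hardy_dual (T g) t <= hardy_dual (T g) s.
Proof. exact: hardy_dual_Top_ni. Qed.

Lemma rho_tildeE f : Mplus L f -> rho_tilde L N u v nu phi f =
  ereal_sup [set rearr_pairing L f w | w in
    [set hardy_dual (T g) | g in [set g | Mplus L g /\ associate L N g <= 1]]].
Proof.
move=> [mf _].
have E g : M L g -> \int[leb]_(t in ioo 0 L)
      (rearr L f t * (v t)%:E *
       \int[leb]_(s in ioo 0 (nuinv L nu t)%:E) (T g s * (u s)%:E)) =
    rearr_pairing L f (hardy_dual (T g)).
  move=> mg; rewrite -integral_rearr_noninc//.
  - by apply: leb_eq_integral => t _; rewrite muleA.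
  - exact: dual_Top_M.
  - exact: dual_Top_ge0.
  - exact: dual_Top_ni.
congr ereal_sup; apply/seteqP; split.
  move=> y [g [pg Ng] <-]; have [mg _] := pg.
  by exists (hardy_dual (T g)); [exists g|rewrite E].
move=> y [w [g [pg Ng] <-] <-]; have [mg _] := pg.
by exists g => //; rewrite E.
Qed.

Lemma associate_Top_le (C : R) g : op_bound L (associate L N) T C ->
  Mplus L g -> associate L N g <= 1 -> associate L N (T g) <= C%:E.
Proof.
move=> [C0 hC] pg Ng; have [mg _] := pg.
have absE f : Mplus L f -> norm_ext (associate L N) f = associate L N f.
  by move=> pf; apply: associate_ae => //; [apply: Mplus_abs; case: pf|exact: Mplus_eq_abs].
rewrite -absE; last exact: Top_Mplus.
apply: le_trans (hC _ mg) _; rewrite absE// -[leRHS]mule1.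
by apply: lee_wpmul2l; rewrite ?lee_fin.
Qed.

Lemma Hop_rearr f : Hop L u v nu (rearr L f) = hardy (rearr L f).
Proof.
apply/funext => t; congr (_ * _); apply: leb_eq_integral => s _.
by rewrite abs_rearr.
Qed.

Lemma hardy_rearr_le_rho f : Mplus L f ->
  N (Hop L u v nu (rearr L f)) <= rho L N u v nu f.
Proof.
move=> [mf _]; rewrite Hop_rearr.
apply: ereal_sup_ubound; exists (rearr L f) => //; split; first exact: rearr_Mplus.
exact: equimeasurable_rearr.
Qed.

(** The function u cut off at nu^-1(t) is nonincreasing, so Hardy-Littlewood replaces g by g^* under
    the integral; only then does g^* <= T g apply. *)
Lemma hardy_dual_le_Top g : M L g -> (forall x, 0 <= g x) ->
  forall t, ioo 0 L t -> hardy_dual g t <= hardy_dual (T g) t.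
Proof.
move=> mg g0 t It; apply: lee_wpmul2l; first by rewrite lee_fin ltW// v_gt0.
have sI := sub_ioo_nuinv hnu It.
set x := nuinv L nu t.
have mx : leb_measurable (ioo 0 x%:E) by exact: measurable_ioo.
have mu := u_measurable.
have mT : M L (T g) by exact: Top_M.
pose u1 s : \bar R := if (s < x)%R then (u s)%:E else 0.
have u10 s : ioo 0 L s -> 0 <= u1 s.
  by move=> Is; rewrite /u1; case: ifP => // _; rewrite lee_fin ltW// u_gt0.
have u1ni s s' : ioo 0 L s -> ioo 0 L s' -> (s <= s')%R -> u1 s' <= u1 s.
  move=> Is Is' ss; rewrite /u1; case: ifPn => s'x.
    by rewrite (le_lt_trans ss s'x) lee_fin u_ni.
  exact: u10.
have mu1 : M L u1.
  by apply: monotone_emeasurable; [exact: ioo_interval|left; exact: u1ni].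
have cut (k : R -> \bar R) :
    \int[leb]_(s in ioo 0 x%:E) (k s * (u s)%:E) = \int[leb]_(s in ioo 0 L) (k s * u1 s).
  rewrite [LHS]integral_mkcond [RHS]integral_mkcond; apply: eq_integral => s _.
  rewrite !patchE /u1; case: ifPn => [|sx].
    by rewrite inE => sx; rewrite mem_set; [case: (sx) => _; rewrite lte_fin => ->|exact: sI].
  case: ifPn => //; rewrite inE => -[s0 sL]; case: ifPn => [h|_]; last by rewrite mule0.
  by move/negP : sx; case; rewrite inE.
rewrite !cut.
apply: (@le_trans _ _ (\int[leb]_(s in ioo 0 L) (rearr L g s * u1 s))).
  apply: (@le_trans _ _ (\int[leb]_(s in ioo 0 L) (`|g s| * `|u1 s|))).
    apply: le_of_eq; apply: leb_eq_integral => s Is.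
    by rewrite !gee0_abs// u10.
  apply: (le_trans (hardy_littlewood L0 mg mu1)).
  by rewrite (integral_rearr_noninc mg mu1 u10 u1ni).
have T0 := Top_ge0 g.
(* As g^* <= T g holds only a.e., T g is replaced by its pointwise maximum with g^*. *)
have E : \int[leb]_(s in ioo 0 L) (T g s * u1 s) =
    \int[leb]_(s in ioo 0 L) (maxe (rearr L g s) (T g s) * u1 s).
  apply: leb_ae_eq_integral => //.
  - exact: leb_measurable_funM.
  - by apply: leb_measurable_funM => //; apply: measurable_maxe; [exact: rearr_M|exact: mT].
  - apply: ae_onS (rearr_le_Top g) => s _ h.
    by rewrite max_r.
rewrite E; apply: leb_le_integral => //.
- by apply: leb_measurable_funM => //; exact: rearr_M.
- by apply: leb_measurable_funM => //; apply: measurable_maxe; [exact: rearr_M|exact: mT].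
- by move=> s Is; rewrite mule_ge0 ?rearr_ge0 ?u10.
- move=> s Is; apply: lee_wpmul2r; first exact: u10.
  by rewrite le_max lexx.
Qed.

Lemma rho_le_rho_tilde f : Mplus L f -> rho L N u v nu f <= rho_tilde L N u v nu phi f.
Proof.
move=> pf; rewrite rhoE// rho_tildeE//.
apply: ge_ereal_sup => _ [_ [g [pg g0 Ng] <-] <-]; have [mg _] := pg.
apply: (@le_trans _ _ (rearr_pairing L f (hardy_dual (T g)))); last first.
  by apply: ereal_sup_ubound; exists (hardy_dual (T g)) => //; exists g.
have mw : M L (hardy_dual g) by exact: hardy_dual_M.
rewrite /rearr_pairing; apply: leb_le_integral.
- exact: mI.
- by apply: leb_measurable_funM; exact: rearr_M.
- by apply: leb_measurable_funM; exact: rearr_M.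
- by move=> t _; rewrite mule_ge0 ?rearr_ge0.
- move=> t _; apply: lee_wpmul2l; first exact: rearr_ge0.
  apply: rearr_le => //; first exact: dual_Top_M.
  apply: ae_onW => s Is; rewrite !gee0_abs.
  + exact: hardy_dual_le_Top.
  + exact: dual_Top_ge0.
  + exact: hardy_dual_ge0.
Qed.

Lemma rho_tilde_le_bound (C : R) f : op_bound L (associate L N) T C -> (0 < C)%R ->
  Mplus L f -> rho_tilde L N u v nu phi f <= C%:E * N (Hop L u v nu (rearr L f)).
Proof.
move=> hC C0 pf; have [mf _] := pf; rewrite rho_tildeE//.
apply: ge_ereal_sup => _ [_ [g [pg Ng] <-] <-]; have [mg _] := pg.
have pT : Mplus L (T g) by exact: Top_Mplus.
have [mT _] := pT.
have NT := associate_Top_le hC pg Ng.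
rewrite Hop_rearr.
have pH := (hardy_norm_abs (rearr_Mplus L f)).1.
apply: le_trans (associate_holder hN pH pT C0 NT).
rewrite -integral_rearr_noninc//; last 3 first.
- exact: dual_Top_M.
- exact: dual_Top_ge0.
- exact: dual_Top_ni.
rewrite hardy_duality//.
- exact: rearr_M.
- by move=> x _; exact: rearr_ge0.
- exact: Top_ge0.
Qed.




Lemma ri_norm_indic_gt0 (b : R) : (0 < b)%R -> b%:E <= L ->
  0 < N (fun x => (\1_(ioo 0 b%:E) x)%:E) < +oo.
Proof.
move=> b0 bL; have mb : leb_measurable (ioo 0 b%:E) by exact: measurable_ioo.
have bI : ioo 0 b%:E `<=` ioo 0 L by apply: subset_ioo.
have lb : leb (ioo 0 b%:E : set (lebR R)) = b%:E by rewrite leb_ioo0// lee_fin ltW.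
have pb : Mplus L (fun x => (\1_(ioo 0 b%:E) x)%:E) by exact: indic1_Mplus.
apply/andP; split; last by apply: (ri_indic hN mb bI); rewrite lb ltry.
rewrite lt_neqAle (ri_ge0 hN pb) andbT eq_sym; apply/eqP => /(ri_eq0 hN pb).1 h.
have : leb (ioo 0 b%:E : set (lebR R)) = 0.
  apply: ae_on_absurd => //; apply: ae_onS (ae_on_subset bI h) => x xb.
  by rewrite indicE mem_set// => -[] /eqP; rewrite oner_eq0.
by rewrite lb => -[] /eqP; rewrite gt_eqF.
Qed.

(* Testing T on a multiple of an indicator. Hence op_norm * +oo = +oo, which is
   needed when N (Hop (rearr f)) is infinite. *)
Lemma op_bound_ge : exists k : R, (0 < k)%R /\
  forall C, op_bound L (associate L N) T C -> (k <= C)%R.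
Proof.
have [b [b0 bL]] : exists b : R, (0 < b)%R /\ b%:E <= L.
  move: hL; case: (L) => [r||//]; first by rewrite lte_fin => r0; exists r.
  by move=> _; exists 1%R; rewrite leey.
have mb : leb_measurable (ioo 0 b%:E) by exact: measurable_ioo.
have bI : ioo 0 b%:E `<=` ioo 0 L by apply: subset_ioo.
have lb : leb (ioo 0 b%:E : set (lebR R)) = b%:E by rewrite leb_ioo0// lee_fin ltW.
have lb_fin : leb (ioo 0 b%:E : set (lebR R)) < +oo by rewrite lb ltry.
have [c [c0 Nc]] := associate_indic_le1 hN mb bI lb_fin.
have /andP[n0 n_lty] := ri_norm_indic_gt0 b0 bL.
set chi := fun x : R => (\1_(ioo 0 b%:E) x)%:E : \bar R in n0 n_lty.
have n_fin : N chi \is a fin_num by rewrite ge0_fin_numE// ltW.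
pose n := fine (N chi); have nE : N chi = n%:E by rewrite fineK.
have n_gt0 : (0 < n)%R by rewrite -lte_fin -nE.
pose g := fun x : R => (c * \1_(ioo 0 b%:E) x)%:E : \bar R.
have pg : Mplus L g by apply: indic_Mplus => //; exact: ltW.
have [mg _] := pg.
have pchi : Mplus L chi by exact: indic1_Mplus.
have pT : Mplus L (T g) by exact: Top_Mplus.
(* On (0, b) one has c <= g^* <= T g a.e., so Hoelder gives c b <= \int chi T g <= C n with n =
   [N chi]. *)
exists (c * b / n)%R; split; first by rewrite divr_gt0// mulr_gt0.
move=> C hC; set k := (c * b / n)%R.
have k0 : (0 < k)%R by rewrite divr_gt0// mulr_gt0.
(* [associate_holder] asks for a positive constant and C might be 0; as k/2 < k, the bound k <= C'
   still forces k <= C. *)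
pose C' := Num.max C (k / 2)%R.
have C'0 : (0 < C')%R by rewrite lt_max divr_gt0// orbT.
suff : (k <= C')%R.
  by rewrite le_max => /orP[//|]; rewrite ler_pdivlMr// ger_pMr// -[1%R]/(1%:R) ler_nat.
have NT : associate L N (T g) <= C'%:E.
  by apply: (le_trans (associate_Top_le hC pg Nc)); rewrite lee_fin le_max lexx.
have := associate_holder hN pchi pT C'0 NT; rewrite nE -EFinM => h.
rewrite ler_pdivrMr// -lee_fin; apply: le_trans h.
have [mT _] := pT; have [mchi _] := pchi.
rewrite EFinM -lb -(leb_integral_cst c%:E mb) integral_mkcond.
rewrite [leRHS]integral_mkcond.
apply: (@le_trans _ _ (\int[leb]_x (((fun x => chi x * rearr L g x) \_ (ioo 0 L)) x))).
  rewrite -!integral_mkcond.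
  apply: (@le_trans _ _ (\int[leb]_(x in ioo 0 b%:E) (chi x * rearr L g x))).
    apply: leb_le_integral.
    - exact: mb.
    - exact: leb_measurable_cst.
    - apply: (leb_measurable_funS mI bI).
      by apply: leb_measurable_funM; [exact: mchi|exact: rearr_M].
    - by move=> x _; rewrite lee_fin ltW.
    - move=> x xb; rewrite /chi indicE mem_set// mul1e.
      by case: xb => x0 xb; apply: rearr_indic_ge => //; exact: ltW.
  apply: leb_subset_integral => //.
  - by apply: leb_measurable_funM; [exact: mchi|exact: rearr_M].
  - by move=> x _; rewrite mule_ge0 ?rearr_ge0// lee_fin.
rewrite -!integral_mkcond.
apply: (@le_trans _ _ (\int[leb]_(x in ioo 0 L) (chi x * maxe (rearr L g x) (T g x)))).
  apply: leb_le_integral => //.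
  - by apply: leb_measurable_funM; [exact: mchi|exact: rearr_M].
  - apply: leb_measurable_funM; first exact: mchi.
    by apply: measurable_maxe; [exact: rearr_M|exact: mT].
  - by move=> x _; rewrite mule_ge0 ?rearr_ge0// lee_fin.
  - move=> x _; apply: lee_wpmul2l; first by rewrite lee_fin.
    by rewrite le_max lexx.
apply: le_of_eq; apply: leb_ae_eq_integral => //.
- apply: leb_measurable_funM; first exact: mchi.
  by apply: measurable_maxe; [exact: rearr_M|exact: mT].
- by apply: leb_measurable_funM; [exact: mchi|exact: mT].
- apply: ae_onS (rearr_le_Top g) => x _ hx.
  by rewrite max_r.
Qed.

(** Provides the positive weight behind (P5). For a small multiple of the indicator of (0, b) with b
    = nu^-1(t), phi g^* is positive on (0, b); hence its tail supremum is positive there, and so is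
    the integral of that against xi. *)
Lemma hardy_dual_Top_gt0 (t : R) : ioo 0 L t ->
  exists g, [/\ Mplus L g, associate L N g <= 1 & 0 < hardy_dual (T g) t].
Proof.
move=> It; set b := nuinv L nu t.
have Ib : ioo 0 L b by exact: nuinv_ioo.
have [b0 bL] := Ib.
have mb : leb_measurable (ioo 0 b%:E) by exact: measurable_ioo.
have bI : ioo 0 b%:E `<=` ioo 0 L by apply: subset_ioo => //; exact: ltW.
have lb : leb (ioo 0 b%:E : set (lebR R)) = b%:E by rewrite leb_ioo0// lee_fin ltW.
have lb_fin : leb (ioo 0 b%:E : set (lebR R)) < +oo by rewrite lb ltry.
have [c [c0 Nc]] := associate_indic_le1 hN mb bI lb_fin.
pose g := fun x : R => (c * \1_(ioo 0 b%:E) x)%:E : \bar R.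
have pg : Mplus L g by apply: indic_Mplus => //; exact: ltW.
have [mg _] := pg.
exists g; split=> //.
rewrite (hardy_dual_TopE g)//; apply: mule_gt0; first by rewrite lte_fin v_gt0.
pose S := tail_sup g.
have S_gt0 s : ioo 0 b%:E s -> 0 < S s.
  move=> sb; have Is := bI _ sb; have [s0 sb'] := sb.
  rewrite lt_neqAle (tail_sup_ge0 g Is) andbT eq_sym; apply/eqP => Ss.
  pose J : set R := ico s b%:E.
  have JI : J `<=` ioo 0 L.
    move=> x [sx xb]; split; [exact: lt_le_trans sx|exact: lt_trans bL].
  have F0 x : ioo 0 L x -> 0 <= (u x / xi x)%:E * rearr L g x.
    by move=> Ix; rewrite mule_ge0 ?rearr_ge0// lee_fin divr_ge0 ?ltW ?u_gt0 ?xi_gt0.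
  have : ae_on J (fun=> False).
    apply: ae_onS (ae_on_subset JI (ae_le_ess_sup_tail F0)) => x Jx h.
    have Ix := JI _ Jx; have [sx xb] := Jx.
    have : (u x / xi x)%:E * rearr L g x <= 0.
      by apply: (le_trans h); rewrite -Ss; exact: ess_sup_tail_ni.
    rewrite leNgt mule_gt0// ?lte_fin ?divr_gt0 ?u_gt0 ?xi_gt0//.
    apply: (@lt_le_trans _ _ c%:E); first by rewrite lte_fin.
    apply: rearr_indic_ge => //; [exact: ltW|by case: Ix => /ltW].
  move=> /(ae_on_absurd (measurable_ico s b%:E)).
  rewrite leb_ico_fin; last by rewrite ltW// -lte_fin.
  by move=> [] /eqP; rewrite subr_eq0 gt_eqF// -lte_fin.
have mxiS : leb_measurable_fun (ioo 0 b%:E) (fun s => (xi s)%:E * S s).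
  apply: (leb_measurable_funS mI bI); apply: leb_measurable_funM.
    exact: xi_measurable.
  exact: tail_sup_measurable.
have xiS_gt0 s : ioo 0 b%:E s -> 0 < (xi s)%:E * S s.
  by move=> sb; rewrite mule_gt0 ?S_gt0// lte_fin xi_gt0//; exact: bI.
rewrite lt_neqAle leb_integral_ge0 ?andbT; last by move=> s /xiS_gt0/ltW.
rewrite eq_sym; apply/eqP => int0.
have : ae_on (ioo 0 b%:E) (fun s => (xi s)%:E * S s = 0).
  apply: leb_integral_abs_eq0 => //; rewrite -[RHS]int0.
  by apply: leb_eq_integral => s sb; rewrite gee0_abs// ltW// xiS_gt0.
move=> h; have : leb (ioo 0 b%:E : set (lebR R)) = 0.
  apply: ae_on_absurd => //; apply: ae_onS h => s sb h0.
  by have := xiS_gt0 _ sb; rewrite h0 ltxx.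
by rewrite lb => -[] /eqP; rewrite gt_eqF.
Qed.

(** A single weight suffices: it is nonincreasing and positive at |E|/2, hence bounded below on (0,
    |E|/2), and doubling recovers the integral of f^* over (0, |E|). *)
Lemma rho_tilde_local_integral (E : set (lebR R)) : measurable E ->
  E `<=` ioo 0 L -> leb E < +oo ->
  exists C : R, (0 < C)%R /\ forall f, Mplus L f ->
    \int[leb]_(x in E) f x <= C%:E * rho_tilde L N u v nu phi f.
Proof.
move=> mE EI Efin; set m := fine (leb E).
have mEE : leb E = m%:E by rewrite fineK// ge0_fin_numE// measure_ge0.
have m_ge0 : (0 <= m)%R by rewrite fine_ge0// measure_ge0.
have mL : m%:E <= L.
  by rewrite -mEE -(leb_ioo0 L0); apply: le_leb; [exact: mE|exact: mI|].
have rhoE' f : Mplus L f -> rho_tilde L N u v nu phi f =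
    ereal_sup [set rearr_pairing L f w | w in
    [set hardy_dual (T g) | g in [set g | Mplus L g /\ associate L N g <= 1]]].
  exact: rho_tildeE.
have [m0|m0] := eqVneq m 0%R.
  exists 1%R; split=> // f pf; apply: (le_trans (integral_le_rearr hL mE EI Efin pf)).
  rewrite -/m m0 (_ : ioo 0 0%:E = set0); last first.
    by apply/seteqP; split=> // x [x0]; rewrite lte_fin ltNge ltW.
  rewrite integral_set0 mul1e rhoE'//.
  have p0 : Mplus L (fun=> 0 : \bar R).
    by apply: Mplus_ge0 => //; exact: leb_measurable_cst.
  apply: le_ereal_sup_tmp.
  exists (rearr_pairing L f (hardy_dual (T (fun=> 0)))).
    exists (hardy_dual (T (fun=> 0))) => //; exists (fun=> 0) => //; split=> //.
    apply: ge_ereal_sup => _ [h _ <-].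
    have -> : \int[leb]_(x in ioo 0 L) (0 * h x) = \int[leb]_(x in ioo 0 L) (0 : \bar R).
      by apply: leb_eq_integral => x _; rewrite mul0e.
    by rewrite integral0.
  exact: rearr_pairing_ge0.
have m_gt0 : (0 < m)%R by rewrite lt_neqAle eq_sym m0.
pose t1 := (m / 2)%R.
have t10 : (0 < t1)%R by rewrite divr_gt0.
have t1m : (t1 < m)%R by rewrite ltr_pdivrMr// ltr_pMr// ltr1n.
have It1 : ioo 0 L t1 by split=> //; apply: lt_le_trans mL; rewrite lte_fin.
have [g [pg Ng w_gt0]] := hardy_dual_Top_gt0 It1.
have [mg _] := pg.
pose w := hardy_dual (T g).
(* The weight may be infinite at t1; the minimum with 1 gives a real lower bound. *)
pose k := fine (mine (w t1) 1).
have k_fin : mine (w t1) 1 \is a fin_num.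
  rewrite ge0_fin_numE; first by rewrite gt_min ltry orbT.
  by rewrite le_min ltW//= lee_fin.
have kE : k%:E = mine (w t1) 1 by rewrite fineK.
have k0 : (0 < k)%R by rewrite -lte_fin kE lt_min w_gt0 lte_fin/=.
have kw t : ioo 0 L t -> (t < t1)%R -> k%:E <= w t.
  move=> It tt1; rewrite kE ge_min; apply/orP; left.
  by apply: dual_Top_ni => //; exact: ltW.
exists (2 / k)%R; split; first by rewrite divr_gt0.
move=> f pf; have [mf _] := pf.
apply: (le_trans (integral_le_rearr hL mE EI Efin pf)); rewrite -/m.
apply: (le_trans (integral_rearr_double mf m_gt0 mL)).
rewrite [(2 / k)%:E]EFinM -muleA; apply: lee_wpmul2l; first by rewrite lee_fin.
rewrite lee_pdivlMl//; apply: (@le_trans _ _ (rearr_pairing L f w)); last first.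
  by rewrite rhoE'//; apply: ereal_sup_ubound; exists w => //; exists g.
rewrite -integral_rearr_noninc//; last 3 first.
- exact: dual_Top_M.
- by move=> t; exact: dual_Top_ge0.
- by move=> s t; exact: dual_Top_ni.
have sI : ioo 0 t1%:E `<=` ioo 0 L by apply: subset_ioo => //; apply: ltW; case: It1.
have mt1 : leb_measurable (ioo 0 t1%:E) by exact: measurable_ioo.
have mrf : leb_measurable_fun (ioo 0 L) (rearr L f) by exact: rearr_M.
have mw : leb_measurable_fun (ioo 0 L) w.
  exact: dual_Top_M.
have mrw : leb_measurable_fun (ioo 0 L) (fun t => rearr L f t * w t).
  exact: leb_measurable_funM.
have mrf1 := leb_measurable_funS mI sI mrf.
have rf0 t : ioo 0 t1%:E t -> 0 <= rearr L f t by move=> _; exact: rearr_ge0.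
have k_ge0 : 0 <= k%:E by rewrite lee_fin ltW.
rewrite -(leb_integralZl mt1 mrf1 rf0 k_ge0).
apply: (@le_trans _ _ (\int[leb]_(t in ioo 0 t1%:E) (rearr L f t * w t))).
  apply: leb_le_integral.
  - exact: mt1.
  - by apply: leb_measurable_funM; [exact: leb_measurable_cst|exact: mrf1].
  - exact: (leb_measurable_funS mI sI mrw).
  - by move=> t _; rewrite mule_ge0 ?rearr_ge0.
  - move=> t tt; rewrite muleC; apply: lee_wpmul2l; first exact: rearr_ge0.
    by apply: kw; [exact: sI|case: tt => _; rewrite lte_fin].
apply: leb_subset_integral => //.
move=> t It; rewrite mule_ge0 ?rearr_ge0//.
exact: dual_Top_ge0.
Qed.


(** * Finiteness on indicators *)

Let mv : leb_measurable_fun (ioo 0 L) (EFin \o v).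
Proof. exact: v_measurable. Qed.

(** The function of the finiteness hypothesis with a general m in place of the endpoint. For m <= L
    it is [hardy] of the indicator of (0, m), hence it dominates the Hardy image of the rearranged
    indicator of a set of measure at most m. *)
Definition hardy_cut (m t : R) : \bar R :=
  (u t)%:E * \int[leb]_(s in ioo (nu t) m%:E) (v s)%:E.

Let below (m s : R) : \bar R := if (s < m)%R then 1 else 0.

Let below_M m : M L (below m).
Proof.
apply: monotone_emeasurable; first exact: ioo_interval.
left => x y _ _ xy; rewrite /below; case: ifPn => // ym; last by case: ifP.
by rewrite (le_lt_trans xy ym).
Qed.

Let below_ge0 m s : 0 <= below m s.
Proof. by rewrite /below; case: ifP. Qed.

Let hardy_cutE (m t : R) : m%:E <= L -> hardy_cut m t = hardy (below m) t.
Proof. by move=> mL; congr (_ * _); exact: integral_ioo_trunc. Qed.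

Lemma hardy_cut_Mplus (m : R) : m%:E <= L -> Mplus L (hardy_cut m).
Proof.
move=> mL; have -> : hardy_cut m = hardy (below m).
  by apply/funext => t; exact: hardy_cutE.
apply: hardy_Mplus.
  exact: below_M.
by move=> x _; exact: below_ge0.
Qed.

Lemma hardy_rearr_indic_le (E : set R) (m : R) : leb_measurable E -> m%:E <= L ->
  leb (E : set (lebR R)) <= m%:E ->
  forall t, ioo 0 L t ->
  Hop L u v nu (rearr L (fun x => (\1_E x)%:E)) t <= hardy_cut m t.
Proof.
move=> mE mL Em t It; rewrite hardy_cutE// /Hop.
apply: lee_wpmul2l; first by rewrite lee_fin ltW// u_gt0.
have sI := sub_ioo_nu hnu It.
apply: leb_le_integral.
- exact: measurable_ioo.
- apply: (leb_measurable_funS mI sI); apply: leb_measurable_funM.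
    by apply: leb_measurable_abs; exact: rearr_M.
  exact: mv.
- apply: (leb_measurable_funS mI sI); apply: leb_measurable_funM.
    exact: below_M.
  exact: mv.
- by move=> s /sI Is; rewrite mule_ge0// lee_fin ltW// v_gt0.
- move=> s /sI Is; apply: lee_wpmul2r; first by rewrite lee_fin ltW// v_gt0.
  rewrite abs_rearr; have [s0 _] := Is.
  apply: (le_trans (rearr_indic_le L mE (ltW s0))).
  rewrite /below; case: ifPn => // sE; last by case: ifP.
  by rewrite ifT// -lte_fin; exact: lt_le_trans Em.
Qed.

Lemma integral_v_ge (a b : R) : ioo 0 L a -> ioo 0 L b -> (a <= b)%R ->
  (v b * (b - a))%:E <= \int[leb]_(s in ioo a b%:E) (v s)%:E.
Proof.
move=> Ia Ib ab; have [a0 _] := Ia; have [_ bL] := Ib.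
have sI : ioo a b%:E `<=` ioo 0 L by apply: subset_ioo; exact: ltW.
have mab : leb_measurable (ioo a b%:E) by exact: measurable_ioo.
rewrite EFinM -(leb_ioo_fin ab) -(leb_integral_cst _ mab).
apply: leb_le_integral.
- exact: mab.
- exact: leb_measurable_cst.
- exact: (leb_measurable_funS mI sI mv).
- by move=> s _; rewrite lee_fin ltW// v_gt0.
- move=> s ss; rewrite lee_fin; apply: v_ni => //.
    exact: sI.
  by case: ss => _; rewrite lte_fin => /ltW.
Qed.

Lemma integral_v_le (D : set R) (a b : R) : leb_measurable D -> ioo 0 L a -> 
  b%:E <= L -> (a <= b)%R -> D `<=` ico a b%:E ->
  \int[leb]_(s in D) (v s)%:E <= (v a * (b - a))%:E.
Proof.
move=> mD Ia bL ab DJ; have [a0 _] := Ia.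
have sI : ico a b%:E `<=` ioo 0 L.
  by move=> x [ax xb]; split; [exact: lt_le_trans ax|exact: lt_le_trans bL].
have mab : leb_measurable (ico a b%:E) by exact: measurable_ico.
have mvJ := leb_measurable_funS mI sI mv.
apply: (@le_trans _ _ (\int[leb]_(s in ico a b%:E) (v s)%:E)).
  apply: leb_subset_integral.
  - exact: mD.
  - exact: mab.
  - exact: mvJ.
  - by move=> s /sI Is; rewrite lee_fin ltW// v_gt0.
  - exact: DJ.
rewrite EFinM -(leb_ico_fin ab) -(leb_integral_cst _ mab).
apply: leb_le_integral.
- exact: mab.
- exact: mvJ.
- exact: leb_measurable_cst.
- by move=> s /sI Is; rewrite lee_fin ltW// v_gt0.
- move=> s ss; rewrite lee_fin; apply: v_ni => //.
    exact: sI.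
  by case: ss.
Qed.

(* Where nu t < a / 2 the integral over (nu t, a) already contains (a / 2, a),
   so it controls the one over (a, m); elsewhere hardy_cut m is bounded and
   vanishes outside (0, nu^-1 m). *)
Lemma hardy_cut_le (a m : R) : ioo 0 L a -> ioo 0 L m -> (a <= m)%R ->
  exists C K : R, [/\ (0 <= C)%R, (0 <= K)%R & forall t, ioo 0 L t ->
    hardy_cut m t <=
      C%:E * hardy_cut a t + (K * \1_(ioo 0 (nuinv L nu m)%:E) t)%:E].
Proof.
move=> Ia Im am; have [a0 aL] := Ia; have [m0 mL] := Im.
have a20 : (0 < a / 2)%R by rewrite divr_gt0.
have a2a : (a / 2 < a)%R by rewrite ltr_pdivrMr// ltr_pMr// ltr1n.
have Ia2 : ioo 0 L (a / 2)%R by split=> //; apply: lt_trans aL; rewrite lte_fin.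
set b := nuinv L nu (a / 2)%R; have Ib : ioo 0 L b by exact: nuinv_ioo.
have va := v_gt0 Ia; have va2 := v_gt0 Ia2; have ub := u_gt0 Ib.
(* The integral of v over (a, m) is at most v(a) m = (2m/a) v(a) (a/2), and v(a) (a/2) is at most
   the integral over (a/2, a). For [K]: t >= b gives u(t) <= u(b), and v <= v(a/2) on an interval of
   length at most m. *)
exists (1 + 2 * m / a)%R, (u b * (v (a / 2) * m))%R; split.
- by rewrite addr_ge0// divr_ge0 ?mulr_ge0// ltW.
- by rewrite !mulr_ge0// ltW.
move=> t It; have Int := nu_ioo hnu It; have ut := u_gt0 It.
have [nt0 ntL] := Int.
have int0 (x : R) : x%:E <= L -> 0 <= \int[leb]_(s in ioo (nu t) x%:E) (v s)%:E.
  move=> xL; apply: leb_integral_ge0 => s [ns sx].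
  rewrite lee_fin ltW// v_gt0//; split; [exact: lt_trans ns|exact: lt_le_trans xL].
have ind0 : 0 <= (u b * (v (a / 2) * m) * \1_(ioo 0 (nuinv L nu m)%:E) t)%:E.
  by rewrite lee_fin !mulr_ge0// ltW.
have [tb|bt] := ltP t b.
  apply: (@le_trans _ _ ((1 + 2 * m / a)%:E * hardy_cut a t)); last exact: leeDl.
  rewrite /hardy_cut muleCA; apply: lee_wpmul2l; first by rewrite lee_fin ltW.
  have nta : (nu t < a / 2)%R by rewrite -(lt_nuinv hnu It Ia2).
  set A := \int[leb]_(s in ioo (nu t) a%:E) (v s)%:E.
  have A_ge : (v a * (a / 2))%:E <= A.
    apply: (@le_trans _ _ (v a * (a - nu t))%:E).
      by rewrite lee_fin ler_pM2l// lerBrDr; lra.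
    by apply: integral_v_ge => //; lra.
  pose J : set R := ico a m%:E.
  have mJ : leb_measurable J by exact: measurable_ico.
  have sI : ioo (nu t) m%:E `<=` ioo 0 L by apply: subset_ioo; exact: ltW.
  have -> : \int[leb]_(s in ioo (nu t) m%:E) (v s)%:E =
      A + \int[leb]_(s in J) (v s)%:E.
    apply: leb_integral_ioo_split => //; first by lra.
      exact: (leb_measurable_funS mI sI mv).
    by move=> s /sI Is; rewrite lee_fin ltW// v_gt0.
  have J_le : \int[leb]_(s in J) (v s)%:E <= (v a * (m - a))%:E.
    by apply: (integral_v_le mJ Ia) => //; exact: ltW.
  rewrite EFinD ge0_muleDl ?lee_fin//; last by rewrite divr_ge0 ?mulr_ge0 ?ltW.
  rewrite mul1e leeD2l//; apply: (le_trans J_le).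
  apply: (@le_trans _ _ ((2 * m / a)%:E * (v a * (a / 2))%:E)).
    rewrite -EFinM lee_fin.
    have -> : (2 * m / a * (v a * (a / 2)) = v a * m)%R by field; rewrite gt_eqF.
    by rewrite ler_pM2l// lerBlDr; lra.
  by apply: lee_wpmul2l; rewrite // lee_fin divr_ge0 ?mulr_ge0 ?ltW.
apply: (@le_trans _ _ (u b * (v (a / 2) * m) * \1_(ioo 0 (nuinv L nu m)%:E) t)%:E); last first.
  apply: leeDr; rewrite mule_ge0//; first by rewrite lee_fin addr_ge0 ?divr_ge0 ?mulr_ge0 ?ltW.
  by rewrite mule_ge0 ?int0 ?(ltW aL)// lee_fin ltW.
have ant : (a / 2 <= nu t)%R by rewrite leNgt -(lt_nuinv hnu It Ia2) -leNgt.
have [tm|mt] := ltP t (nuinv L nu m); last first.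
  rewrite /hardy_cut (_ : ioo (nu t) m%:E = set0) ?integral_set0 ?mule0//.
  apply/seteqP; split=> // x [nx xm].
  have : (nu t < m)%R by apply: (lt_trans nx); rewrite -lte_fin.
  by rewrite -(lt_nuinv hnu It Im) ltNge mt.
have ntm : (nu t < m)%R by rewrite -(lt_nuinv hnu It Im).
rewrite indicE mem_set; last by split=> //; case: It.
rewrite mulr1 EFinM; apply: lee_pmul.
- by rewrite lee_fin ltW.
- by apply: int0; exact: ltW.
- by rewrite lee_fin; exact: u_ni.
have mD : leb_measurable (ioo (nu t) m%:E) by exact: measurable_ioo.
apply: (le_trans (@integral_v_le _ (a / 2)%R m mD Ia2 (ltW mL) _ _)).
- lra.
- by move=> x [nx xm]; split=> //; rewrite ltW// (le_lt_trans ant).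
- by rewrite lee_fin ler_pM2l//; lra.
Qed.

(** Serves the case L = oo, where finiteness is assumed only for a = 1 and is needed for m as large
    as the measure of the given set. *)
Lemma hardy_cut_norm_fin (a m : R) : ioo 0 L a -> ioo 0 L m -> (a <= m)%R ->
  N (hardy_cut a) < +oo -> N (hardy_cut m) < +oo.
Proof.
move=> Ia Im am Na; have [_ aL] := Ia; have [_ mL] := Im.
have [C [K [C0 K0 hCK]]] := hardy_cut_le Ia Im am.
have pa := hardy_cut_Mplus (ltW aL); have pm := hardy_cut_Mplus (ltW mL).
set J := ioo 0 (nuinv L nu m)%:E in hCK.
have mJ : leb_measurable J by exact: measurable_ioo.
have Inm := nuinv_ioo hnu Im.
have sJ : J `<=` ioo 0 L by apply: subset_ioo => //; case: Inm => _ /ltW.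
have lJ : leb (J : set (lebR R)) < +oo.
  by rewrite leb_ioo0 ?ltry// lee_fin ltW//; case: Inm.
have pCa : Mplus L (fun t => C%:E * hardy_cut a t).
  case: (pa) => ma a0; split.
    by apply: leb_measurable_funM; [exact: leb_measurable_cst|exact: ma].
  by apply: ae_onS a0 => t _ h; rewrite mule_ge0// lee_fin.
have pKJ : Mplus L (fun t => (K * \1_J t)%:E) by exact: indic_Mplus.
have psum : Mplus L (fun t => C%:E * hardy_cut a t + (K * \1_J t)%:E).
  case: pCa => mCa Ca0; case: pKJ => mKJ KJ0; split.
    by apply: leb_measurable_funD; [exact: mCa|exact: mKJ].
  by apply: ae_onS (ae_on_and Ca0 KJ0) => t _ [x y]; exact: adde_ge0.
apply: (le_lt_trans (ri_monotone hN pm psum (ae_onW hCK))).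
apply: (le_lt_trans (ri_triangle hN pCa pKJ)).
have p1 : Mplus L (fun t => (\1_J t)%:E) by exact: indic1_Mplus.
have -> : N (fun t => (K * \1_J t)%:E) = K%:E * N (fun t => (\1_J t)%:E).
  by rewrite -(ri_homogeneous hN K0 p1).
rewrite (ri_homogeneous hN C0 pa).
have fin x (c : R) : 0 <= x -> x < +oo -> c%:E * x < +oo.
  by move=> x0 xoo; rewrite -(@fineK _ x) ?ge0_fin_numE// -EFinM ltry.
apply: lte_add_pinfty; apply: fin => //.
- exact: (ri_ge0 hN).
- exact: (ri_ge0 hN).
- exact: (ri_indic hN).
Qed.

Hypothesis h_fin : N (fun t => (u t)%:E *
    (\1_(ioo 0 (nuinv L nu (endpoint L))%:E) t)%:E *
    \int[leb]_(s in ioo (nu t) (endpoint L)%:E) (v s)%:E) < +oo.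

Lemma hardy_cut_endpoint_fin : (endpoint L)%:E <= L -> N (hardy_cut (endpoint L)) < +oo.
Proof.
move=> aL; have pa := hardy_cut_Mplus aL.
pose Phi t := (u t)%:E * (\1_(ioo 0 (nuinv L nu (endpoint L))%:E) t)%:E *
    \int[leb]_(s in ioo (nu t) (endpoint L)%:E) (v s)%:E.
have PhiE t : ioo 0 L t -> hardy_cut (endpoint L) t = Phi t.
  move=> It; rewrite /Phi indicE; have [t0 tL] := It.
  have [tJ|tJ] := boolP (t \in _); first by rewrite mule1.
  rewrite mule0 mul0e /hardy_cut (_ : ioo (nu t) _ = set0) ?integral_set0 ?mule0//.
  apply/seteqP; split=> // x [nx xa].
  (* When the endpoint is L, the convention nu^-1(L) = L makes the indicator equal to 1 on all of
     (0, L). *)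
  have [aEL|aL'] := eqVneq (endpoint L)%:E L.
    move/negP : tJ; case; rewrite inE; split=> //.
    by rewrite /nuinv aEL eqxx -[X in _ < X]aEL in tL *.
  have Ia : ioo 0 L (endpoint L).
    split; last by rewrite lt_neqAle aL'.
    have [nt0 _] := nu_ioo hnu It.
    by apply: (lt_trans nt0); apply: (lt_trans nx); rewrite -lte_fin.
  move/negP : tJ; case; rewrite inE; split=> //.
  rewrite lte_fin (lt_nuinv hnu It Ia); apply: (lt_trans nx).
  by rewrite -lte_fin.
have pPhi : Mplus L Phi.
  case: pa => ma a0; split; first exact: (eq_M PhiE ma).
  by apply: ae_onS a0 => t It; rewrite PhiE.
by rewrite (ri_norm_ae hN pa pPhi) ?h_fin//; exact: ae_onW.
Qed.

Lemma hardy_rearr_indic_fin (E : set (lebR R)) : measurable E -> E `<=` ioo 0 L ->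
  leb E < +oo -> N (Hop L u v nu (rearr L (fun x => (\1_E x)%:E))) < +oo.
Proof.
move=> mE EI Efin; have E_fin : leb E \is a fin_num by rewrite ge0_fin_numE.
have [m mL [Em Nm]] : exists2 m : R, m%:E <= L & leb E <= m%:E /\ N (hardy_cut m) < +oo.
  have EL : leb E <= L by rewrite -(leb_ioo0 L0); apply: le_leb; [exact: mE|exact: mI|].
  have [aEL|aL] := eqVneq (endpoint L)%:E L.
    by exists (endpoint L); rewrite aEL//; split=> //; apply: hardy_cut_endpoint_fin; rewrite aEL.
  have Loo : L = +oo by move: hL aL; case: (L) => //= r _; rewrite eqxx.
  have endE : endpoint L = 1%R by rewrite Loo.
  have I1 (m : R) : (0 < m)%R -> ioo 0 L m by move=> m0; split=> //; rewrite Loo ltry.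
  (* At least |E| for the comparison with [hardy_cut m], and at least 1 so that finiteness carries
     over from the endpoint 1. *)
  pose m := Num.max (fine (leb E)) 1%R.
  have m1 : (1 <= m)%R by rewrite le_max lexx orbT.
  exists m; first by rewrite Loo leey.
  split; first by rewrite -(fineK E_fin) lee_fin le_max lexx.
  apply: (@hardy_cut_norm_fin 1%R); [exact: I1|by apply: I1; lra|exact: m1|].
  by rewrite -endE; apply: hardy_cut_endpoint_fin; rewrite Loo leey.
have pHop : Mplus L (Hop L u v nu (rearr L (fun x => (\1_E x)%:E))).
  have -> : Hop L u v nu (rearr L (fun x => (\1_E x)%:E)) =
      hardy (fun s => `|rearr L (fun x => (\1_E x)%:E) s|) by [].
  apply: hardy_Mplus => //.
  by apply: leb_measurable_abs; exact: rearr_M.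
apply: le_lt_trans Nm; apply: (ri_monotone hN pHop (hardy_cut_Mplus mL)).
by apply: ae_onW => t; exact: hardy_rearr_indic_le.
Qed.

Hypothesis T_bounded : bounded_op L (associate L N) T.

Let zero_Mplus : Mplus L (fun=> 0).
Proof. by apply: Mplus_ge0 => //; exact: leb_measurable_cst. Qed.

Let zero_associate : associate L N (fun=> 0) <= 1.
Proof.
apply: ge_ereal_sup => _ [h _ <-].
have -> : \int[leb]_(x in ioo 0 L) (0 * h x) = \int[leb]_(x in ioo 0 L) (0 : \bar R).
  by apply: leb_eq_integral => x _; rewrite mul0e.
by rewrite integral0.
Qed.

Lemma T_bound_gt0 : exists2 C : R, (0 < C)%R & op_bound L (associate L N) T C.
Proof.
have [C hC] := T_bounded.
have [k [k0 hk]] := op_bound_ge.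
by exists C => //; exact: lt_le_trans (hk _ hC).
Qed.

Lemma rho_tilde_le_rho : exists2 C : R, (0 < C)%R &
  forall f, Mplus L f -> rho_tilde L N u v nu phi f <= C%:E * rho L N u v nu f.
Proof.
have [C C0 hC] := T_bound_gt0; exists C => // f pf.
apply: le_trans (rho_tilde_le_bound hC C0 pf) _.
apply: lee_wpmul2l; first by rewrite lee_fin ltW.
exact: (hardy_rearr_le_rho pf).
Qed.

Lemma rho_tilde_indic_fin (E : set (lebR R)) : measurable E -> E `<=` ioo 0 L ->
  leb E < +oo -> rho_tilde L N u v nu phi (fun x => (\1_E x)%:E) < +oo.
Proof.
move=> mE EI Efin; have [C C0 hC] := T_bound_gt0.
have p1 : Mplus L (fun x => (\1_E x)%:E) by exact: indic1_Mplus.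
apply: le_lt_trans (rho_tilde_le_bound hC C0 p1) _.
have NH := hardy_rearr_indic_fin mE EI Efin.
have [->|Nn] := eqVneq (N (Hop L u v nu (rearr L (fun x => (\1_E x)%:E)))) -oo.
  by rewrite gt0_muleNy ?lte_fin// ltNyr.
rewrite -[N _]fineK; first by rewrite -EFinM ltry.
by rewrite fin_numE Nn lt_eqF.
Qed.

Lemma ri_norm_rho_tilde : ri_norm L (rho_tilde L N u v nu phi).
Proof.
apply: (@ri_norm_of_weights _ _ hL [set hardy_dual (T g) | g in
    [set g | Mplus L g /\ associate L N g <= 1]]).
- by exists (hardy_dual (T (fun=> 0))); exists (fun=> 0).
- move=> _ [g [[mg _] _] <-].
  exact: dual_Top_M.
- exact: rho_tildeE.
- exact: rho_tilde_indic_fin.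
- move=> E mE EI Efin.
  exact: rho_tilde_local_integral.
Qed.

(** (P4) is inherited through rho <= rho_tilde, and (P5) through rho_tilde <= C rho. *)
Lemma ri_norm_rho : ri_norm L (rho L N u v nu).
Proof.
apply: (@ri_norm_of_weights _ _ hL [set hardy_dual g | g in dual_ball]).
- by exists (hardy_dual (fun=> 0)); exists (fun=> 0).
- move=> _ [g [[mg _] g0 _] <-].
  by apply: hardy_dual_M.
- exact: rhoE.
- move=> E mE EI Efin.
  have p1 : Mplus L (fun x => (\1_E x)%:E) by exact: indic1_Mplus.
  apply: le_lt_trans (rho_tilde_indic_fin mE EI Efin).
  exact: rho_le_rho_tilde.
- move=> E mE EI Efin; have [C C0 hC] := rho_tilde_le_rho.
  have [C' [C'0 hC']] :=
    rho_tilde_local_integral mE EI Efin.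
  exists (C' * C)%R; split; first exact: mulr_gt0.
  move=> f pf; apply: (le_trans (hC' f pf)); rewrite EFinM -muleA.
  by apply: lee_wpmul2l; [rewrite lee_fin ltW|exact: hC].
Qed.

(** The bound holds for each admissible C, and [op_norm] is their infimum. Division by H gives the
    claim when 0 < H < oo; for H = 0 any C does, and for H = oo the positive lower bound on all C
    makes the right side infinite. *)
Lemma rho_tilde_le_op_norm f : Mplus L f -> rho_tilde L N u v nu phi f <=
  op_norm L (associate L N) T * N (Hop L u v nu (rearr L f)).
Proof.
move=> pf; set H := N _.
have [k [k0 hk]] := op_bound_ge.
have bound C : op_bound L (associate L N) T C ->
    rho_tilde L N u v nu phi f <= C%:E * H.
  move=> hC; have C0 := lt_le_trans k0 (hk _ hC).
  exact: (rho_tilde_le_bound hC C0 pf).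
have k_le : k%:E <= op_norm L (associate L N) T.
  by apply: le_ereal_inf_tmp => _ [C hC <-]; rewrite lee_fin; exact: hk.
have op_gt0 : 0 < op_norm L (associate L N) T by apply: lt_le_trans k_le; rewrite lte_fin.
have H0 : 0 <= H.
  apply: (ri_ge0 hN).
  apply: hardy_Mplus => //.
  by apply: leb_measurable_abs; exact: rearr_M.
have [C hC] := T_bounded.
have [Hoo|Hfin] := eqVneq H +oo; first by rewrite Hoo gt0_muley// leey.
have [H00|Hn0] := eqVneq H 0.
  by apply: (le_trans (bound _ hC)); rewrite H00 !mule0.
have H_fin : H \is a fin_num by rewrite ge0_fin_numE// lt_neqAle Hfin leey.
have h0 : (0 < fine H)%R by rewrite -lte_fin fineK// lt_neqAle eq_sym Hn0.
rewrite -(fineK H_fin) muleC -lee_pdivrMl//.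
apply: le_ereal_inf_tmp => _ [C' hC' <-].
by rewrite lee_pdivrMl// muleC fineK//; exact: bound.
Qed.

End Hardy.



Theorem proposition3p12 (R : realType) (L : \bar R) (hL : 0 < L)
  (N : (R -> \bar R) -> \bar R) (hN : ri_norm L N)
  (nu : R -> R) (hnu : increasing_bij L nu)
  (hnuD : L = +oo -> D_inf_lower nu)
  (u : R -> R)
  (u_gt0 : forall t, ioo 0 L t -> (0 < u t)%R)
  (u_noninc : {in ioo 0 L &, nonincreasing_fun u})
  (xi : R -> R)
  (xi_gt0 : forall t, ioo 0 L t -> (0 < xi t)%R)
  (xi_meas : measurable_fun (ioo 0 L : set (lebR R)) xi)
  (v : R -> R)
  (v_gt0 : forall t, ioo 0 L t -> (0 < v t)%R)
  (v_def : forall t, ioo 0 L t ->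
     ((v t)^-1)%:E = \int[leb]_(s in ioo 0 (nuinv L nu t)%:E) (xi s)%:E)
  (v_left : L < +oo -> (0 < left_lim v (fine L))%R)
  (h_fin : let a := endpoint L in
     N (fun t => (u t)%:E * (\1_(ioo 0 (nuinv L nu a)%:E) t)%:E *
                 \int[leb]_(s in ioo (nu t) a%:E) (v s)%:E) < +oo) :
  let phi : R -> R := fun t => (u t / xi t)%R in
  bounded_op L (associate L N) (Top L phi) ->
  [/\ ri_norm L (rho L N u v nu),
      ri_norm L (rho_tilde L N u v nu phi),
      (forall f : R -> \bar R, Mplus L f ->
         [/\ N (Hop L u v nu (rearr L f)) <= rho L N u v nu f,
             rho L N u v nu f <= rho_tilde L N u v nu phi f &
             rho_tilde L N u v nu phi f <=
               op_norm L (associate L N) (Top L phi) *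
               N (Hop L u v nu (rearr L f))]) &
      equivalent_functionals L (rho L N u v nu) (rho_tilde L N u v nu phi)].
Proof.
move=> phi T_bounded.
have le_tilde f : Mplus L f -> rho L N u v nu f <= rho_tilde L N u v nu phi f.
  exact: (rho_le_rho_tilde hnu u_gt0 u_noninc xi_gt0 xi_meas v_gt0 v_def hL hN).
split.
- exact: (ri_norm_rho hnu u_gt0 u_noninc xi_gt0 xi_meas v_gt0 v_def hL hN).
- exact: (ri_norm_rho_tilde hnu u_gt0 u_noninc xi_gt0 xi_meas v_gt0 v_def hL hN).
- move=> f pf; split.
  + exact: (hardy_rearr_le_rho nu u v N hL pf).
  + exact: le_tilde.
  + exact: (rho_tilde_le_op_norm hnu u_gt0 u_noninc xi_gt0 xi_meas v_gt0 v_def hL hN).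
split; first by exists 1%R => f pf; rewrite mul1e; exact: le_tilde.
have [C _ hC] :=
  rho_tilde_le_rho hnu u_gt0 u_noninc xi_gt0 xi_meas v_gt0 v_def hL hN T_bounded.
by exists C.
Qed.
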